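(* Let $n\ge 2$ be an integer. There exists a continuous positive function $\phi_n:\mathbb{R}\to\mathbb{R}$ such that for all intervals $I\subseteq\mathbb{R}$ $$\Phi_n(Q,I)=\frac{Q^{n+1}}{2\zeta(n+1)}\int_I\phi_n(x)\,dx+O\!\left(Q^n(\ln Q)^{\ell(n)}\right)\qquad (Q\to\infty),$$ where the implicit constant in the big-O notation depends only on $n$ (in particular it does not depend on $I$; the endpoints of $I$ may be functions of $Q$ or take the values $\pm\infty$). For infinitely many intervals $I=I(Q)$ the true order of the remainder term $$\Phi_n(Q,I)-\frac{Q^{n+1}}{2\zeta(n+1)}\int_I\phi_n(x)\,dx$$ is $Q^n$ as $Q\to\infty$. The function $\phi_n$ satisfies $$\phi_n(-x)=\phi_n(x)\quad\text{for all }x\in\mathbb{R},\qquad x^2\phi_n(x)=\phi_n\!\left(\frac1x\right)\quad\text{for all }x\in\mathbb{R}\setminus\{0\},$$ and it can be written explicitly as $$\phi_n(x)=\int_{\Delta_n(x)}\left|\sum_{k=1}^n k\,p_k x^{k-1}\right|dp_1\cdots dp_n,\qquad x\in\mathbb{R},$$ where $$\Delta_n(x)=\left\{(p_1,\ldots,p_n)\in\mathbb{R}^n:\ \max_{1\le k\le n}|p_k|\le 1,\ \left|\sum_{k=1}^n p_kx^k\right|\le 1\right\}.$$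
   Context: For a polynomial $p(x)=a_nx^n+\dots+a_1x+a_0$ of degree $n$, its height is $H(p)=\max_{0\le i\le n}|a_i|$. The minimal polynomial of an algebraic number $\alpha$ is a polynomial $p\in\mathbb{Z}[x]$ of minimal degree with $p(\alpha)=0$ and with the greatest common divisor of its coefficients equal to $1$; the degree $\deg(\alpha)$ and height $H(\alpha)$ are the degree and height of this minimal polynomial. For $Q>1$, $\mathbb{A}_n(Q)$ is the set of real algebraic numbers $\alpha$ with $\deg(\alpha)=n$ and $H(\alpha)\le Q$, and for $S\subseteq\mathbb{R}$, $\Phi_n(Q,S)=\#(\mathbb{A}_n(Q)\cap S)$. The function $\zeta$ is the Riemann zeta function. Put $\ell(2)=1$ and $\ell(n)=0$ for $n\ge3$. The big-O statement as $Q\to\infty$ means that there are constants $C,Q_0$ depending only on $n$ such that the absolute value of the remainder is at most $CQ^n(\ln Q)^{\ell(n)}$ for all $Q\ge Q_0$ and all intervals $I$. The true order of a quantity $X$ is $Y$ if $c_1Y\le|X|\le c_2Y$ with positive constants $c_1,c_2$ depending, perhaps, on some fixed parameters (here $n$ and the chosen family of intervals $Q\mapsto I(Q)$, but not $Q$); so the second assertion says that there are infinitely many families of intervals $Q\mapsto I(Q)$ for each of which this holds for all sufficiently large $Q$. *)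

(* Defs.v *)
From HB Require Import structures.
From mathcomp Require Import all_boot all_order all_algebra.
From mathcomp Require Import all_classical all_reals all_analysis.

Set Implicit Arguments.
Unset Strict Implicit.
Unset Printing Implicit Defensive.

Import Order.TTheory GRing.Theory Num.Theory.
Import numFieldNormedType.Exports.

Local Open Scope classical_set_scope.
Local Open Scope ring_scope.

(* MathComp-Analysis has the product sigma-algebra on n.-tuple T but no
   Lebesgue measure on it; we build it by iterating the binary product:
   the measure on n.+1-tuples is the image of lambda \x lambda_n under
   (x, p) |-> x :: p. *)
Section lebesgue_tuple.
Context (R : realType).
Let T : measurableType _ := measurableTypeR R.

Definition cons_pair n (u : T * n.-tuple T) : n.+1.-tuple T :=
  [tuple of u.1 :: u.2].

Lemma measurable_cons_pair n :
  measurable_fun [set: T * n.-tuple T] (@cons_pair n).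
Proof. exact: measurable_cons. Qed.

Section step.
Context n (m : {sigma_finite_measure set (n.-tuple T) -> \bar R}).

Definition lebesgue_cons : set (n.+1.-tuple T) -> \bar R :=
  pushforward (lebesgue_measure \x m)%E (@cons_pair n).

Let lebesgue_cons0 : lebesgue_cons set0 = 0%E.
Proof. by rewrite /lebesgue_cons /pushforward preimage_set0 measure0. Qed.

Let lebesgue_cons_ge0 A : (0 <= lebesgue_cons A)%E.
Proof. by rewrite /lebesgue_cons /pushforward measure_ge0. Qed.

Let lebesgue_cons_sigma_additive : semi_sigma_additive lebesgue_cons.
Proof.
move=> F mF tF mUF; rewrite /lebesgue_cons /pushforward preimage_bigcup.
have mp k : measurable (@cons_pair n @^-1` F k).
  by rewrite -[X in measurable X]setTI; exact: measurable_cons_pair.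
apply: measure_semi_sigma_additive => //.
- apply/trivIsetP => /= i j _ _ ij; rewrite -preimage_setI.
  by move/trivIsetP : tF => -> //; rewrite preimage_set0.
- exact: bigcupT_measurable.
Qed.

HB.instance Definition _ := isMeasure.Build _ _ _ lebesgue_cons
  lebesgue_cons0 lebesgue_cons_ge0 lebesgue_cons_sigma_additive.

Let lebesgue_cons_sigma_finite : sigma_finite setT lebesgue_cons.
Proof.
have /sigma_finiteP[F [TF ndF Foo]] := @sigma_finiteT _ _ _ (@lebesgue_measure R).
have /sigma_finiteP[G [TG ndG Goo]] := sigma_finiteT m.
pose g (p : n.+1.-tuple T) : T * n.-tuple T := (thead p, [tuple of behead p]).
have mg : measurable_fun setT g.
  apply/measurable_fun_pairP; split; last exact: measurable_behead.
  exact: measurable_tnth.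
exists (fun k => g @^-1` (F k `*` G k)) => [|k].
  apply/esym; rewrite -subTset => p _.
  have [i _ Fi] : (\bigcup_i F i) (thead p) by rewrite -TF.
  have [j _ Gj] : (\bigcup_i G i) [tuple of behead p] by rewrite -TG.
  exists (maxn i j) => //; split => /=.
    by move: Fi; exact/subsetPset/ndF/leq_maxl.
  by move: Gj; exact/subsetPset/ndG/leq_maxr.
have [mFk Fkoo] := Foo k; have [mGk Gkoo] := Goo k; split.
  by rewrite -[X in measurable X]setTI; apply: mg => //; exact: measurableX.
rewrite /lebesgue_cons /pushforward -comp_preimage.
rewrite (_ : g \o @cons_pair n = id) ?preimage_id.
  by rewrite product_measure1E// lte_mul_pinfty// ge0_fin_numE.
by apply/funext => -[x p]; rewrite /g /cons_pair /=; congr pair; apply/val_inj.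
Qed.

HB.instance Definition _ := Measure_isSigmaFinite.Build _ _ _ lebesgue_cons
  lebesgue_cons_sigma_finite.

End step.

Fixpoint lebesgue_tuple n : {sigma_finite_measure set (n.-tuple T) -> \bar R} :=
  match n with
  | 0 => \d_([tuple] : 0.-tuple T)
  | k.+1 => lebesgue_cons (lebesgue_tuple k)
  end.

(* This determines lebesgue_tuple n: it is the usual Lebesgue measure. *)
Lemma lebesgue_tuple_box n (A : 'I_n -> set T) :
  (forall i, measurable (A i)) ->
  lebesgue_tuple n [set p | forall i, A i (tnth p i)] =
  (\prod_(i < n) lebesgue_measure (A i))%E.
Proof.
elim: n A => [|n IH] A mA.
  rewrite big_ord0 /= diracE mem_set //.
  by case.
rewrite big_ord_recl -IH //=.
rewrite /lebesgue_cons /pushforward -product_measure1E //.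
  congr (_ _); apply/seteqP; split => [[x p] /= h|[x p] /= [h0 h1] i].
    split => /=; first exact: (h ord0).
    by move=> i; have := h (lift ord0 i); rewrite tnthS.
  by have [j ->|->//] := unliftP ord0 i; rewrite tnthS; exact: h1.
rewrite (_ : mkset _ = \big[setI/setT]_(i < n)
   ((@tnth n T ^~ i) @^-1` A (lift ord0 i))).
  apply: bigsetI_measurable => i _.
  by rewrite -[X in measurable X]setTI; exact: measurable_tnth.
rewrite -bigcap_seq; apply/seteqP; split => p /= h i => [_|]; first exact: h.
by apply: h; rewrite /= mem_index_enum.
Qed.

End lebesgue_tuple.

Section algebraic_numbers.
Context (R : realType).

(* zcontents p is the gcd of the coefficients of p, up to sign.  The minimal
   polynomial is determined up to sign, which does not affect its height. *)
Definition is_min_poly (alpha : R) (p : {poly int}) : Prop :=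
  [/\ root (map_poly intr p) alpha,
      `|zcontents p|%N = 1%N &
      forall q : {poly int}, q != 0 -> root (map_poly intr q) alpha ->
        (size p <= size q)%N].

Definition height (p : {poly int}) : nat := \max_(i < size p) `|(p`_i)%R|%N.

Definition algebraic_numbers (n : nat) (Q : R) : set R :=
  [set alpha | exists p : {poly int},
    [/\ is_min_poly alpha p, (size p).-1 = n & (height p)%:R <= Q]].

(* Extended real: +oo if the set is infinite. *)
Definition Phi (n : nat) (Q : R) (S : set R) : \bar R :=
  counting (algebraic_numbers n Q `&` S).

End algebraic_numbers.

Section density.
Context (R : realType).

(* For s > 1. *)
Definition zeta (s : R) : R := limn (series (fun k : nat => k.+1%:R `^ (- s))).

Definition ell (n : nat) : nat := if n == 2%N then 1%N else 0%N.

(* The coordinate p_k (1 <= k <= n) is tnth p (k - 1). *)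
Definition Delta n (x : R) : set (n.-tuple (measurableTypeR R)) :=
  [set p | \big[Num.max/0]_(k < n) `|tnth p k : R| <= 1 /\
           `| \sum_(k < n) (tnth p k : R) * x ^+ k.+1 | <= 1].

(* Extended real: a finite bound on it forces Phi n Q [set` I] and the integral
   to be finite (+oo - +oo is -oo here). *)
Definition remainder (n : nat) (phi : R -> R) (Q : R) (I : interval R) : \bar R :=
  (Phi n Q [set` I] -
   (Q ^+ n.+1 / (2 * zeta n.+1%:R))%:E *
     \int[lebesgue_measure]_(x in [set` I]) (phi x)%:E)%E.

Definition true_order (X : R -> \bar R) (Y : R -> R) : Prop :=
  exists c1 c2 Q0 : R, [/\ 0 < c1, 0 < c2 &
    forall Q, Q0 <= Q ->
      ((c1 * Y Q)%:E <= `|X Q|)%E /\ (`|X Q| <= (c2 * Y Q)%:E)%E].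

(* Families are compared as sets and for large Q only: changing the values of
   a family for small Q does not give a new one. *)
Definition infinitely_many_families (P : (R -> interval R) -> Prop) : Prop :=
  exists J : nat -> R -> interval R, (forall i, P (J i)) /\
    forall i j, i != j -> forall Q0, exists Q,
      Q0 <= Q /\ [set` J i Q] != [set` J j Q] :> set R.

End density.

Arguments Delta {R} n x.

(* Main.v *)
Require Import Defs.
From HB Require Import structures.
From mathcomp Require Import all_boot all_order all_algebra.
From mathcomp Require Import all_classical all_reals all_analysis.
From mathcomp Require Import measurable_realfun.
From mathcomp Require Import polyrcf.
From mathcomp Require Import ring lra zify.
Set Implicit Arguments.
Unset Strict Implicit.
Unset Printing Implicit Defensive.
Import Order.TTheory GRing.Theory Num.Theory.
Import numFieldNormedType.Exports.
Local Open Scope classical_set_scope.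
Local Open Scope ring_scope.

(** An algebraic number of degree n and height at most Q is a root of exactly
    two polynomials, p and -p, among the irreducible primitive integer
    polynomials in the box of degree at most n and height at most Q.  So the
    theorem is about the number of pairs (p, x) with p an integer point of the
    box and x a root of p in I; primitivity and irreducibility are restored
    afterwards.

    Main term.  Rescaled by 2/L, L = 2M+1, the integer polynomials of height at
    most M become the centres of the L^(n+1) cells of [-1,1]^(n+1).  Write such
    a polynomial as f + t with f(0) = 0.  For f fixed, the number of pairs
    (t, x) with f(x) + t = 0 is L/2 times the integral of |f'| over the points
    of I where |f| <= 1, up to a bounded error: between two roots of f' each
    level is reached at most once, and the levels reached form an interval
    (variation_level_count).  The integral of that quantity over the
    coefficients of f is, by Tonelli, the integral of phi_n over I, phi_n being
    the function of the explicit formula (integral_density).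

    Uniformity.  To pass from the sum over the grid of polynomials f to the
    integral, observe that the integral over the cube is the average, over all
    translates of the grid inside a cell, of the grid sums (integral_cube_le,
    integral_cube_ge), so it is enough that translations hardly change the
    number of roots.  This is a one-coefficient question: on the line
    p = g + t X^k, Rolle's theorem for p / X^k cuts I into boundedly many
    pieces, independent of t, on which each p has at most one root, and the t
    for which there is a root form an interval (grid_stable_coef).  Moving a
    grid in one coordinate changes the count of points in an interval by at
    most one.  The resulting error O(M^n) depends on n only, whatever I is
    (root_total_asymp).

    From all polynomials to primitive ones.  Grouping polynomials by content
    gives T(M) = sum of P(M/d) over d, so that the error of P satisfies a
    recursion in which the terms d >= 2 have total weight less than 1; this
    yields 1/zeta(n+1) with error O(M^n) (inversion, prim_total_asymp).

    Reducible polynomials.  By Gelfond's inequality (gelfond) the product of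
    the heights of the factors is at most a constant times M.  Counting the
    pairs of factors gives O(M^n), with a logarithm only from the products of
    two linear factors (reducibles_asymp).  Polynomials of degree less than n
    are O(M^n) in number.

    The function phi_n is continuous by dominated convergence, since a
    hyperplane is negligible, and positive because a small box of coefficients
    contributes (continuous_phi, phi_gt0).  Its symmetries come from counting:
    x -> -x and x -> 1/x permute the polynomials of the box, so the integrals of
    phi_n over I and over its image have the same asymptotics, hence are equal,
    and differentiating with respect to the length of I gives the functional
    equations (phi_transport).

    Optimality.  An integer polynomial of height at most Q with nonzero
    constant term has no root in the interval from 0 to 1/(2Q).  On
    ]0, 1/((i+2)Q)[ the count is therefore 0, while the main term is of order
    Q^(n+1) / Q = Q^n because phi_n(0) > 0 (near0_true_order). *)

(** * Counting the real roots of a polynomial in an interval *)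

Section root_count.
Context (R : realType).
Implicit Types (S : pred R) (p g : {poly R}).

(** The zero polynomial has no root for this count, because rootsR 0 is empty;
    it is one point of the grids below and only affects error terms. *)
Definition nroots S p : nat := count S (rootsR p).

Lemma nroots0 S : nroots S 0 = 0%N.
Proof. by rewrite /nroots rootsR0. Qed.

Lemma mem_rootsR p x : p != 0 -> (x \in rootsR p) = root p x.
Proof. by move=> p0; rewrite -(roots_on_rootsR p0) in_itv. Qed.

Lemma uniq_rootsR p : uniq (rootsR p).
Proof. exact: uniq_roots. Qed.

Lemma root_rootsR p x : x \in rootsR p -> root p x.
Proof.
have [->|p0] := eqVneq p 0; first by rewrite root0.
by rewrite mem_rootsR.
Qed.

Lemma size_rootsR n p : (size p <= n.+1)%N -> (size (rootsR p) <= n)%N.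
Proof.
have [->|p0 sp] := eqVneq p 0; first by rewrite rootsR0.
rewrite -ltnS (leq_trans _ sp)// max_poly_roots// ?uniq_rootsR//.
by apply/allP => x; exact: root_rootsR.
Qed.

Lemma nroots_le n S p : (size p <= n.+1)%N -> (nroots S p <= n)%N.
Proof. by move=> /size_rootsR; exact/leq_trans/count_size. Qed.

Lemma nroots_eqS S S' p : S =1 S' -> nroots S p = nroots S' p.
Proof. by move=> h; exact: eq_count. Qed.

Lemma nroots_bij S S' p p' (f : R -> R) : p != 0 -> p' != 0 ->
    {in S &, injective f} ->
    (forall x, S x -> root p x -> S' (f x) && root p' (f x)) ->
    (forall y, S' y -> root p' y -> exists2 x, S x && root p x & f x = y) ->
  nroots S p = nroots S' p'.
Proof.
move=> p0 p'0 finj h1 h2; rewrite /nroots -!size_filter -(size_map f).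
apply/perm_size/uniq_perm.
- rewrite map_inj_in_uniq ?filter_uniq ?uniq_rootsR//.
  by move=> x y; rewrite !mem_filter => /andP[Sx _] /andP[Sy _]; exact: finj.
- by rewrite filter_uniq ?uniq_rootsR.
move=> y; apply/mapP/idP => [[x] |]; rewrite mem_filter ?mem_rootsR//.
  by move=> /andP[Sx rx] ->; rewrite mem_filter mem_rootsR//; exact: h1.
move=> /andP[/h2/[apply]] [x /andP[Sx rx] <-]; exists x => //.
by rewrite mem_filter mem_rootsR// Sx.
Qed.

Lemma nroots_scale S c p : c != 0 -> nroots S (c *: p) = nroots S p.
Proof.
move=> c0; have [->|p0] := eqVneq p 0; first by rewrite scaler0.
apply: (@nroots_bij _ _ _ _ id); rewrite ?scaler_eq0 ?negb_or ?c0//.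
  by move=> x ->; rewrite rootZ.
by move=> y Sy ry; exists y => //; rewrite Sy rootZ.
Qed.

Lemma nroots_split S z p : nroots S p =
  (nroots [pred x | S x & (x < z)%R] p + nroots [pred x | S x & x == z] p
   + nroots [pred x | S x & (z < x)%R] p)%N.
Proof.
rewrite /nroots; elim: (rootsR p) => //= x s ->.
case: (S x); case: ltgtP => //=; lia.
Qed.

Lemma nroots_unique S p : p != 0 ->
  {in S &, forall x y, root p x -> root p y -> x = y} ->
  nroots S p = `[< exists2 x, S x & root p x >].
Proof.
move=> p0 h; rewrite /nroots; case: asboolP => [[x Sx rx]|nx].
  rewrite -size_filter (_ : [seq y <- rootsR p | S y] = [:: x])//.
  apply: perm_small_eq => //; apply: uniq_perm => //.
    by rewrite filter_uniq ?uniq_rootsR.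
  move=> y; rewrite mem_filter mem_rootsR// inE.
  apply/idP/eqP => [/andP[Sy ry]|->]; [exact: h|exact/andP].
apply/eqP; rewrite eqn0Ngt -has_count; apply/hasP => -[x].
by rewrite mem_rootsR// => rx Sx; apply: nx; exists x.
Qed.

Definition convex S := forall x y z, S x -> S z -> x <= y <= z -> S y.

Lemma convex_lt S (z : R) : convex S -> convex [pred x | S x & (x < z)%R].
Proof.
move=> cS x y t /= /andP[Sx xz] /andP[St tz] /[dup] xyt /andP[_ yt].
by rewrite (cS _ _ _ Sx St xyt) /= (le_lt_trans yt).
Qed.

Lemma convex_gt S (z : R) : convex S -> convex [pred x | S x & (z < x)%R].
Proof.
move=> cS x y t /= /andP[Sx xz] /andP[St tz] /[dup] xyt /andP[xy _].
by rewrite (cS _ _ _ Sx St xyt) /= (lt_le_trans xz).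
Qed.

Lemma convex_eq S (z : R) : convex S -> convex [pred x | S x & x == z].
Proof.
move=> cS x y t /= /andP[Sx /eqP xz] /andP[St /eqP tz]; rewrite xz tz => /le_anti<-.
by rewrite -xz Sx eqxx.
Qed.

(** Cutting principle.  A quantity that is additive under cutting an interval
    at a point and at most 1 on the pieces cut out by zs is bounded on the whole
    interval.  Each cut produces three pieces, hence the crude 3 ^ size zs; the
    pieces reduced to a cut point are why the condition on a piece A allows A
    to meet zs in its only point. *)
Lemma convex_split (P : pred R -> nat -> Prop) zs S :
    (forall A z a b c, convex A -> {subset A <= S} ->
       P [pred x | A x & (x < z)%R] a ->
       P [pred x | A x & x == z] b -> P [pred x | A x & (z < x)%R] c ->
       P A (a + b + c)%N) ->
    convex S ->
    (forall A, convex A -> {subset A <= S} ->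
       (forall z, z \in zs -> A z -> forall x, A x -> x = z) -> P A 1%N) ->
  P S (3 ^ size zs)%N.
Proof.
elim: zs S => [|z zs IH] S Padd cS base /=.
  by apply: base.
have cl := @convex_lt S z cS; have cm := @convex_eq S z cS; have cr := @convex_gt S z cS.
rewrite expnS !mulSn mul0n addn0 addnA.
have step (D : pred R) : convex D -> {subset D <= S} ->
   (D z -> forall x, D x -> x = z) -> P D (3 ^ size zs)%N.
  move=> cD sD Dz; apply: IH => //.
    by move=> A w a b c cA sA; apply: Padd => // x /sA /sD.
  move=> A cA sA h; apply: base => // [x /sA/sD//|w].
  rewrite inE => /predU1P[->|]; last exact: h.
  by move=> Az x Ax; apply: Dz; exact: sA.
apply: (Padd _ z) => //; apply: step => //.
- by move=> x /andP[].
- by rewrite /= ltxx andbF.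
- by move=> x /andP[].
- by move=> _ x /= /andP[_ /eqP].
- by move=> x /andP[].
- by rewrite /= ltxx andbF.
Qed.

(** * Translated grids of [-1,1] *)

(** One point in each of the L equal cells of [-1,1], at relative position u. *)
Definition grid L u j : R := 2 * (j%:R + u) / L%:R - 1.

(** Both ends u, v = 0 and 1 are allowed, so translation by a whole cell is
    included. *)
Definition grid_stable C (f : R -> nat) := forall L u v, 0 <= u <= 1 -> 0 <= v <= 1 ->
  (\sum_(j <- iota 0 L) f (grid L u j) <= \sum_(j <- iota 0 L) f (grid L v j) + C)%N.

Lemma grid_stableW C D f : (C <= D)%N -> grid_stable C f -> grid_stable D f.
Proof. by move=> CD h L u v hu hv; apply: leq_trans (h _ _ _ hu hv) _; rewrite leq_add2l. Qed.

Lemma grid_stableD C D (f g : R -> nat) : grid_stable C f -> grid_stable D g ->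
  grid_stable (C + D) (fun t => f t + g t)%N.
Proof.
move=> hf hg L u v hu hv; rewrite !big_split /=.
have := hf L u v hu hv; have := hg L u v hu hv; lia.
Qed.

Lemma grid_mono L u v i j : (i < j)%N -> 0 <= u <= 1 -> 0 <= v <= 1 ->
  grid L u i <= grid L v j.
Proof.
move=> ij /andP[_ u1] /andP[v0 _]; rewrite /grid lerD2r ler_wpM2r ?invr_ge0 ?ler0n//.
rewrite ler_wpM2l// (@le_trans _ _ (i.+1%:R))//; first by rewrite -natr1 lerD2l.
by rewrite (@le_trans _ _ j%:R) ?ler_nat// lerDl.
Qed.

(** Points a and b of two interleaved sequences are counted in an interval: two
    successive points of the first sequence in the interval force the point of
    the second one between them, so at most one point of a is unmatched.  Here
    the point b_j follows a_(j-1); in the next lemma it follows a_j. *)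
Lemma sum_le_next (a b : nat -> bool) m L :
  (forall i j, (i < j)%N -> a i -> a j -> b j) ->
  (\sum_(i <- iota m L) a i <= \sum_(i <- iota m L) b i + 1)%N.
Proof.
move=> h; elim: L m => [|L IH] m; rewrite /= ?big_nil// !big_cons.
case am : (a m); last by rewrite (leq_trans (IH m.+1))// -addnA leq_addl.
rewrite [X in (X <= _)%N]addnC leq_add2r -[leqLHS]add0n leq_add// big_seq [leqRHS]big_seq.
apply: leq_sum => i; rewrite mem_iota => /andP[mi _].
by case ai : (a i) => //; rewrite (h m i).
Qed.

Lemma sum_le_prev (a b : nat -> bool) m L :
  (forall i j, (i < j)%N -> a i -> a j -> b i) ->
  (\sum_(i <- iota m L) a i <= \sum_(i <- iota m L) b i + 1)%N.
Proof.
move=> h; elim: L m => [|L IH] m; rewrite /= ?big_nil// !big_cons.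
case am : (a m); last by rewrite (leq_trans (IH m.+1))// -addnA leq_addl.
have [/hasP[j]|/hasPn none] := boolP (has a (iota m.+1 L)).
  by rewrite mem_iota => /andP[mj _] aj; rewrite (h m j)//= -addnA leq_add2l.
by rewrite big_seq big1 ?addn0 ?leq_addl// => i /none /negbTE ->.
Qed.

Lemma grid_stable_convex A : convex A -> grid_stable 1 A.
Proof.
move=> cA L u v hu hv; have [uv|vu] := leP u v.
  apply: (@sum_le_prev (fun j => A (grid L u j)) (fun j => A (grid L v j))) => i j ij Ai Aj.
  apply: cA Ai Aj _; rewrite (grid_mono L ij)// andbT.
  by rewrite /grid lerD2r ler_wpM2r ?invr_ge0 ?ler0n// ler_wpM2l// lerD2l.
apply: (@sum_le_next (fun j => A (grid L u j)) (fun j => A (grid L v j))) => i j ij Ai Aj.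
apply: cA Ai Aj _; rewrite (grid_mono L ij)//=.
by rewrite /grid lerD2r ler_wpM2r ?invr_ge0 ?ler0n// ler_wpM2l// lerD2l ltW.
Qed.

Lemma grid_stable_cst b : grid_stable 1 (fun=> b : bool).
Proof. by apply: (@grid_stable_convex (fun=> b)) => x y z. Qed.

Lemma grid_stable_eq C (f g : R -> nat) : f =1 g -> grid_stable C f -> grid_stable C g.
Proof. by move=> /funext ->. Qed.

(** Rolle's theorem for p / X^k, whose derivative is
    (X p' - k p) / X^(k+1); the condition on the sign of x y keeps 0 outside the
    interval. *)
Lemma rolle_monomial k p x y : x < y -> 0 < x * y ->
  root p x -> root p y ->
  exists2 z, x < z < y & root ('X * p^`() - k%:R *: p) z.
Proof.
move=> xy xy0 /rootP px /rootP py.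
have nz z : x <= z <= y -> z != 0.
  move=> /andP[xz zy]; apply/eqP => z0; rewrite z0 in xz zy.
  by have := mulr_le0_ge0 xz zy; rewrite leNgt xy0.
pose f z := p.[z] * ('X^k : {poly R}).[z] ^-1.
have dX z : x <= z <= y -> is_derive z 1 f
    (p.[z] *: (- ('X^k : {poly R}).[z] ^- 2 *: ('X^k : {poly R})^`().[z])
      + ('X^k : {poly R}).[z]^-1 *: p^`().[z]).
  move=> /nz z0; apply: is_deriveM; apply: is_deriveV.
  by rewrite hornerXn expf_neq0.
have fder z : z \in `]x, y[ -> derivable f z 1.
  rewrite in_itv/= => /andP[/ltW xz /ltW zy].
  by apply: ex_derive; apply: dX; rewrite xz zy.
have fcont : {within `[x, y], continuous f}.
  apply: derivable_within_continuous => z; rewrite in_itv/= => xzy.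
  by apply: ex_derive; exact: dX.
have [|z] := Rolle xy fder fcont; first by rewrite /f px py !mul0r.
rewrite in_itv /= => xzy h.
have xzy' : x <= z <= y by case/andP: xzy => /ltW -> /ltW ->.
exists z => //; apply/rootP.
have h0 := @derive_val _ _ _ _ _ _ _ h.
have := @derive_val _ _ _ _ _ _ _ (dX z xzy'); rewrite h0 => {h0 h dX fder fcont f}.
have z0 := nz z xzy'.
rewrite hornerD hornerN hornerZ hornerM hornerX derivXn !hornerMn !hornerXn /GRing.scale/=.
case: k => [|k] /= h.
  move: h; rewrite expr0 mulr0n mulr0 mulr0 add0r invr1 mul1r mul0r subr0 => <-.
  by rewrite mulr0.
have zk : z ^+ k != 0 by rewrite expf_neq0.
apply: (mulfI (expf_neq0 k z0)); rewrite mulr0.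
transitivity (z ^+ k.+2 * z ^+ k * 0); last by rewrite mulr0.
by rewrite h -mulr_natr !exprS; field; rewrite z0 zk.
Qed.

(** * Varying one coefficient *)
Section coef_line.
Variables (n k : nat) (S : pred R) (g : {poly R}).
Hypotheses (sg : (size g <= n.+1)%N) (kn : (k <= n)%N) (k0 : (0 < k)%N).
Hypothesis cS : convex S.

Let q := 'X * g^`() - k%:R *: g.

Let line t := g + t *: 'X^k.

Let coef_q i : q`_i = (i%:R - k%:R) * g`_i.
Proof.
rewrite /q coefB coefZ coefXM coef_deriv mulrBl; case: i => [|i] /=.
  by rewrite !mul0r.
by rewrite [i.+1%:R * _]mulr_natl.
Qed.

Let size_q : (size q <= n.+1)%N.
Proof.
apply/leq_sizeP => j nj; rewrite coef_q nth_default ?mulr0//.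
exact: leq_trans sg nj.
Qed.

Let q_line t : 'X * (line t)^`() - k%:R *: line t = q.
Proof.
apply/polyP => i; rewrite coef_q /line coefB coefZ coefXM coef_deriv !coefD !coefZ !coefXn.
case: i => [|i] /=.
  by rewrite (ltn_eqF k0) mulr0; ring.
rewrite -[(_ + _) *+ _]mulr_natl; case: (i.+1 =P k) => [->|_]; last by rewrite mulr0n mulr0; ring.
by rewrite mulr1n mulr1; ring.
Qed.

(** The polynomial q = X p' - k p is the same for all p = g + t X^k.  Cut S at 0
    and at the roots of q.  On a piece, p has at most one root by Rolle's
    theorem for p / X^k, and x is a root exactly when t = - g(x) / x^k; this
    function of x is continuous, so the t for which p has a root in the piece
    form an interval, and an interval contains the same number of points of two
    translated grids, up to one. *)
Lemma grid_stable_coef : grid_stable (3 ^ n.+1) (fun t => nroots S (g + t *: 'X^k)).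
Proof.
have [q0|q0] := eqVneq q 0.
  have gk i : i != k -> g`_i = 0.
    move=> ik; have /eqP := coef_q i; rewrite q0 coef0 eq_sym mulf_eq0 subr_eq0 eqr_nat.
    by rewrite (negbTE ik) => /eqP.
  have lineE t : g + t *: 'X^k = (g`_k + t) *: 'X^k.
    apply/polyP => i; rewrite coefD !coefZ coefXn; case: eqVneq => [->|/gk->].
      by rewrite !mulr1.
    by rewrite !mulr0 addr0.
  have Xk : 'X^k != 0 :> {poly R} by rewrite monic_neq0// monicXn.
  have eE : nroots S 'X^k = `[< exists2 x, S x & root 'X^k x >].
    apply: nroots_unique => // x y _ _; rewrite !rootE !hornerXn !expf_eq0 k0 /=.
    by move=> /eqP -> /eqP ->.
  set e := `[< _ >] in eE.
  (* Here p = (g_k + t) X^k: the count is constant, except at t = - g_k where p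
     is the zero polynomial; the two half-lines cost 1 each. *)
  apply: (@grid_stableW 2); first by rewrite expnS; have := expn_gt0 3 n; lia.
  pose F (t : R) := ((e && (t < - g`_k)%R) + (e && (- g`_k < t)%R))%N.
  refine (@grid_stable_eq 2 F _ _ _).
    move=> t /=; rewrite lineE; rewrite /F; case: (ltgtP t (- g`_k)) => [tc|tc|->]; last first.
      by rewrite subrr scale0r nroots0 ?andbF.
    - by rewrite nroots_scale ?eE ?andbF ?andbT// addrC -(opprK g`_k) subr_eq0 gt_eqF.
    - by rewrite nroots_scale ?eE ?andbF ?andbT ?addn0// addrC -(opprK g`_k) subr_eq0 lt_eqF.
  apply: (@grid_stableD 1 1).
    apply: (@grid_stable_convex (fun t => e && (t < - g`_k)%R)).
    by move=> x y z /andP[-> _] /= hz /andP[_ yz]; apply: le_lt_trans yz hz.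
  apply: (@grid_stable_convex (fun t => e && (- g`_k < t)%R)).
  by move=> x y z /andP[-> /= hx] _ /andP[xy _]; apply: lt_le_trans hx xy.
have linen0 t : line t != 0.
  by apply/eqP => lt; move: (q_line t) q0; rewrite lt deriv0 mulr0 scaler0 subr0 => <-; rewrite eqxx.
have root_line t x : root (line t) x = (g.[x] == - t * x ^+ k).
  by rewrite rootE hornerD hornerZ hornerXn addr_eq0 mulNr.
(* At most n cuts at the roots of q, and one at 0. *)
apply: (@grid_stableW (3 ^ size (0%R :: rootsR q))%N).
  by rewrite leq_pexp2l//= ltnS size_rootsR.
apply: (@convex_split (fun A C => grid_stable C (fun t => nroots A (line t)))) => //.
  move=> A z a b c _ _ ha hb hc.
  apply: grid_stable_eq (grid_stableD (grid_stableD ha hb) hc) => t.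
  by rewrite -(nroots_split A z).
move=> A cA _ nice.
have [A0|nA0] := boolP (A 0).
  have A0' x : A x -> x = 0 by apply: nice; rewrite // mem_head.
  apply: grid_stable_eq (grid_stable_cst (g.[0] == 0)) => t.
  rewrite nroots_unique//; last by move=> x y /A0'-> /A0'->.
  congr nat_of_bool; apply/idP/asboolP.
    by move=> g0; exists 0; rewrite // root_line expr0n (gtn_eqF k0) mulr0.
  by move=> [x /A0' ->]; rewrite root_line expr0n (gtn_eqF k0) mulr0.
have pos x y : A x -> A y -> 0 < x * y.
  move=> Ax Ay; rewrite ltNge; apply: contra nA0 => xy0.
  have [x0|x0] := leP 0 x.
    have [y0|y0] := leP y 0; first by apply: (cA _ _ _ Ay Ax); rewrite y0 x0.
    by apply: (cA _ _ _ Ax Ax); rewrite x0 andbT -(pmulr_lle0 _ y0).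
  apply: (cA _ _ _ Ax Ay); rewrite (ltW x0)/=.
  by rewrite -(nmulr_rle0 _ x0).
have uniqA t : {in A &, forall x y, root (line t) x -> root (line t) y -> x = y}.
  suff lt x y : A x -> A y -> root (line t) x -> root (line t) y -> x < y -> False.
    by move=> x y Ax Ay rx ry; case: (ltgtP x y) => // /lt; case.
  move=> Ax Ay rx ry xy.
  have [z /andP[xz zy]] := rolle_monomial k xy (pos _ _ Ax Ay) rx ry.
  rewrite q_line => rz.
  have Az : A z by apply: (cA _ _ _ Ax Ay); rewrite !ltW.
  by move: xz; rewrite -(nice z _ Az x Ax) ?ltxx// inE mem_rootsR ?rz ?orbT.
apply: (@grid_stable_eq _ (fun t => `[< exists2 x, A x & root (line t) x >])) => [t|].
  by rewrite nroots_unique//; exact: uniqA.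
apply: (@grid_stable_convex (fun t => `[< exists2 x, A x & root (line t) x >])).
move=> t1 t t2 /asboolP[x Ax rx] /asboolP[y Ay ry] /andP[t1t tt2]; apply/asboolP.
have lineE u x' : (line u).[x'] = g.[x'] + u * x' ^+ k.
  by rewrite hornerD hornerZ hornerXn.
(* x and y are the roots for t1 and t2; for t between them, the values at x
   and y are (t - t1) x^k and (t - t2) y^k, of opposite signs as x y > 0. *)
have sgn : (line t).[x] * (line t).[y] <= 0.
  move: rx ry; rewrite !root_line !lineE => /eqP-> /eqP->.
  rewrite [leLHS](_ : _ = - ((t - t1) * (t2 - t) * (x * y) ^+ k)); last by rewrite exprMn; ring.
  by rewrite oppr_le0 !mulr_ge0 ?subr_ge0// exprn_ge0// ltW// pos.
have [xy|yx] := leP x y.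
  have [z] := polyrcf.poly_ivt xy sgn; rewrite in_itv => /= xzy rz.
  by exists z => //; exact: cA xzy.
have [|z] := polyrcf.poly_ivt (p := line t) (ltW yx); first by rewrite mulrC.
rewrite in_itv => /= yzx rz.
by exists z => //; exact: cA yzx.
Qed.

End coef_line.
End root_count.

(** * Midpoint grids and lengths of intervals *)

Section mid_grid.
Context (R : realType).

Lemma count_half_lt L (z : R) : 0 <= z <= L%:R ->
  z - 2^-1 <= (\sum_(j <- iota 0 L) (j%:R + 2^-1 < z)%R)%N%:R.
Proof.
elim: L => [|L IH] in z *.
  by move=> /andP[_ z0]; rewrite big_nil; lra.
move=> /andP[z0 zL]; rewrite -[L.+1]addn1 iotaD big_cat /= big_seq1 add0n natrD.
have [zL'|Lz] := leP z L%:R.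
  by apply: le_trans (IH _ _) _; [rewrite z0|rewrite lerDl ler0n].
have -> : (\sum_(j <- iota 0 L) (j%:R + 2^-1 < z)%R = L)%N.
  rewrite big_seq (eq_bigr (fun=> 1%N)) => [|j]; last first.
    rewrite mem_iota => /andP[_ jL]; have : (j.+1%:R : R) <= L%:R by rewrite ler_nat.
    by rewrite -natr1 => jL'; rewrite (_ : _ < _)//; lra.
  by rewrite -big_seq sum1_size size_iota.
case: (ltP (L%:R + 2^-1) z) => /=; last lra.
by move: zL; rewrite -natr1; lra.
Qed.

Lemma count_half_le L (z : R) : 0 <= z ->
  (\sum_(j <- iota 0 L) (j%:R + 2^-1 <= z)%R)%N%:R <= z + 2^-1.
Proof.
elim: L => [|L IH] in z *.
  by move=> z0; rewrite big_nil; lra.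
move=> z0; rewrite -[L.+1]addn1 iotaD big_cat /= big_seq1 add0n natrD.
case: (leP (L%:R + 2^-1) z) => h /=; last by rewrite addr0; exact: IH.
rewrite [leLHS](_ : _ = L%:R + 1); first by lra.
congr (_%:R + _); rewrite big_seq (eq_bigr (fun=> 1%N)) => [|j]; last first.
  rewrite mem_iota => /andP[_ jL]; have : (j.+1%:R : R) <= L%:R by rewrite ler_nat.
  by rewrite -natr1 => jL'; rewrite (_ : _ <= _)//; lra.
by rewrite -big_seq sum1_size size_iota.
Qed.

Lemma grid_in L j : (j < L)%N -> -1 <= (grid L 2^-1 j : R) <= 1.
Proof.
move=> jL; have jL' : j%:R + 1 <= L%:R :> R by rewrite natr1 ler_nat.
have L0' : 0 < L%:R :> R by rewrite ltr0n (leq_trans _ jL).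
rewrite /grid lerBrDr addNr lerBlDr ler_pdivrMr//.
rewrite divr_ge0 ?mulr_ge0 ?addr_ge0 ?invr_ge0 ?ler0n//=; lra.
Qed.

(** B is an interval with end points a and b inside [-1,1], with either
    convention at the end points.  Since the grid points sit at half-integer
    positions, each end contributes an error of at most 1/2. *)
Lemma count_mid_grid L (B : pred R) (a b : R) : (0 < L)%N -> a <= b ->
  (forall t, a < t < b -> B t && (-1 <= t <= 1)) ->
  (forall t, B t -> -1 <= t <= 1 -> a <= t <= b) ->
  `|L%:R / 2 * (b - a) - (\sum_(j <- iota 0 L) B (grid L 2^-1 j))%N%:R| <= 1.
Proof.
move=> L0 ab h1 h2; have L0' : 0 < L%:R :> R by rewrite ltr0n.
have gridE (j : nat) : grid L 2^-1 j = (j%:R + 2^-1) * (2 / L%:R) - 1 :> R.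
  by rewrite /grid; ring.
have gridin := @grid_in L.
(* If [a, b] sticks out of [-1,1], the hypotheses force a = b. *)
have [inab|] := boolP ((-1 <= a) && (b <= 1)); last first.
  move=> nin; have e : a = b.
    apply/le_anti; rewrite ab /= leNgt; apply: contra nin => ltab.
    apply/andP; split; rewrite leNgt; apply/negP => h.
      have := h1 ((a + Num.min b (-1)) / 2) _; move=> /(_ _)/andP[]//.
        by case: (leP b (-1)) => h3; lra.
      by move=> _; case: (leP b (-1)) => h3; lra.
    have := h1 ((b + Num.max a 1) / 2) _; move=> /(_ _)/andP[]//.
      by case: (leP a 1) => h3; lra.
    by move=> _; case: (leP a 1) => h3; lra.
  rewrite e subrr mulr0 sub0r normrN big_seq big1 ?normr0 ?ler01// => j.
  rewrite mem_iota => /andP[_ /= jL]; case Bj : (B _) => //.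
  have /andP[aj jb] := h2 _ Bj (gridin _ jL).
  have /andP[j1 j2] := gridin _ jL.
  by move: nin; rewrite (le_trans j1 _) ?(le_trans _ j2)//= -?e // e.
case/andP: inab => a1 b1.
(* Positions of the end points, in cells counted from -1. *)
pose x := L%:R / 2 * (a + 1); pose y := L%:R / 2 * (b + 1).
have x0 : 0 <= x by rewrite mulr_ge0 ?divr_ge0 ?ler0n//; lra.
have y0 : 0 <= y by rewrite mulr_ge0 ?divr_ge0 ?ler0n//; lra.
have xL : x <= L%:R.
  by rewrite /x mulrAC ler_pdivrMr// ler_wpM2l ?ler0n//; lra.
have yL : y <= L%:R.
  by rewrite /y mulrAC ler_pdivrMr// ler_wpM2l ?ler0n//; lra.
have -> : L%:R / 2 * (b - a) = y - x by rewrite /x /y; ring.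
have xE j : (x <= j%:R + 2^-1) = (a <= grid L 2^-1 j).
  rewrite gridE lerBrDr mulrA ler_pdivlMr// /x mulrC mulrA ler_pdivrMr//.
have xE' j : (x < j%:R + 2^-1) = (a < grid L 2^-1 j).
  rewrite gridE ltrBrDr mulrA ltr_pdivlMr// /x mulrC mulrA ltr_pdivrMr//.
have yE j : (j%:R + 2^-1 <= y) = (grid L 2^-1 j <= b).
  rewrite gridE lerBlDr mulrA ler_pdivrMr// /y [_ / 2 * _]mulrC mulrA ler_pdivlMr//.
have yE' j : (j%:R + 2^-1 < y) = (grid L 2^-1 j < b).
  rewrite gridE ltrBlDr mulrA ltr_pdivrMr// /y [_ / 2 * _]mulrC mulrA ltr_pdivlMr//.
have := @count_half_lt L x; have := @count_half_lt L y.
rewrite x0 xL y0 yL => /(_ isT) ylt /(_ isT) xlt.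
have xle := count_half_le L x0; have yle := count_half_le L y0.
rewrite ler_norml; apply/andP; split.
- rewrite lerBrDr -lerBrDl opprK.
  have : (\sum_(j <- iota 0 L) B (grid L 2^-1 j) + \sum_(j <- iota 0 L) (j%:R + 2^-1 < x)%R
     <= \sum_(j <- iota 0 L) (j%:R + 2^-1 <= y)%R)%N.
    rewrite -big_split/= big_seq [leqRHS]big_seq leq_sum// => j.
    rewrite mem_iota => /andP[_ /= jL].
    case Bj : (B _); last by case: ltP => // jx; rewrite (_ : _ <= _)//; apply: le_trans (ltW jx) _; rewrite ler_wpM2l ?lerD2r// divr_ge0 ?ler0n.
    have /andP[aj jb] := h2 _ Bj (gridin _ jL).
    by rewrite yE jb ltNge xE aj.
  rewrite -(ler_nat R) natrD; lra.
- rewrite lerBlDr -lerBlDl.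
  have : (\sum_(j <- iota 0 L) (j%:R + 2^-1 < y)%R <= \sum_(j <- iota 0 L) B (grid L 2^-1 j) + \sum_(j <- iota 0 L) (j%:R + 2^-1 <= x)%R)%N.
    rewrite -big_split/= leq_sum// => j _; rewrite yE'.
    case: ltP => // jb; rewrite leNgt xE'; case: ltP => aj; last by rewrite leq_addl.
    by have /andP[-> _] := h1 (grid L 2^-1 j) ltac:(by rewrite aj jb).
  rewrite -(ler_nat R) natrD; lra.
Qed.
End mid_grid.

(** * The area formula for one polynomial *)

Section area.
Context (R : realType).
Local Notation mu := (@lebesgue_measure R).
Implicit Types (S A : pred R) (f : {poly R}).

Definition strip (S : pred R) (f : {poly R}) : set R :=
  [set x | S x /\ `|f.[x]| <= 1].

(** The total variation on S of f clipped to [-1,1]. *)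
Definition variation S f : \bar R :=
  (\int[mu]_(x in strip S f) (`|f^`().[x]|)%:E)%E.

(** The number of solutions of f(x) = - t in S, summed over the levels t of the
    midpoint grid: a Riemann sum for the Banach indicatrix of f, whose integral
    is the variation. *)
Definition level_count (S : pred R) (f : {poly R}) L : nat :=
  \sum_(j <- iota 0 L) nroots S (f + (grid L 2^-1 j)%:P).

Lemma measurable_convex (S : pred R) : convex S -> measurable [set x | S x].
Proof.
move=> cS; apply: is_interval_measurable => x y Sx Sy z; exact: (cS x z y).
Qed.

Lemma measurable_strip S (f : {poly R}) : convex S ->
  measurable (strip S f).
Proof.
move=> cS; apply: measurableI; first exact: measurable_convex.
have mf : measurable_fun setT (horner f) by exact: measurable_poly.
rewrite [X in measurable X](_ : _ = (horner f) @^-1` `[-1, 1]%classic).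
  by rewrite -[X in measurable X]setTI; apply: mf => //; exact: measurable_itv.
by apply/seteqP; split => x /=; rewrite in_itv/= ler_norml.
Qed.

Lemma measurable_absderiv (D : set R) (f : {poly R}) :
  measurable_fun D (fun x => (`|f^`().[x]|)%:E).
Proof.
apply/measurable_EFinP/measurableT_comp; [exact: normr_measurable|exact: measurable_poly].
Qed.

Lemma variation_ge0 S f : (0 <= variation S f)%E.
Proof. by apply: integral_ge0 => x _; rewrite lee_fin. Qed.

Lemma variation_split S f z : convex S -> variation S f =
  (variation [pred x | S x & (x < z)%R] f + variation [pred x | S x & x == z] f +
   variation [pred x | S x & (z < x)%R] f)%E.
Proof.
move=> cS; rewrite /variation -!ge0_integral_setU; last first.
all: try exact: measurable_absderiv.
all: try (apply: measurable_strip; by [apply: convex_lt|apply: convex_gt|apply: convex_eq]).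
all: try (by move=> x _; rewrite lee_fin).
- apply/disj_setPS => x [/= [/andP[_ xz] _] [/andP[_ /eqP xz'] _]].
  by rewrite xz' ltxx in xz.
- apply/disj_setPS => x [/= [] [/andP[_ xz] _] [/andP[_ zx] _]].
    by have := lt_trans xz zx; rewrite ltxx.
  by rewrite (eqP xz) ltxx in zx.
- by apply: measurableU; apply: measurable_strip;[apply: convex_lt|apply: convex_eq].
congr (integral _ _ _); apply/seteqP; split => x /=.
  move=> [Sx fx]; case: (ltgtP x z) => xz; [left; left|right|left; right];
    split => //; apply/andP; split => //; exact/eqP.
by move=> [[|]|] [/andP[]].
Qed.

Lemma level_count_split S f L z : level_count S f L =
  (level_count [pred x | S x & (x < z)%R] f L + level_count [pred x | S x & x == z] f L +
   level_count [pred x | S x & (z < x)%R] f L)%N.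
Proof. by rewrite -!big_split /=; apply: eq_bigr => j _; exact: nroots_split. Qed.

Lemma variation_eq_itv A f a b (b0 b1 : bool) :
  strip A f = [set` Interval (BSide b0 a) (BSide b1 b)] ->
  variation A f = (\int[mu]_(x in `]a, b[) (`|f^`().[x]|)%:E)%E.
Proof.
by move=> e; rewrite /variation e integral_itv_bndoo//; exact: measurable_absderiv.
Qed.

Lemma int_deriv f a b : a < b ->
  (\int[mu]_(x in `]a, b[) (f^`().[x])%:E)%E = (f.[b] - f.[a])%:E.
Proof.
move=> ab; rewrite -(@integral_itv_bndoo _ a b _ true false); last first.
  by apply/measurable_EFinP; exact: measurable_poly.
rewrite (@continuous_FTC2 _ _ (horner f)) ?EFinB//.
- by apply: continuous_subspaceT => x; exact: continuous_horner.
- split; first by move=> x _; exact: derivable_horner.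
    by apply: cvg_at_right_filter; exact: continuous_horner.
  by apply: cvg_at_left_filter; exact: continuous_horner.
- by move=> x _; rewrite -derivE.
Qed.

Lemma strip_itv A f : convex (fun x => `[< strip A f x >]) -> strip A f !=set0 ->
  (exists M, forall x, A x -> `|x| <= M) ->
  exists a b b0 b1, a <= b /\ strip A f = [set` Interval (BSide b0 a) (BSide b1 b)].
Proof.
move=> cA [x0 Ax0] [M hM].
have iA : is_interval (strip A f).
  by move=> x y Ax Ay z h; apply/asboolP; apply: (cA x z y) => //; exact/asboolP.
have hl : has_lbound (strip A f).
  by exists (- M) => x [/hM]; rewrite ler_norml => /andP[].
have hu : has_ubound (strip A f).
  by exists M => x [/hM]; rewrite ler_norml => /andP[].
exists (inf (strip A f)), (sup (strip A f)), `[< strip A f (inf (strip A f)) >],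
  (~~ `[< strip A f (sup (strip A f)) >]); split.
  apply: (@le_trans _ _ x0); first exact: ge_inf.
  by apply: ub_le_sup.
by have /is_intervalP := iA; rewrite /Rhull (asboolT hl) (asboolT hu).
Qed.

Section piece.
Variables (A : pred R) (f : {poly R}) (L : nat).
Hypotheses (cA : convex A) (L0 : (0 < L)%N).
Hypothesis bA : exists M, forall x, A x -> `|x| <= M.
Hypothesis df0 : f^`() != 0.

Lemma levelcount_inj : {in A &, injective (horner f)} ->
  level_count A f L = (\sum_(j <- iota 0 L) `[< exists2 x, A x & f.[x] = - grid L 2^-1 j >])%N.
Proof.
move=> finj; apply: eq_bigr => j _.
have f0 : f + (grid L 2^-1 j)%:P != 0.
  by apply: contra df0 => /eqP /(congr1 deriv); rewrite derivD derivC addr0 deriv0 => ->.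
rewrite nroots_unique//; first congr nat_of_bool.
  apply: asbool_equiv_eq; split=> -[x Ax].
    by rewrite rootE hornerD hornerC addr_eq0 => /eqP; exists x.
  by move=> fx; exists x => //; rewrite rootE hornerD hornerC addr_eq0 fx.
move=> x y Ax Ay; rewrite !rootE !hornerD !hornerC !addr_eq0 => /eqP fx /eqP fy.
by apply: finj => //; rewrite fx fy.
Qed.

(** A single point lies on at most one level, and has variation 0. *)
Lemma piece_point z : (forall x, A x -> x = z) -> exists2 v : R,
  variation A f = v%:E & `|L%:R / 2 * v - (level_count A f L)%:R| <= 1.
Proof.
move=> Az; exists 0.
  rewrite /variation; have [Sz|nSz] := pselect (strip A f z).
    rewrite (_ : strip A f = [set z]) ?integral_set1//.
    by apply/seteqP; split => [x [/Az]|x ->].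
  rewrite (_ : strip A f = set0) ?integral_set0//.
  by apply/seteqP; split => // x Sx; apply: nSz; rewrite -(Az x)//; case: Sx.
rewrite mulr0 sub0r normrN levelcount_inj => [|x y /Az -> /Az ->//].
rewrite normr_nat -[leRHS]/(1%:R) ler_nat -[leqRHS]add0n.
have := @sum_le_next (fun j => `[< exists2 x, A x & f.[x] = - grid L 2^-1 j >]) (fun=> false) 0 L.
rewrite big1_eq; apply=> i j ij /asboolP[x /Az -> fi] /asboolP[y /Az -> fj].
exfalso; move: fj; rewrite fi => /oppr_inj; rewrite /grid => /addIr.
move=> /(mulIf _) => /(_ _)/mulfI => /(_ _ _)/addIr/eqP.
rewrite invr_neq0 ?pnatr_eq0 -?lt0n// => /(_ isT isT).
by rewrite eqr_nat (ltn_eqF ij).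
Qed.

(** s = 1 or -1 is the sign of f' on A.  Then f is injective on A, so the levels
    that it reaches inside [-1,1] form an interval, and the fundamental theorem
    of calculus identifies its length with the variation. *)
Lemma piece_mono (s : R) : s ^+ 2 = 1 -> (forall x, A x -> 0 < s * f^`().[x]) -> exists2 v : R,
  variation A f = v%:E & `|L%:R / 2 * v - (level_count A f L)%:R| <= 1.
Proof.
move=> s1 sf.
have s0 : s != 0 by apply/eqP => s0; move: s1; rewrite s0 expr0n /= => /eqP; rewrite eq_sym oner_eq0.
pose h := s *: f.
have fh x : f.[x] = s * h.[x] by rewrite /h hornerZ mulrA -expr2 s1 mul1r.
have hmono : {in A &, {homo horner h : x y / x < y}}.
  move=> x y Ax Ay xy.
  suff dh : forall z, z \in `]x, y[ -> 0 < h^`().[z].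
    by apply: (ltr_hornerW dh) => //; rewrite in_itv/= lexx (ltW xy).
  move=> z; rewrite in_itv /= => /andP[/ltW xz /ltW zy].
  by rewrite /h derivZ hornerZ sf// (cA Ax Ay)// xz zy.
have hmono' : {in A &, {mono horner h : x y / x <= y}} by apply: le_mono_in.
have finj : {in A &, injective (horner f)}.
  move=> x y Ax Ay; rewrite !fh => /(mulfI s0) e; apply/le_anti.
  by rewrite -(hmono' x y)// -(hmono' y x)// e lexx.
rewrite levelcount_inj//.
have normh x : `|f.[x]| = `|h.[x]|.
  rewrite fh normrM (_ : `|s| = 1) ?mul1r//.
  by apply/eqP; rewrite -sqrp_eq1// ?normr_ge0// real_normK ?num_real// s1.
have [Sn0|S0] := pselect (strip A f !=set0); last first.
  exists 0.
    rewrite /variation (_ : strip A f = set0) ?integral_set0//.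
    by apply/seteqP; split => // x Sx; apply: S0; exists x.
  rewrite mulr0 sub0r normrN big_seq big1 ?normr0 ?ler01// => j.
  rewrite mem_iota => /andP[_ /= jL].
  rewrite asboolF// => -[x Ax fx]; apply: S0; exists x; split => //.
  by rewrite fx normrN ler_norml grid_in.
have cS : convex (fun x => `[< strip A f x >]).
  move=> x y z /asboolP[Ax fx] /asboolP[Az fz] xyz; apply/asboolP.
  have Ay := cA Ax Az xyz; split => //; rewrite normh.
  move: fx fz; rewrite !normh !ler_norml => /andP[fx _] /andP[_ fz].
  case/andP: xyz => xy yz; rewrite -(hmono' _ _ Ax Ay) in xy.
  rewrite -(hmono' _ _ Ay Az) in yz.
  by rewrite (le_trans fx xy) (le_trans yz fz).
have [a [b [b0 [b1 [ab SE]]]]] := strip_itv cS Sn0 bA.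
have Soo x : a < x < b -> strip A f x.
  rewrite SE /= => /andP[ax xb]; rewrite in_itv/=.
  by apply/andP; split; [case: (b0)|case: (b1)] => /=; rewrite ?ltW.
have Scc x : strip A f x -> a <= x <= b.
  rewrite SE /= in_itv/= => /andP[ax xb].
  by move: ax xb; case: (b0); case: (b1) => /= ax xb; apply/andP; split => //; apply: ltW.
have dh x : x \in `]a, b[ -> 0 < h^`().[x].
  by rewrite in_itv/= => /Soo[Ax _]; rewrite /h derivZ hornerZ sf.
have hcc : {in `[a, b] &, {mono horner h : x y / x <= y}} := ler_horner dh.
have ain : a \in `[a, b] by rewrite in_itv/= lexx.
have bin : b \in `[a, b] by rewrite in_itv/= lexx andbT.
have hab : h.[a] <= h.[b] by rewrite hcc.
have VE : variation A f = (h.[b] - h.[a])%:E.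
  rewrite (variation_eq_itv SE); move: ab; rewrite le_eqVlt => /predU1P[->|ab].
    by rewrite set_itvoo0// integral_set0 subrr.
  rewrite -int_deriv//; apply: eq_integral => x; rewrite inE/= => xab.
  rewrite -[in RHS](gtr0_norm (dh x xab)) /h derivZ hornerZ normrM.
  rewrite (_ : `|s| = 1) ?mul1r//.
  by apply/eqP; rewrite -sqrp_eq1// ?normr_ge0// real_normK ?num_real// s1.
have onto v : h.[a] < v < h.[b] -> exists2 x, A x & (`|h.[x]| <= 1) && (h.[x] == v).
  move=> /andP[av vb].
  have hv : (h - v%:P).[a] * (h - v%:P).[b] <= 0.
    rewrite !hornerD !hornerN !hornerC; apply: mulr_le0_ge0; first by rewrite subr_le0 ltW.
    by rewrite subr_ge0 ltW.
  have [x] := polyrcf.poly_ivt ab hv.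
  rewrite in_itv/= => /andP[ax xb]; rewrite rootE hornerD hornerN hornerC subr_eq0 => /eqP hx.
  have [Ax] : strip A f x.
    apply: Soo; rewrite !lt_neqAle ax xb !andbT; apply/andP; split.
      by apply: contraTneq av => ->; rewrite hx ltxx.
    by apply: contraTneq vb => <-; rewrite hx ltxx.
  by rewrite normh => h1; exists x => //; rewrite h1 hx eqxx.
have into x : A x -> `|h.[x]| <= 1 -> h.[a] <= h.[x] <= h.[b].
  rewrite -normh => Ax fx; have xab := Scc _ (conj Ax fx).
  by rewrite !hcc// ?in_itv//=; case/andP: xab.
exists (h.[b] - h.[a]) => //.
have : (s == 1) || (s == -1) by rewrite -sqrf_eq1 s1.
case/orP => /eqP se; rewrite se in fh.
- rewrite (_ : h.[b] - h.[a] = - h.[a] - - h.[b]); last by rewrite opprK addrC.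
  apply: (@count_mid_grid _ _ (fun t => `[< exists2 x, A x & f.[x] = - t >])) => //.
  + by rewrite lerN2.
  + move=> t tab; have [|x Ax /andP[h1 /eqP hx]] := onto (- t); first lra.
    rewrite hx normrN in h1; rewrite -ler_norml h1 andbT; apply/asboolP; exists x => //.
    by rewrite fh mul1r.
  + move=> t /asboolP[x Ax]; rewrite fh mul1r => hx t1; have := into x Ax; rewrite hx normrN ler_norml t1 => /(_ isT) ht; lra.
- apply: (@count_mid_grid _ _ (fun t => `[< exists2 x, A x & f.[x] = - t >])) => //.
  + move=> t tab; have [|x Ax /andP[h1 /eqP hx]] := onto t; first lra.
    rewrite hx in h1; rewrite -ler_norml h1 andbT; apply/asboolP; exists x => //.
    by rewrite fh mulN1r hx.
  + move=> t /asboolP[x Ax]; rewrite fh mulN1r => /oppr_inj hx t1; have := into x Ax.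
    by rewrite hx ler_norml t1 => /(_ isT).
Qed.

End piece.

(** Cut at the roots of f': each piece is a point or has f' of constant sign. *)
Lemma variation_level_count S f L M : convex S -> (0 < L)%N ->
  (forall x, S x -> `|x| <= M) -> (f = 0 \/ f^`() != 0) -> exists2 v : R,
  variation S f = v%:E &
  `|L%:R / 2 * v - (level_count S f L)%:R| <= (3 ^ size (rootsR f^`()))%:R.
Proof.
move=> cS L0 bS [->|df0].
  exists 0.
    rewrite /variation; apply: integral0_eq => x _.
    by rewrite deriv0 horner0 normr0.
  rewrite deriv0 rootsR0 mulr0 sub0r normrN /level_count big1 ?normr0// => j _.
  by rewrite add0r /nroots rootsRC.
apply: (@convex_split _ (fun A C => exists2 v : R, variation A f = v%:E &
  `|L%:R / 2 * v - (level_count A f L)%:R| <= C%:R)) => //.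
  move=> A z a b c cA _ [u Vu hu] [v Vv hv] [w Vw hw].
  exists (u + v + w); first by rewrite (variation_split _ z cA) Vu Vv Vw.
  rewrite (level_count_split A f L z) !natrD.
  move: hu hv hw; rewrite !ler_norml; lra.
move=> A cA sA nice.
have bA : exists M, forall x, A x -> `|x| <= M by exists M => x /sA /bS.
have [[z zA rz]|nz] := pselect (exists2 z, A z & root f^`() z).
  by apply: (piece_point L0 df0) => x; apply: (nice z) => //; rewrite mem_rootsR.
have [[x0 Ax0]|nA] := pselect (exists x, A x); last first.
  by apply: (@piece_point _ _ _ L0 df0 0) => x Ax; case: nA; exists x.
have sgn x y : A x -> A y -> 0 < f^`().[x] * f^`().[y].
  suff W u v : A u -> A v -> u <= v -> 0 < f^`().[u] * f^`().[v].
    by move=> Ax Ay; case: (leP x y) => [/W|/ltW/W]; [exact|rewrite mulrC; exact].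
  move=> Au Av uv; rewrite ltNge; apply/negP => /(polyrcf.poly_ivt uv)[w].
  by rewrite in_itv => /= uwv rw; apply: nz; exists w => //; exact: cA uwv.
have d0 : f^`().[x0] != 0.
  by apply/eqP => d0; have := sgn _ _ Ax0 Ax0; rewrite d0 mul0r ltxx.
apply: (piece_mono cA L0 bA df0 (s := Num.sg f^`().[x0])).
  by rewrite sqr_sg d0.
move=> x Ax; have := sgn _ _ Ax0 Ax.
by rewrite -sgr_gt0 sgrM -[in X in _ -> X]sgr_gt0 sgrM sgr_id.
Qed.

End area.

(** * Grids in several dimensions *)

Section grid_points.
Context (R : realType).

(** Product of one grid for each entry of us, the entry being its shift. *)
Fixpoint gpts L (us : seq R) : seq (seq R) :=
  if us is u :: us' then [seq grid L u j :: s | j <- iota 0 L, s <- gpts L us']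
  else [:: [::]].

Lemma big_gpts_nil (T : Type) (idx : T) (op : Monoid.law idx) L (F : seq R -> T) :
  \big[op/idx]_(s <- gpts L [::]) F s = F [::].
Proof. by rewrite /= big_seq1. Qed.

Lemma big_gpts_cons (T : Type) (idx : T) (op : Monoid.law idx) L u us (F : seq R -> T) :
  \big[op/idx]_(s <- gpts L (u :: us)) F s =
  \big[op/idx]_(j <- iota 0 L) \big[op/idx]_(s <- gpts L us) F (grid L u j :: s).
Proof. by rewrite /= big_allpairs_dep. Qed.

Lemma size_gpts L us s : s \in gpts L us -> size s = size us.
Proof.
elim: us s => [|u us IH] s /=; first by rewrite inE => /eqP ->.
by move=> /allpairsP[[j s'] /= [_ /IH <- ->]].
Qed.

Lemma card_gpts L us : size (gpts L us) = (L ^ size us)%N.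
Proof. by elim: us => // u us IH; rewrite /= size_allpairs size_iota IH expnS. Qed.

(** Stability in each of the n coordinates separately, the others being
    arbitrary reals. *)
Definition coord_stable n C (F : seq R -> nat) := forall s1 s2,
  (size s1 + size s2).+1 = n -> grid_stable C (fun t => F (s1 ++ t :: s2)).

Definition shifts n (us : seq R) := (size us == n) && all (fun u => 0 <= u <= 1) us.

(** Move the grid one coordinate at a time: each move changes the sum by at most
    C on each of the L ^ n.-1 lines in that direction. *)
Lemma gsum_stable n C L F us vs : shifts n us -> shifts n vs -> coord_stable n C F ->
  (\sum_(s <- gpts L us) F s <= \sum_(s <- gpts L vs) F s + n * C * L ^ n.-1)%N.
Proof.
elim: n F us vs => [|n IH] F us vs.
  by move=> /andP[/nilP -> _] /andP[/nilP -> _] _; rewrite leq_addr.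
case: us => // u us /andP[us1 /= /andP[u01 us01]].
case: vs => // v vs /andP[vs1 /= /andP[v01 vs01]] cF.
have us' : shifts n us by apply/andP.
have vs' : shifts n vs by apply/andP.
rewrite !big_gpts_cons.
pose m := (\sum_(j <- iota 0 L) \sum_(s <- gpts L vs) F (grid L u j :: s))%N.
apply: (@leq_trans (m + L * (n * C * L ^ n.-1))).
  rewrite -[X in (X * _)%N](size_iota 0 L) -sum1_size big_distrl /= -big_split /=.
  apply: leq_sum => j _; rewrite mul1n; apply: IH => // s1 s2 e.
  by apply: (cF (grid L u j :: s1) s2); rewrite -e.
have -> : (L * (n * C * L ^ n.-1) = n * C * L ^ n)%N.
  by case: n {IH us1 vs1 cF us' vs'} => [|n]; rewrite ?mul0n ?muln0// mulnCA expnS.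
rewrite mulSn mulnDl addnA leq_add2r /m exchange_big [X in (_ <= X + _)%N]exchange_big /=.
move: vs1 => /eqP[vs1]; rewrite -vs1 -card_gpts mulnC -[X in (_ + X * _)%N]sum1_size big_distrl -big_split /=.
rewrite big_seq [leqRHS]big_seq; apply: leq_sum => s /size_gpts ss.
by rewrite mul1n; apply: (cF [::] s) => //; rewrite /= ss vs1.
Qed.

Definition center n : seq R := nseq n 2^-1.

Lemma shifts_center n : shifts n (center n).
Proof.
rewrite /shifts size_nseq eqxx /=; apply/allP => x /nseqP[-> _].
by apply/andP; split; lra.
Qed.

Lemma Poly_insert (s1 s2 : seq R) t :
  Poly (s1 ++ t :: s2) = Poly (s1 ++ 0 :: s2) + t *: 'X^(size s1).
Proof.
apply/polyP => i; rewrite coefD !coef_Poly coefZ coefXn !nth_cat.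
case: ltngtP => [| |->]; rewrite ?mulr0 ?addr0//.
  by move=> h; rewrite -(subnSK h).
by rewrite subnn /= add0r mulr1.
Qed.

Lemma Poly_cons (t : R) s : Poly (t :: s) = Poly s * 'X + t%:P.
Proof. by rewrite /= cons_poly_def. Qed.

Lemma grid_stable_sum (I : Type) (r : seq I) C (f : I -> R -> nat) :
  (forall i, grid_stable C (f i)) ->
  grid_stable (size r * C) (fun t => \sum_(i <- r) f i t)%N.
Proof.
move=> h; elim: r => [|i r IH].
  apply: grid_stable_eq (_ : grid_stable 0 (fun=> 0%N)) => [t|]; first by rewrite big_nil.
  by move=> L u v _ _; rewrite !big1_eq.
apply: grid_stable_eq (grid_stableD (h i) IH) => t; by rewrite big_cons.
Qed.

(** The k-th entry of s is the coefficient of X^(k+1), so that grid_stable_coef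
    applies at each of the L levels; the constant coefficient itself is the
    level. *)
Lemma coord_stable_level_count n S L : convex S ->
  coord_stable n (L * 3 ^ n.+1) (fun s : seq R => level_count S (Poly s * 'X) L).
Proof.
move=> cS s1 s2 e; rewrite -[X in (X * _)%N](size_iota 0 L).
apply: (@grid_stable_sum _ (iota 0 L) _ (fun j t => nroots S (Poly (s1 ++ t :: s2) * 'X + (grid L 2^-1 j)%:P))).
move=> j; set a := grid L _ _.
refine (@grid_stable_eq _ _ (fun t => nroots S (Poly (a :: s1 ++ 0%R :: s2) + t *: 'X^((size s1).+1))) _ _ _).
  by move=> t; rewrite -Poly_cons -[a :: s1 ++ t :: s2]/((a :: s1) ++ t :: s2) Poly_insert.
apply: grid_stable_coef => //.
  by rewrite (leq_trans (size_Poly _))//= size_cat /= addnS e.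
by rewrite -e ltnS leq_addr.
Qed.

End grid_points.

(** * Integrals as averages of grid sums *)

Section affine.
Context (R : realType).
Local Notation mu := (@lebesgue_measure R).
Local Open Scope ereal_scope.

Let aff (c d : R) (u : measurableTypeR R) : measurableTypeR R := (c + d * u)%R.

Lemma measurable_affine c d : measurable_fun setT (aff c d).
Proof.
apply: measurable_funD => //; exact: measurable_funM.
Qed.

(** The image of the measure under an increasing affine map has the right values
    on half-open intervals, which characterizes Lebesgue measure. *)
Lemma integral_affine (c d : R) (D : set (measurableTypeR R)) (F : measurableTypeR R -> \bar R) : (0 < d)%R ->
  measurable D -> measurable_fun D F -> (forall x, D x -> 0 <= F x) ->
  \int[mu]_(x in D) F x = d%:E * \int[mu]_(u in aff c d @^-1` D) F (aff c d u).
Proof.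
move=> d0 mD mF F0; have ma := measurable_affine c d.
pose dn : {nonneg R} := NngNum (ltW d0).
pose m : {measure set (measurableTypeR R) -> \bar R} := measure_function_pushforward__canonical__measure_function_Measure mu ma.
pose nu : {measure set (measurableTypeR R) -> \bar R} := mscale dn m.
rewrite (@eq_measure_integral _ _ _ D nu); last first.
  move=> A mA _; apply: (@lebesgue_measure_unique R nu) => // X [[a b] _ <-] /=.
  rewrite /nu /mscale/= /pushforward.
  rewrite (_ : aff c d @^-1` _ = `](((a - c) / d)%R), (((b - c) / d)%R)]%classic); last first.
    apply/seteqP; split => x /=; rewrite !in_itv/= /aff.
      by rewrite ltr_pdivrMr// ler_pdivlMr// ltrBlDl lerBrDl mulrC.
    by rewrite ltr_pdivrMr// ler_pdivlMr// ltrBlDl lerBrDl mulrC.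
  rewrite !lebesgue_measure_itv /= !lte_fin ltr_pM2r ?invr_gt0// ltrD2r.
  case: ifPn => ab; last by rewrite mule0.
  rewrite -!EFinB -EFinM; congr EFin; field; exact: lt0r_neq0.
rewrite ge0_integral_mscale// ge0_integral_pushforward//.
by move=> y; rewrite inE; exact: F0.
Qed.

(** Cut [-1,1] into L cells and bring each of them back to [0,1]: averaging over
    the shift u turns grid sums into the exact integral. *)
Lemma integral_grid L (F : measurableTypeR R -> \bar R) : (0 < L)%N ->
  measurable_fun setT F -> (forall x, 0 <= F x) ->
  \int[mu]_(x in `[(-1)%R, 1%R]) F x =
  (2 / L%:R)%:E * \int[mu]_(u in `[0%R, 1%R]) \sum_(j <- iota 0 L) F (grid L u j).
Proof.
move=> L0 mF F0.
have L0' : (0 < L%:R :> R)%R by rewrite ltr0n.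
have dL : (0 < 2 / L%:R :> R)%R by rewrite divr_gt0.
have mF' (D : set (measurableTypeR R)) : measurable_fun D F by exact: measurable_funTS.
pose x j : R := (2 * j%:R / L%:R - 1)%R.
have xS j : (x j <= x j.+1)%R.
  by rewrite /x lerD2r ler_wpM2r ?invr_ge0 ?ler0n// ler_wpM2l// ler_nat.
have x0j j : (x 0%N <= x j)%R by elim: j => // j; move/le_trans; apply.
have part k : \int[mu]_(t in `[x 0%N, x k[) F t =
    \sum_(j <- iota 0 k) \int[mu]_(t in `[x j, x j.+1[) F t.
  elim: k => [|k IH]; first by rewrite set_itvco0 big_nil integral_set0.
  rewrite -[in iota 0 _]addn1 iotaD big_cat/= big_seq1 add0n -IH.
  rewrite (@itv_bndbnd_setU _ _ _ (BLeft (x k))) ?bnd_simp//.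
  rewrite ge0_integral_setU//; try exact: measurable_itv.
  apply/disj_setPS => t []; rewrite /= !in_itv/= => /andP[_ tx] /andP[xt _].
  by have := lt_le_trans tx xt; rewrite ltxx.
have xL : x L = 1%R by rewrite /x; field; exact: lt0r_neq0.
have x0 : x 0%N = (-1)%R by rewrite /x mulr0 mul0r add0r.
have gridE (j : nat) : (fun u => grid L u j) = aff (2 * j%:R / L%:R - 1) (2 / L%:R).
  by apply/funext => u; rewrite /grid /aff; ring.
have mFg (j : nat) (D : set (measurableTypeR R)) : measurable_fun D (fun u => F (grid L u j)).
  apply: measurable_funTS; apply: (measurableT_comp mF); rewrite gridE.
  exact: measurable_affine.
rewrite -integral_itv_bndo_bndc; last exact: mF'.
rewrite -[(-1)%R]x0 -{1}xL part ge0_integral_sum; last 3 first.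
- exact: measurable_itv.
- by move=> j; exact: mFg.
- by move=> j u _; exact: F0.
rewrite ge0_sume_distrr; last by move=> j _; exact: integral_ge0.
apply: eq_bigr => j _; rewrite (@integral_affine (x j) (2 / L%:R))//.
rewrite (_ : aff _ _ @^-1` _ = `[0%R, 1%R[%classic); last first.
  apply/seteqP; split => u; rewrite /= !in_itv/= /aff lerDl pmulr_rge0//.
    move=> /andP[-> /=]; rewrite -ltrBrDl -ltr_pdivlMl// => /lt_le_trans; apply.
    by rewrite /x -natr1 le_eqVlt; apply/orP; left; apply/eqP; field; exact: lt0r_neq0.
  move=> /andP[-> /=] u1; rewrite -ltrBrDl -ltr_pdivlMl//; apply: (lt_le_trans u1).
  by rewrite /x -natr1 le_eqVlt; apply/orP; left; apply/eqP; field; exact: lt0r_neq0.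
rewrite -[in RHS]integral_itv_bndo_bndc; last exact: mFg.
by congr (_ * _); apply: eq_integral => u _; congr F; rewrite /grid /aff /x; ring.
Qed.

End affine.

(** * Iterated integrals on the cube *)

Section tuple_integral.
Context (R : realType).
Local Notation mu := (@lebesgue_measure R).
Local Notation T := (measurableTypeR R).
Local Open Scope ereal_scope.

Lemma integral_tupleS n (F : n.+1.-tuple T -> \bar R) :
  measurable_fun setT F -> (forall p, 0 <= F p) ->
  \int[lebesgue_tuple R n.+1]_p F p =
  \int[mu]_x \int[lebesgue_tuple R n]_p F [tuple of x :: p].
Proof.
move=> mF F0.
have -> : \int[lebesgue_tuple R n.+1]_p F p =
    \int[pushforward (mu \x lebesgue_tuple R n) (@cons_pair R n)]_p F p by [].
rewrite ge0_integral_pushforward//; last exact: measurable_cons_pair.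
rewrite preimage_setT fubini_tonelli1//.
  by apply: measurableT_comp => //; exact: measurable_cons_pair.
by move=> u; exact: F0.
Qed.

Definition cube n : set (n.-tuple T) := [set p | forall i, (`|tnth p i : R| <= 1)%R].

Arguments cube n : clear implicits.

Lemma measurable_tuple_box n (A : 'I_n -> set T) : (forall i, measurable (A i)) ->
  measurable [set p : n.-tuple T | forall i, A i (tnth p i)].
Proof.
move=> mA.
rewrite [X in measurable X](_ : _ = \big[setI/setT]_(i < n) ((@tnth n T ^~ i) @^-1` A i)).
  apply: bigsetI_measurable => i _.
  by rewrite -[X in measurable X]setTI; apply: measurable_tnth.
rewrite -bigcap_seq; apply/seteqP; split => p /= h i => [_|]; first exact: h.
by apply: h; rewrite /= mem_index_enum.
Qed.

Lemma cubeE n : cube n = [set p | forall i, `[(-1)%R, 1%R]%classic (tnth p i : R)].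
Proof.
by apply/seteqP; split => p h i; have := h i; rewrite /= in_itv/= -ler_norml.
Qed.

Lemma measurable_cube n : measurable (cube n).
Proof.
rewrite cubeE; apply: (@measurable_tuple_box n (fun=> `[(-1)%R, 1%R]%classic)) => i.
exact: measurable_itv.
Qed.

Lemma measurable_section n (F : n.+1.-tuple T -> \bar R) (x : T) :
  measurable_fun setT F -> measurable_fun setT (fun p : n.-tuple T => F [tuple of x :: p]).
Proof.
move=> mF; apply: (measurableT_comp mF).
rewrite (_ : (fun p => _) = @cons_pair R n \o (pair x)); last by [].
apply: measurableT_comp; [exact: measurable_cons_pair|].
exact: measurable_pair1.
Qed.

Lemma measurable_integral_section n (F : n.+1.-tuple T -> \bar R) :
  measurable_fun setT F -> (forall p, 0 <= F p) ->
  measurable_fun setT (fun x => \int[lebesgue_tuple R n]_(p in cube n) F [tuple of x :: p]).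
Proof.
move=> mF F0.
pose G (u : T * n.-tuple T) := ((fun p : n.-tuple T => F [tuple of u.1 :: p]) \_ (cube n)) u.2.
rewrite (_ : (fun x => _) = fubini_F (lebesgue_tuple R n) G); last first.
  by apply/funext => x; rewrite /fubini_F [LHS]integral_mkcond.
apply: measurable_fun_fubini_tonelli_F; last first.
  by move=> u; rewrite /G /patch; case: ifP => _; [exact: F0|].
rewrite (_ : G = (fun u => F (@cons_pair R n u)) \_ (setT `*` (cube n))); last first.
  apply/funext => -[x p]; rewrite /G /patch /=; congr (if _ then _ else _).
  by apply/idP/idP; rewrite !inE //= => -[].
apply/(measurable_restrictT _ _).1 => //.
- apply: measurableX => //; exact: measurable_cube.
- apply: measurable_funTS; apply: measurableT_comp => //; exact: measurable_cons_pair.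
Qed.

Lemma integral_cubeS n (F : n.+1.-tuple T -> \bar R) :
  measurable_fun setT F -> (forall p, 0 <= F p) ->
  \int[lebesgue_tuple R n.+1]_(p in cube n.+1) F p =
  \int[mu]_(x in `[(-1)%R, 1%R]) \int[lebesgue_tuple R n]_(p in cube n) F [tuple of x :: p].
Proof.
move=> mF F0; rewrite integral_mkcond integral_tupleS; last 2 first.
- apply/(measurable_restrictT _ _).1; [exact: measurable_cube|exact: measurable_funTS].
- by move=> p; rewrite /patch; case: ifP => _; [exact: F0|].
rewrite [RHS]integral_mkcond; apply: eq_integral => x _.
rewrite /= [RHS]patchE; case: ifPn => xin; last first.
  apply: integral0_eq => p _; rewrite patchE ifF//; apply: contraNF xin.
  by rewrite !inE => /(_ ord0); rewrite /= in_itv/= -ler_norml (tnth_nth 0%R).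
rewrite [RHS]integral_mkcond; apply: eq_integral => p _; rewrite !patchE.
congr (if _ then _ else _); apply/idP/idP; rewrite !inE => h i.
  by have := h (lift ord0 i); rewrite tnthS.
have [j ->|->] := unliftP ord0 i; first by rewrite tnthS; exact: h.
by move: xin; rewrite inE/= in_itv/= -ler_norml (tnth_nth 0%R).
Qed.

End tuple_integral.
Arguments cube : clear implicits.

(** * Bounding an integral on the cube by grid sums *)

Section cube_bounds.
Context (R : realType).
Local Notation mu := (@lebesgue_measure R).
Local Notation T := (measurableTypeR R).
Local Open Scope ereal_scope.

Lemma integral_cube0 (F : seq R -> \bar R) :
  \int[lebesgue_tuple R 0]_(p in cube R 0) F p = F [::].
Proof.
rewrite (_ : cube R 0 = setT); last by apply/seteqP; split => // p _ [].
rewrite integral_dirac//; first by rewrite diracT mul1e.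
rewrite (_ : (fun p => _) = cst (F [::])) //.
by apply/funext => p; rewrite tuple0.
Qed.

Lemma integral_grid_sum n L (F : seq R -> \bar R) u :
  measurable_fun setT (fun p : n.+1.-tuple T => F p) -> (forall p, 0 <= F p) ->
  \int[lebesgue_tuple R n]_(p in cube R n) (\sum_(j <- iota 0 L) F (grid L u j :: p)) =
  \sum_(j <- iota 0 L) \int[lebesgue_tuple R n]_(p in cube R n) F (grid L u j :: p).
Proof.
move=> mF F0; rewrite ge0_integral_sum//; first exact: measurable_cube.
move=> j; apply: measurable_funTS.
exact: (@measurable_section _ _ (fun p : n.+1.-tuple T => F p)).
Qed.

Lemma integral_cube_grid n L (F : seq R -> \bar R) : (0 < L)%N ->
  measurable_fun setT (fun p : n.+1.-tuple T => F p) -> (forall p, 0 <= F p) ->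
  \int[lebesgue_tuple R n.+1]_(p in cube R n.+1) F p =
  (2 / L%:R)%:E * \int[mu]_(u in `[0%R, 1%R])
    \int[lebesgue_tuple R n]_(p in cube R n) \sum_(j <- iota 0 L) F (grid L u j :: p).
Proof.
move=> L0 mF F0.
rewrite (@integral_cubeS _ _ (fun p : n.+1.-tuple T => F p))//.
rewrite (@integral_grid _ L)//; last 2 first.
- exact: (@measurable_integral_section _ _ (fun p : n.+1.-tuple T => F p)).
- by move=> x; exact: integral_ge0.
by congr (_ * _); apply: eq_integral => u _; rewrite integral_grid_sum.
Qed.

Lemma measurable_integral_grid n L (F : seq R -> \bar R) (D : set T) :
  measurable_fun setT (fun p : n.+1.-tuple T => F p) -> (forall p, 0 <= F p) ->
  measurable_fun D (fun u =>
    \int[lebesgue_tuple R n]_(p in cube R n) \sum_(j <- iota 0 L) F (grid L u j :: p)).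
Proof.
move=> mF F0; apply: measurable_funTS.
under [X in measurable_fun _ X]funext do rewrite integral_grid_sum//.
apply: emeasurable_sum => j.
have mG : measurable_fun setT (fun x => \int[lebesgue_tuple R n]_(p in cube R n) F (x :: p)).
  exact: (@measurable_integral_section _ _ (fun p : n.+1.-tuple T => F p)).
apply: (measurableT_comp mG).
rewrite (_ : (fun u => _) = (fun u : T => (2 * j%:R / L%:R - 1) + (2 / L%:R) * u)%R).
  exact: measurable_affine.
by apply/funext => u; rewrite /grid; ring.
Qed.

Lemma measurable_grid_sum n L (F : seq R -> \bar R) u :
  measurable_fun setT (fun p : n.+1.-tuple T => F p) ->
  measurable_fun setT (fun p : n.-tuple T => \sum_(j <- iota 0 L) F (grid L u j :: p)).
Proof.
move=> mF; apply: emeasurable_sum => j.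
exact: (@measurable_section _ _ (fun p : n.+1.-tuple T => F p)).
Qed.

Lemma integral_unit_cst (b : R) : \int[mu]_(u in `[0%R, 1%R]) b%:E = b%:E.
Proof.
rewrite integral_cst//=.
by rewrite lebesgue_measure_itv/= lte01 oppr0 adde0 mule1.
Qed.

(** The integral is (2/L)^n times the average of the grid sums over all the
    shifts in [0,1]^n; so a bound valid for every shift passes to the integral.
    The same holds for lower bounds. *)
Lemma integral_cube_le n L (F : seq R -> \bar R) (B : R) : (0 < L)%N -> (0 <= B)%R ->
  measurable_fun setT (fun p : n.-tuple T => F p) -> (forall p, 0 <= F p) ->
  (forall us, shifts n us -> \sum_(s <- gpts L us) F s <= B%:E) ->
  \int[lebesgue_tuple R n]_(p in cube R n) F p <= ((2 / L%:R) ^+ n * B)%:E.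
Proof.
move=> L0 B0; elim: n F => [|n IH] F mF F0 hB.
  rewrite integral_cube0 expr0 mul1r.
  by have := hB [::] isT; rewrite big_gpts_nil.
rewrite (@integral_cube_grid _ L)// exprS -mulrA [leRHS]EFinM.
rewrite lee_pmul2l ?lte_fin ?divr_gt0 ?ltr0n//.
rewrite -integral_unit_cst; apply: ge0_le_integral => //.
- by move=> u _; apply: integral_ge0 => p _; apply: sume_ge0.
- exact: measurable_integral_grid.
move=> u; rewrite /= in_itv/= => u01.
apply: (IH (fun s => \sum_(j <- iota 0 L) F (grid L u j :: s))).
- exact: measurable_grid_sum.
- by move=> p; apply: sume_ge0.
move=> us /andP[/eqP su us01]; have := hB (u :: us); rewrite big_gpts_cons exchange_big; apply.
by rewrite /shifts /= su eqxx u01 us01.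
Qed.

Lemma integral_cube_ge n L (F : seq R -> \bar R) (B : R) : (0 < L)%N -> (0 <= B)%R ->
  measurable_fun setT (fun p : n.-tuple T => F p) -> (forall p, 0 <= F p) ->
  (forall us, shifts n us -> B%:E <= \sum_(s <- gpts L us) F s) ->
  ((2 / L%:R) ^+ n * B)%:E <= \int[lebesgue_tuple R n]_(p in cube R n) F p.
Proof.
move=> L0 B0; elim: n F => [|n IH] F mF F0 hB.
  rewrite integral_cube0 expr0 mul1r.
  by have := hB [::] isT; rewrite big_gpts_nil.
rewrite (@integral_cube_grid _ L)// exprS -mulrA [leLHS]EFinM.
rewrite lee_pmul2l ?lte_fin ?divr_gt0 ?ltr0n//.
rewrite -integral_unit_cst; apply: ge0_le_integral => //.
- by move=> u _; rewrite lee_fin mulr_ge0// exprn_ge0// divr_ge0 ?ler0n.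
- exact: measurable_integral_grid.
move=> u; rewrite /= in_itv/= => u01.
apply: (IH (fun s => \sum_(j <- iota 0 L) F (grid L u j :: s))).
- exact: measurable_grid_sum.
- by move=> p; apply: sume_ge0.
move=> us /andP[/eqP su us01]; have := hB (u :: us); rewrite big_gpts_cons exchange_big; apply.
by rewrite /shifts /= su eqxx u01 us01.
Qed.

End cube_bounds.

(** * The density and its integral over an interval *)

Section density.
Context (R : realType).
Local Notation mu := (@lebesgue_measure R).
Local Notation T := (measurableTypeR R).
Variable n : nat.

Definition value (x : R) (p : n.-tuple T) : R := \sum_(k < n) (tnth p k : R) * x ^+ k.+1.

Definition slope (x : R) (p : n.-tuple T) : R :=
  \sum_(k < n) k.+1%:R * (tnth p k : R) * x ^+ k.

(** The polynomial without constant term whose coefficients are the entries of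
    p. *)
Definition tpoly (p : seq R) : {poly R} := Poly p * 'X.

Lemma tpolyE (p : n.-tuple T) : tpoly p = \sum_(k < n) (tnth p k : R) *: 'X^(k.+1).
Proof.
rewrite /tpoly; apply/polyP => i; rewrite coefMX coef_Poly coef_sum.
case: i => [|i] /=; first by rewrite big1// => k _; rewrite coefZ coefXn mulr0.
have [ni|ni] := leqP n i.
  rewrite nth_default ?size_tuple// big1// => k _; rewrite coefZ coefXn eqSS.
  by rewrite gtn_eqF ?mulr0// (leq_trans _ ni).
rewrite (bigD1 (Ordinal ni))//= coefZ coefXn eqxx mulr1 big1 ?addr0.
  by rewrite (tnth_nth 0).
move=> k ki; rewrite coefZ coefXn eqSS (_ : (i == k) = false) ?mulr0//.
by apply: contraNF ki => /eqP e; apply/eqP/val_inj.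
Qed.

Lemma valueE x p : value x p = (tpoly p).[x].
Proof.
rewrite tpolyE horner_sum; apply: eq_bigr => k _; by rewrite hornerZ hornerXn.
Qed.

Lemma slopeE x p : slope x p = (tpoly p)^`().[x].
Proof.
rewrite tpolyE raddf_sum /= horner_sum; apply: eq_bigr => k _.
by rewrite derivZ hornerZ derivXn hornerMn hornerXn /= -mulr_natl; ring.
Qed.

Lemma DeltaE (x : R) : Delta n x = [set p : n.-tuple T | cube R n p /\ `|value x p| <= 1].
Proof.
apply/seteqP; split => p /= [h1 h2]; split => //.
  by move=> i; move: h1 => /bigmax_leP[_]; apply.
by apply/bigmax_leP; split.
Qed.

Definition density (x : R) : \bar R :=
  (\int[lebesgue_tuple R n]_(p in Delta n x) (`|slope x p|)%:E)%E.

Lemma measurable_value : measurable_fun setT (fun u : T * n.-tuple T => value u.1 u.2).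
Proof.
apply: measurable_sum => k; apply: measurable_funM.
  apply: (@measurableT_comp _ _ _ _ _ _ (fun p : n.-tuple T => tnth p k)) => //.
  exact: measurable_tnth.
by apply: measurable_funX.
Qed.

Lemma measurable_slope : measurable_fun setT (fun u : T * n.-tuple T => slope u.1 u.2).
Proof.
apply: measurable_sum => k; apply: measurable_funM; last exact: measurable_funX.
apply: measurable_funM => //.
apply: (@measurableT_comp _ _ _ _ _ _ (fun p : n.-tuple T => tnth p k)) => //.
exact: measurable_tnth.
Qed.

Section tonelli.
Variable S : pred R.
Hypothesis cS : convex S.

Let dom C : set (T * n.-tuple T) := [set u | S u.1 /\ (C u.2 /\ `|value u.1 u.2| <= 1)].

Let mdom C : measurable C -> measurable (dom C).
Proof.
move=> mC.
have -> : dom C = ([set x | S x] `*` C) `&` ((fun u => value u.1 u.2) @^-1` `[-1, 1]%classic).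
  apply/seteqP; split => u /=; rewrite in_itv /= -ler_norml /dom /mkset; tauto.
apply: measurableI; first by apply: measurableX => //; exact: measurable_convex.
rewrite -[X in measurable X]setTI; exact: measurable_value.
Qed.

Let W C := (fun u : T * n.-tuple T => (`|slope u.1 u.2|)%:E) \_ (dom C).

Let mW C : measurable C -> measurable_fun setT (W C).
Proof.
move=> mC; apply/(measurable_restrictT _ _).1; first exact: mdom.
apply: measurable_funTS; apply/measurable_EFinP/measurableT_comp => //.
exact: measurable_slope.
Qed.

Let W0 C u : (0 <= W C u)%E.
Proof. by rewrite /W patchE; case: ifP => // _; rewrite lee_fin. Qed.

Let Wx C p : (\int[mu]_x W C (x, p))%E = ((fun p : n.-tuple T => variation S (tpoly p)) \_ C) p.
Proof.
rewrite patchE; case: ifPn => [|np].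
  rewrite inE => cp; rewrite /variation [RHS]integral_mkcond; apply: eq_integral => x _.
  rewrite /W !patchE -slopeE; congr (if _ then _ else _).
  by apply/idP/idP; rewrite !inE /dom /strip /= -valueE; tauto.
apply: integral0_eq => x _; rewrite /W patchE ifF//.
by apply: contraNF np; rewrite !inE /dom /= => -[_ []].
Qed.

Let Wp x : (\int[lebesgue_tuple R n]_p W (cube R n) (x, p))%E = (density \_ [set x | S x]) x.
Proof.
rewrite patchE; case: ifPn => [|np].
  rewrite inE => Sx; rewrite /density [RHS]integral_mkcond; apply: eq_integral => p _.
  rewrite /W !patchE; congr (if _ then _ else _).
  by apply/idP/idP; rewrite !inE DeltaE /dom /=; tauto.
apply: integral0_eq => p _; rewrite /W patchE ifF//.
by apply: contraNF np; rewrite !inE /dom /= => -[].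
Qed.

Lemma measurable_variation :
  measurable_fun setT (fun p : n.-tuple T => variation S (tpoly p)).
Proof.
rewrite (_ : (fun p => _) = fubini_G mu (W setT)); last first.
  by apply/funext => p; rewrite /fubini_G Wx patch_setT.
by apply: measurable_fun_fubini_tonelli_G; [exact: mW|exact: W0].
Qed.

Lemma measurable_density : measurable_fun ([set x | S x] : set T) (density : T -> \bar R).
Proof.
apply/(measurable_restrictT _ _); first exact: measurable_convex.
rewrite (_ : _ \_ _ = fubini_F (lebesgue_tuple R n) (W (cube R n))); last first.
  by apply/funext => x; rewrite /fubini_F Wp.
by apply: measurable_fun_fubini_tonelli_F; [apply: mW; exact: measurable_cube|exact: W0].
Qed.

(** Tonelli for |slope x p| on the pairs (x, p) with x in S, p in the cube and
    |value x p| <= 1. *)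
Lemma integral_density :
  (\int[mu]_(x in [set x | S x]) density x =
   \int[lebesgue_tuple R n]_(p in cube R n) variation S (tpoly p))%E.
Proof.
rewrite integral_mkcond [RHS]integral_mkcond.
under eq_integral do rewrite -Wp.
under [RHS]eq_integral do rewrite -Wx.
by apply: fubini_tonelli; [apply: mW; exact: measurable_cube|exact: W0].
Qed.

End tonelli.

Lemma density_ge0 x : (0 <= density x)%E.
Proof. by apply: integral_ge0 => p _; rewrite lee_fin. Qed.

End density.

(** * Comparing the lattice sum with the integral *)

Section lattice.
Context (R : realType).
Local Notation mu := (@lebesgue_measure R).

(** n * 3 ^ n.+1 for translating the grid in n coordinates, and less than
    3 ^ n.+1 for the area formula. *)
Definition lattice_err n : nat := (n.+1 * 3 ^ n.+1)%N.

(** The sum over the centres of the cells of [-1,1]^(n+1); the constant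
    coefficient is one of the coordinates. *)
Definition lattice_sum n (S : pred R) L : nat :=
  \sum_(s <- gpts L (center R n.+1)) nroots S (Poly s).

Lemma lattice_sumE n S L :
  lattice_sum n S L = (\sum_(s <- gpts L (center R n)) level_count S (tpoly s) L)%N.
Proof.
rewrite /lattice_sum big_gpts_cons exchange_big; apply: eq_bigr => s _.
by apply: eq_bigr => j _; rewrite Poly_cons.
Qed.

Lemma tpoly_nonconst (s : seq R) : tpoly s = 0 \/ (tpoly s)^`() != 0.
Proof.
have [d0|] := eqVneq (tpoly s)^`() 0; [left|by right].
apply/polyP => -[|i]; rewrite coef0; first by rewrite coefMX.
have := coef_deriv (tpoly s) i; rewrite d0 coef0 => /esym/eqP.
by rewrite mulrn_eq0 /= => /eqP.
Qed.

(** For every shift of the grid in the n non-constant coefficients, the sum of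
    the variations is close to the sum of the level counts, which is close to
    its value for the centred grid.  The integral of the variation over the cube
    lies between the extreme values of these sums. *)
Lemma lattice_bounded n S M L : convex S -> (forall x, S x -> `|x| <= M) -> (0 < L)%N ->
  exists2 v : R, (\int[mu]_(x in [set x | S x]) density n x = v%:E)%E &
  `|(L%:R / 2) ^+ n.+1 * v - (lattice_sum n S L)%:R| <= (lattice_err n * L ^ n)%:R.
Proof.
move=> cS bS L0; have L0' : 0 < L%:R :> R by rewrite ltr0n.
pose v s := fine (variation S (tpoly s)).
pose K := (lattice_err n * L ^ n)%N; pose T := lattice_sum n S L.
have vP (s : seq R) : size s = n -> variation S (tpoly s) = (v s)%:E /\
    `|L%:R / 2 * v s - (level_count S (tpoly s) L)%:R| <= (3 ^ n)%:R.
  move=> sn; have [w e h] := variation_level_count cS L0 bS (tpoly_nonconst s).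
  rewrite /v e; split => //; apply: le_trans h _; rewrite ler_nat leq_pexp2l//.
  have [->|d0] := eqVneq (tpoly s) 0; first by rewrite deriv0 rootsR0.
  have : (size (tpoly s) <= n.+1)%N.
    apply/leq_sizeP => -[//|j] nj; rewrite coefMX /= coef_Poly nth_default//.
    by rewrite sn -ltnS.
  move/(leq_trans (lt_size_deriv d0)) => h2.
  by apply: size_rootsR; exact: ltnW.
have v0 s : 0 <= v s by apply: fine_ge0; exact: variation_ge0.
have sumv us : shifts n us -> (\sum_(s <- gpts L us) variation S (tpoly s) =
    (\sum_(s <- gpts L us) v s)%:E)%E.
  move=> /andP[/eqP su _]; rewrite -sumEFin big_seq [RHS]big_seq.
  apply: eq_bigr => s /size_gpts ss; have [] // := vP s.
  by rewrite ss.
(* Area formula for each grid point, then translation to the centred grid. *)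
have near us : shifts n us ->
  `|L%:R / 2 * (\sum_(s <- gpts L us) v s) - T%:R| <= K%:R.
  move=> sus; have /andP[/eqP su _] := sus.
  pose G s := level_count S (tpoly s) L.
  have h1 : `|L%:R / 2 * (\sum_(s <- gpts L us) v s) - (\sum_(s <- gpts L us) G s)%:R|
      <= (3 ^ n * L ^ n)%:R.
    rewrite natr_sum mulr_sumr -sumrB.
    apply: le_trans (ler_norm_sum _ _ _) _.
    rewrite big_seq (@le_trans _ _ (\sum_(s <- gpts L us | s \in gpts L us) (3 ^ n)%:R))//.
      by apply: ler_sum => s /size_gpts ss; have [] // := vP s; rewrite ss.
    by rewrite -big_seq big_const_seq count_predT card_gpts su iter_addr_0 natrM mulr_natr.
  have cst : coord_stable n (L * 3 ^ n.+1) G by exact: coord_stable_level_count.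
  have h2 := gsum_stable L sus (shifts_center R n) cst.
  have h3 := gsum_stable L (shifts_center R n) sus cst.
  have e : (n * (L * 3 ^ n.+1) * L ^ n.-1 = n * 3 ^ n.+1 * L ^ n)%N.
    by case: (n) => // m; rewrite /= [(L ^ m.+1)%N]expnS [RHS]mulnACA !mulnA.
  rewrite -lattice_sumE -/T e in h2; rewrite -lattice_sumE -/T e in h3.
  have eK : K = (n * 3 ^ n.+1 * L ^ n + 3 * (3 ^ n * L ^ n))%N.
    by rewrite /K /lattice_err mulSn mulnDl addnC; congr (_ + _)%N; rewrite expnS -mulnA.
  move: h2 h3 h1; rewrite -!(ler_nat R) !natrD eK natrD [(3 * _)%:R]natrM.
  have : 0 <= (3 ^ n * L ^ n)%:R :> R by rewrite ler0n.
  rewrite !ler_norml; lra.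
have d2 : 0 <= 2 / L%:R :> R by rewrite divr_ge0 ?ler0n.
have dL : (L%:R / 2) * (2 / L%:R) = 1 :> R by field; exact: lt0r_neq0.
have near' us : shifts n us ->
  (2 / L%:R) * (T%:R - K%:R) <= \sum_(s <- gpts L us) v s <= (2 / L%:R) * (T%:R + K%:R).
  move=> /near; set x := \sum_(s <- _) _ => h.
  have -> : x = (2 / L%:R) * (L%:R / 2 * x) by rewrite mulrA [2 / _ * _]mulrC dL mul1r.
  by move: h; rewrite !ler_pM2l ?divr_gt0// ler_norml; lra.
have mV : measurable_fun setT (fun p : n.-tuple (measurableTypeR R) => variation S (tpoly p)).
  exact: measurable_variation.
have up : (\int[lebesgue_tuple R n]_(p in cube R n) variation S (tpoly p) <=
   ((2 / L%:R) ^+ n.+1 * (T%:R + K%:R))%:E)%E.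
  rewrite exprSr -mulrA.
  apply: (@integral_cube_le _ _ _ (fun s => variation S (tpoly s))) => //.
  - by move=> p; exact: variation_ge0.
  by move=> us sus; rewrite sumv// lee_fin; case/andP: (near' us sus).
have I0 : (0 <= \int[lebesgue_tuple R n]_(p in cube R n) variation S (tpoly p))%E.
  by apply: integral_ge0 => p _; exact: variation_ge0.
have lo : (((2 / L%:R) ^+ n.+1 * (T%:R - K%:R))%:E <=
    \int[lebesgue_tuple R n]_(p in cube R n) variation S (tpoly p))%E.
  have [TK|/ltW TK] := leP 0 (T%:R - K%:R : R); last first.
    by apply: le_trans I0; rewrite lee_fin mulr_ge0_le0// exprn_ge0.
  rewrite exprSr -mulrA.
  apply: (@integral_cube_ge _ _ _ (fun s => variation S (tpoly s))) => //.
  - by rewrite mulr_ge0// addr_ge0.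
  - by move=> p; exact: variation_ge0.
  by move=> us sus; rewrite sumv// lee_fin; case/andP: (near' us sus).
rewrite integral_density//; move: up lo I0.
case: (integral _ _ _) => [w| |] //= + + _; rewrite !lee_fin => up lo; exists w => //.
have -> : T%:R = (L%:R / 2) ^+ n.+1 * ((2 / L%:R) ^+ n.+1 * T%:R) :> R.
  by rewrite mulrA -exprMn dL expr1n mul1r.
have e2 : K%:R = (L%:R / 2) ^+ n.+1 * ((2 / L%:R) ^+ n.+1 * K%:R) :> R.
  by rewrite mulrA -exprMn dL expr1n mul1r.
rewrite -mulrBr normrM ger0_norm ?exprn_ge0 ?divr_ge0//.
rewrite -/K [leRHS]e2 ler_wpM2l ?exprn_ge0 ?divr_ge0//.
by move: up lo; rewrite mulrDr mulrBr ler_norml; lra.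
Qed.
End lattice.

(** * Integer polynomials of bounded height *)

Section integer_polys.
Context (R : realType).

Fixpoint zlists n M : seq (seq int) :=
  if n is n'.+1 then [seq (j%:Z - M%:Z) :: s | j <- iota 0 M.*2.+1, s <- zlists n' M]
  else [:: [::]].

Lemma zlistsS n M : zlists n.+1 M =
  [seq (j%:Z - M%:Z) :: s | j <- iota 0 M.*2.+1, s <- zlists n M].
Proof. by []. Qed.

Lemma mem_zlists n M (s : seq int) :
  (s \in zlists n M) = (size s == n) && all (fun a => `|a| <= M)%N s.
Proof.
elim: n s => [|n IH] s; first by rewrite /= inE; case: s.
rewrite zlistsS.
apply/idP/idP => [/allpairsP[[j t] [hj ht ->]]|].
  move: ht hj; rewrite /fst /snd IH mem_iota /= eqSS => /andP[-> ->] /=; rewrite andbT; lia.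
case: s => // a s /= /andP[]; rewrite eqSS => ss /andP[aM sM].
have hj : `|(a + M%:Z)%R|%N \in iota 0 M.*2.+1 by rewrite mem_iota; lia.
have hs : s \in zlists n M by rewrite IH ss.
have -> : a = `|(a + M%:Z)%R|%N%:Z - M%:Z by lia.
exact: (allpairs_f (fun j t => j%:Z - M%:Z :: t) hj hs).
Qed.

Lemma uniq_zlists n M : uniq (zlists n M).
Proof.
elim: n => // n IH; rewrite zlistsS; apply: allpairs_uniq => //; first exact: iota_uniq.
by move=> [j s] [k t] _ _ /= [/addIr [->] ->].
Qed.

Definition box n M : seq {poly int} := [seq Poly s | s <- zlists n.+1 M].

Lemma height_le (p : {poly int}) M :
  (height p <= M)%N = [forall i : 'I_(size p), (`|(p`_i)%R| <= M)%N].
Proof.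
by apply/bigmax_leqP/forallP => [h i|h i _]; apply: h.
Qed.

Lemma mem_box n M p : (p \in box n M) = (size p <= n.+1)%N && (height p <= M)%N.
Proof.
apply/mapP/andP => [[s + ->]|[sp hp]].
  rewrite mem_zlists => /andP[/eqP ss sM].
  split; first by rewrite (leq_trans (size_Poly s))// ss.
  rewrite height_le; apply/forallP => i; rewrite coef_Poly.
  have [si|si] := leqP (size s) i; first by rewrite nth_default.
  by apply: (allP sM); rewrite mem_nth.
exists (mkseq (fun i => p`_i) n.+1).
  rewrite mem_zlists size_mkseq eqxx; apply/allP => x /mapP[i _ ->].
  have [si|si] := leqP (size p) i; first by rewrite nth_default.
  by move: hp; rewrite height_le => /forallP /(_ (Ordinal si)).
apply/polyP => i; rewrite coef_Poly; have [ni|ni] := ltnP i n.+1; first by rewrite nth_mkseq.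
by rewrite !nth_default ?size_mkseq// (leq_trans sp).
Qed.

Lemma uniq_box n M : uniq (box n M).
Proof.
rewrite map_inj_in_uniq ?uniq_zlists// => s t.
rewrite !mem_zlists => /andP[/eqP ss _] /andP[/eqP st _] e.
apply: (@eq_from_nth _ 0); first by rewrite ss st.
by move=> i _; have := congr1 (fun p : {poly int} => p`_i) e; rewrite !coef_Poly.
Qed.

Definition pR (p : {poly int}) : {poly R} := map_poly intr p.

(** With L = 2M+1 cells, the centres of the cells are the multiples of 2/L
    by the integers from -M to M. *)
Lemma grid_center M j : grid M.*2.+1 2^-1 j = 2 / M.*2.+1%:R * (j%:Z - M%:Z)%:~R :> R.
Proof.
have h : M.*2.+1%:R != 0 :> R by rewrite pnatr_eq0.
rewrite /grid intrD mulrNz -!pmulrn; move: h.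
have -> : M.*2.+1%:R = 2 * M%:R + 1 :> R by rewrite -natr1 -mul2n natrM.
by move=> h; field.
Qed.

Lemma big_gpts_center n M (F : seq R -> nat) :
  (\sum_(s <- gpts M.*2.+1 (center R n)) F s =
   \sum_(s <- zlists n M) F [seq (2 / M.*2.+1%:R * a%:~R)%R | a <- s])%N.
Proof.
elim: n F => [|n IH] F; first by rewrite big_gpts_nil /= big_seq1.
rewrite big_gpts_cons zlistsS big_allpairs_dep; apply: eq_bigr => j _.
by rewrite IH; apply: eq_bigr => s _; rewrite /= grid_center.
Qed.

Definition root_total n (S : pred R) M : nat := \sum_(p <- box n M) nroots S (pR p).

(** Rescaling a polynomial does not move its roots. *)
Lemma lattice_sum_box n S M : lattice_sum n S M.*2.+1 = root_total n S M.
Proof.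
rewrite /lattice_sum big_gpts_center /root_total big_map; apply: eq_bigr => s _.
rewrite -(@nroots_scale _ _ (2 / M.*2.+1%:R) (pR _)); last first.
  by rewrite mulf_neq0 ?invr_neq0 ?pnatr_eq0.
congr nroots; apply/polyP => i; rewrite coef_Poly coefZ coef_map coef_Poly /=.
have [si|si] := leqP (size s) i; last by rewrite (nth_map 0).
by rewrite !nth_default ?size_map// mulr0.
Qed.

End integer_polys.

(** * Asymptotics of the number of roots *)

Section asymptotic.
Context (R : realType).
Local Notation mu := (@lebesgue_measure R).

Lemma expr_diff_le (x y : R) n : 0 <= y -> y <= x ->
  x ^+ n.+1 - y ^+ n.+1 <= n.+1%:R * (x - y) * x ^+ n.
Proof.
move=> y0 yx; elim: n => [|n IH]; first by rewrite !expr1 mulr1 mul1r.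
have x0 := le_trans y0 yx.
have -> : x ^+ n.+2 - y ^+ n.+2 = x * (x ^+ n.+1 - y ^+ n.+1) + (x - y) * y ^+ n.+1.
  by rewrite !exprS; ring.
have -> : n.+2%:R * (x - y) * x ^+ n.+1 =
    x * (n.+1%:R * (x - y) * x ^+ n) + (x - y) * x ^+ n.+1.
  by rewrite -natr1 exprS; ring.
by apply: lerD; [rewrite ler_wpM2l|rewrite ler_wpM2l ?subr_ge0// lerXn2r ?nnegrE].
Qed.

Lemma size_pR n M p : p \in box n M -> (size (pR R p) <= n.+1)%N.
Proof.
by rewrite mem_box => /andP[h _]; apply: leq_trans (size_poly _ _) h.
Qed.

Variable n : nat.

(** The case L = 1 of lattice_bounded already bounds the integral of the density
    over any bounded interval, because the only grid point has at most n
    roots. *)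
Definition volume_bound : R := 2 ^+ n.+1 * (n%:R + (lattice_err n)%:R).

Definition asymp_const : R :=
  volume_bound + (lattice_err n * 3 ^ n)%:R + n.+1%:R * 2 ^+ n * volume_bound.

(** lattice_bounded for L = 2M+1; replacing (L/2)^(n+1) = (M + 1/2)^(n+1) by
    M^(n+1) costs O(M^n) times the integral, which volume_bound controls. *)
Lemma root_total_bounded (S : pred R) B : convex S -> (forall x, S x -> `|x| <= B) ->
  exists2 v : R, (\int[mu]_(x in [set x | S x]) density n x = v%:E)%E /\ 0 <= v <= volume_bound &
  forall M, (0 < M)%N -> `|M%:R ^+ n.+1 * v - (root_total n S M)%:R| <= asymp_const * M%:R ^+ n.
Proof.
move=> cS bS.
have [v vE h1] := lattice_bounded n cS bS (ltn0Sn 0).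
have v0 : 0 <= v by rewrite -lee_fin -vE; apply: integral_ge0 => x _; exact: density_ge0.
have vV : v <= volume_bound.
  have T1 : (lattice_sum n S 1 <= n)%N.
    rewrite /lattice_sum (@leq_trans (\sum_(s <- gpts 1 (center R n.+1)) n))//.
      rewrite big_seq [leqRHS]big_seq; apply: leq_sum => s /size_gpts ss.
      by apply: nroots_le; rewrite (leq_trans (size_Poly _))// ss size_nseq.
    by rewrite big_const_seq count_predT card_gpts exp1n iter_addn_0 muln1.
  have : (1 / 2) ^+ n.+1 * v <= n%:R + (lattice_err n)%:R.
    move: h1; rewrite exp1n muln1 ler_norml => /andP[_].
    by rewrite lerBlDl => /le_trans; apply; rewrite lerD2r ler_nat.
  by rewrite div1r exprVn ler_pdivrMl ?exprn_gt0.
have V0 : 0 <= volume_bound by exact: le_trans vV.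
exists v; first by rewrite v0 vV.
move=> M M0; have M1 : 1 <= M%:R :> R by rewrite ler1n.
have [w] := lattice_bounded n cS bS (ltn0Sn M.*2).
rewrite vE => -[<-]; rewrite lattice_sum_box.
set T := (root_total _ _ _)%:R; set L := M.*2.+1 => h.
have LE : L%:R / 2 = M%:R + 2^-1 :> R.
  by rewrite /L -natr1 -mul2n natrM mulrDl mulrC mulrA mulVf ?mul1r.
have hE : (lattice_err n * L ^ n)%:R <= (lattice_err n * 3 ^ n)%:R * M%:R ^+ n :> R.
  rewrite -natrX -natrM ler_nat -mulnA leq_mul2l -expnMn; apply/orP; right.
  by case: (posnP n) => [->//|n0]; rewrite leq_exp2r// /L; lia.
have hD : `|(L%:R / 2) ^+ n.+1 * v - M%:R ^+ n.+1 * v| <= n.+1%:R * 2 ^+ n * volume_bound * M%:R ^+ n.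
  rewrite -mulrBl normrM (ger0_norm v0) LE.
  rewrite ger0_norm; last first.
    by rewrite subr_ge0 lerXn2r ?nnegrE ?addr_ge0 ?invr_ge0// lerDl invr_ge0.
  have := @expr_diff_le (M%:R + 2^-1) M%:R n (ler0n _ _); rewrite lerDl invr_ge0 => /(_ (ler0n _ _)).
  rewrite addrAC subrr add0r => hh.
  apply: (@le_trans _ _ (n.+1%:R * 2^-1 * (M%:R + 2^-1) ^+ n * volume_bound)).
    by apply: ler_pM => //; rewrite subr_ge0 lerXn2r ?nnegrE ?addr_ge0 ?invr_ge0// lerDl invr_ge0.
  have key : 2^-1 * (M%:R + 2^-1) ^+ n <= 2 ^+ n * M%:R ^+ n :> R.
    rewrite -exprMn (@le_trans _ _ ((M%:R + 2^-1) ^+ n))//.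
      by rewrite ler_piMl ?exprn_ge0 ?addr_ge0 ?invr_ge0// invf_le1// ler1n.
    by rewrite lerXn2r ?nnegrE ?addr_ge0 ?invr_ge0 ?mulr_ge0//; lra.
  have -> : n.+1%:R * 2^-1 * (M%:R + 2^-1) ^+ n * volume_bound =
    n.+1%:R * volume_bound * (2^-1 * (M%:R + 2^-1) ^+ n) by ring.
  have -> : n.+1%:R * 2 ^+ n * volume_bound * M%:R ^+ n =
    n.+1%:R * volume_bound * (2 ^+ n * M%:R ^+ n) by ring.
  by rewrite ler_wpM2l// mulr_ge0.
rewrite /asymp_const.
have hV : 0 <= volume_bound * M%:R ^+ n by rewrite mulr_ge0 ?exprn_ge0.
have := le_trans h hE; rewrite !mulrDl.
move: hD; rewrite !ler_norml; lra.
Qed.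

Lemma nroots_bounded (S : pred R) (ps : seq {poly R}) : exists B : nat, forall k : nat, (B <= k)%N ->
  forall p, p \in ps -> nroots S p = nroots [pred x | S x & `|x| <= k%:R] p.
Proof.
elim: ps => [|p ps [B hB]]; first by exists 0%N.
have [b hb] : exists b : nat, forall x, x \in rootsR p -> `|x| <= b%:R.
  elim: (rootsR p) => [|x s [b hb]]; first by exists 0%N.
  exists (maxn b (Num.trunc `|x|).+1) => y; rewrite inE => /predU1P[->|/hb yb].
    apply: le_trans (ltW (truncnS_gt _)) _; rewrite ler_nat leq_max leqnn orbT//.
  by apply: le_trans yb _; rewrite ler_nat leq_maxl.
exists (maxn B b) => k; rewrite geq_max => /andP[Bk bk] q; rewrite inE => /predU1P[->|qs].
  apply: eq_in_count => x /hb xb /=.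
  by rewrite (le_trans xb) ?ler_nat// andbT.
exact: hB.
Qed.

(** The bounds do not depend on the size of the interval, so they pass to the
    limit along S intersected with [-k, k]: the integrals converge monotonically,
    and for fixed M the root counts are eventually constant. *)
Theorem root_total_asymp (S : pred R) : convex S ->
  exists2 v : R, (\int[mu]_(x in [set x | S x]) density n x = v%:E)%E /\ 0 <= v <= volume_bound &
  forall M, (0 < M)%N -> `|M%:R ^+ n.+1 * v - (root_total n S M)%:R| <= asymp_const * M%:R ^+ n.
Proof.
move=> cS.
pose Sk k := [pred x | S x & `|x| <= k%:R].
have cSk k : convex (Sk k).
  move=> x y z /andP[Sx xk] /andP[Sz zk] /[dup] xyz /andP[xy yz].
  apply/andP; split; first exact: cS xyz.
  by move: xk zk; rewrite !ler_norml; lra.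
have hk k := @root_total_bounded (Sk k) k%:R (cSk k) (fun x h => (andP h).2).
have /choice[v hv] : forall k, exists w,
    [/\ (\int[mu]_(x in [set x | Sk k x]) density n x = w%:E)%E, 0 <= w <= volume_bound &
    forall M, (0 < M)%N ->
      `|M%:R ^+ n.+1 * w - (root_total n (Sk k) M)%:R| <= asymp_const * M%:R ^+ n].
  by move=> k; have [w [h1 h2] h3] := hk k; exists w.
have UE : \bigcup_k [set x | Sk k x] = [set x | S x].
  apply/seteqP; split => [x [k _ /andP[]//]|x /= Sx].
  exists (Num.trunc `|x|).+1 => //=; rewrite /Sk/= Sx/=.
  exact: ltW (truncnS_gt _).
have cvI : (\int[mu]_(x in [set x | Sk k x]) density n x)%E @[k --> \oo] -->
    (\int[mu]_(x in [set x | S x]) density n x)%E.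
  rewrite -UE; apply: ge0_nondecreasing_set_cvg_integral.
  - move=> k m km; apply/subsetPset => x /andP[Sx xk]; apply/andP; split => //.
    by apply: le_trans xk _; rewrite ler_nat.
  - by move=> k; exact: measurable_convex.
  - by move=> k; exact: measurable_density.
  - by move=> k x _; exact: density_ge0.
have cvv : (v k)%:E @[k --> \oo] --> (\int[mu]_(x in [set x | S x]) density n x)%E.
  by apply: cvg_trans cvI; apply: near_eq_cvg; apply: nearW => k; case: (hv k).
have I0 : (0 <= \int[mu]_(x in [set x | S x]) density n x)%E.
  by apply: integral_ge0 => x _; exact: density_ge0.
have IV : (\int[mu]_(x in [set x | S x]) density n x <= volume_bound%:E)%E.
  rewrite -(cvg_lim _ cvv)//; apply: lime_le; first by apply/cvg_ex; eexists; exact: cvv.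
  by apply: nearW => k; rewrite lee_fin; case: (hv k) => _ /andP[].
move: cvv I0 IV; case: (integral _ _ _) => [w| |] //=; rewrite !lee_fin => cvv w0 wV.
exists w; first by rewrite w0 wV.
move=> M M0.
have /fine_cvgP[_ cvv'] := cvv.
have cvn : `|M%:R ^+ n.+1 * v k - (root_total n S M)%:R| @[k --> \oo] -->
    `|M%:R ^+ n.+1 * w - (root_total n S M)%:R|.
  by apply: cvg_norm; apply: cvgB; [apply: cvgMr|exact: cvg_cst].
rewrite -(cvg_lim _ cvn)//; apply: limr_le; first by apply/cvg_ex; eexists; exact: cvn.
have [B hB] := nroots_bounded S [seq pR R p | p <- box n M].
exists B => // k /= Bk; have [_ _ /(_ M M0)] := hv k.
congr (`|_ - _%:R| <= _); rewrite /root_total big_seq [RHS]big_seq; apply: eq_bigr => p pb.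
by rewrite -(hB k)// map_f.
Qed.

End asymptotic.

(** * Partial sums of the zeta function and inversion *)

Section zeta_bounds.
Context (R : realType).
Implicit Types n M : nat.

Definition zeta_part n M : R := \sum_(d <- iota 1 M) (d%:R ^+ n.+1)^-1.

Lemma zeta_partS n M : zeta_part n M.+1 = zeta_part n M + (M.+1%:R ^+ n.+1)^-1.
Proof. by rewrite /zeta_part -[M.+1 in LHS]addn1 iotaD big_cat big_seq1 add1n. Qed.

Lemma invf_telescope M : (0 < M)%N -> (M.+1%:R ^+ 2)^-1 <= M%:R^-1 - M.+1%:R^-1 :> R.
Proof.
case: M => // M _.
have h : 0 < M.+1%:R :> R by rewrite ltr0n.
rewrite -[M.+2]addn1 natrD.
have -> : (M.+1%:R)^-1 - (M.+1%:R + 1%:R)^-1 = (M.+1%:R * (M.+1%:R + 1))^-1 :> R.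
  by field; rewrite !lt0r_neq0// addr_gt0.
by rewrite lef_pV2 ?posrE ?exprn_gt0 ?mulr_gt0 ?addr_gt0// expr2 ler_wpM2r ?lerDl ?addr_ge0// ltW.
Qed.

(** The tail is telescoped with 1/(N+1)^2 <= 1/N - 1/(N+1), the other factors
    being at most 1/M^(n-1). *)
Lemma zeta_part_tail n M N : (0 < n)%N -> (0 < M <= N)%N ->
  zeta_part n N + (M%:R ^+ n.-1)^-1 * N%:R^-1 <= zeta_part n M + (M%:R ^+ n)^-1.
Proof.
case: n => // n _ /andP[M0]; elim: N => [|N IH]; first by rewrite leqNgt M0.
rewrite leq_eqVlt => /predU1P[<-|]; first by rewrite -invfM -exprSr.
rewrite ltnS => MN; apply: le_trans (IH MN); rewrite zeta_partS -addrA lerD2l /=.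
have N0 : (0 < N)%N := leq_trans M0 MN.
rewrite -lerBrDr -mulrBr.
rewrite (_ : N.+1%:R ^+ n.+2 = N.+1%:R ^+ n * N.+1%:R ^+ 2); last by rewrite -exprD addn2.
rewrite invfM; apply: ler_pM; rewrite ?invr_ge0 ?exprn_ge0//; last exact: invf_telescope.
by rewrite lef_pV2 ?posrE ?exprn_gt0 ?ltr0n// lerXn2r ?nnegrE// ler_nat (leq_trans MN).
Qed.

Lemma zeta_part_mono n M N : (M <= N)%N -> zeta_part n M <= zeta_part n N.
Proof.
elim: N => [|N IH]; first by rewrite leqn0 => /eqP ->.
rewrite leq_eqVlt => /predU1P[->//|]; rewrite ltnS => /IH h.
by rewrite zeta_partS (le_trans h)// lerDl invr_ge0 exprn_ge0.
Qed.

(** 7/4 = 1 + 1/4 + 1/2, where 1/2 bounds the tail of the squares after 1/4.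
    What matters below is that the sum without its first term is less than 1. *)
Lemma zeta_part_le n M : (0 < n)%N -> zeta_part n M <= 7 / 4.
Proof.
move=> n0; apply: (@le_trans _ _ (zeta_part 1 M)).
  rewrite /zeta_part big_seq [leRHS]big_seq; apply: ler_sum => d.
  rewrite mem_iota => /andP[d0 _].
  by rewrite lef_pV2 ?posrE ?exprn_gt0 ?ltr0n// ler_weXn2l ?ler1n.
apply: (@le_trans _ _ (zeta_part 1 (maxn M 2))); first by rewrite zeta_part_mono ?leq_maxl.
have := @zeta_part_tail 1 2 (maxn M 2) isT; rewrite leq_maxr => /(_ isT).
rewrite {2}/zeta_part !big_cons big_nil /= expr0 invr1 mul1r expr1n invr1.
have : 0 <= (maxn M 2)%:R^-1 :> R by rewrite invr_ge0.
lra.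
Qed.

Lemma zeta_cvg n : (0 < n)%N -> zeta_part n M @[M --> \oo] --> zeta (n.+1%:R : R).
Proof.
move=> n0.
have -> : zeta n.+1%:R = limn (zeta_part n).
  rewrite /zeta (_ : series _ = zeta_part n)//; apply/funext => M.
  rewrite seriesEnat /= /zeta_part.
  rewrite -{1}(subn0 M) -[iota 1 M]/(iota (1 + 0) M) iotaDl big_map.
  rewrite /index_iota !subn0; apply: eq_bigr => k _.
  by rewrite powRN powR_mulrn// add1n.
apply: nondecreasing_is_cvgn; first by move=> M N; exact: zeta_part_mono.
by exists (7 / 4) => _ [M _ <-]; exact: zeta_part_le.
Qed.

Lemma zeta_ge n M : (0 < n)%N -> zeta_part n M <= zeta (n.+1%:R : R).
Proof.
move=> n0; rewrite -(cvg_lim _ (zeta_cvg n0))//; apply: limr_ge.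
  by apply/cvg_ex; eexists; exact: zeta_cvg.
by exists M => // N /= MN; exact: zeta_part_mono.
Qed.

Lemma zeta_le n M : (0 < n)%N -> (0 < M)%N ->
  zeta (n.+1%:R : R) <= zeta_part n M + (M%:R ^+ n)^-1.
Proof.
move=> n0 M0; rewrite -(cvg_lim _ (zeta_cvg n0))//; apply: limr_le.
  by apply/cvg_ex; eexists; exact: zeta_cvg.
exists M => // N /= MN; have := @zeta_part_tail n M N n0; rewrite M0 MN => /(_ isT).
apply: le_trans; by rewrite lerDl mulr_ge0 ?invr_ge0 ?exprn_ge0.
Qed.

Lemma zeta_ge1 n : (0 < n)%N -> 1 <= zeta (n.+1%:R : R).
Proof.
move=> n0; apply: le_trans (zeta_ge 1 n0).
by rewrite /zeta_part big_seq1 expr1n invr1.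
Qed.

Variables (n : nat) (T P : nat -> R) (C V v : R).
Hypotheses (n2 : (1 < n)%N) (v0 : 0 <= v) (vV : v <= V) (C0 : 0 <= C).
Hypothesis TP : forall M, (0 < M)%N -> T M = \sum_(d <- iota 1 M) P (M %/ d)%N.
Hypothesis Tv : forall M, (0 < M)%N -> `|M%:R ^+ n.+1 * v - T M| <= C * M%:R ^+ n.

Definition inversion_const : R := 4 * (C + V * (2 * n.+1%:R + 1)).

(** Recovers P from T without the Moebius function.  The error
    E m = m^(n+1) v/zeta(n+1) - P m satisfies, by the assumption on T and the
    estimate of the partial sums of zeta, that the sum of the E(m/d) is
    O(m^n).  Since the sum of d^-n over d >= 2 is at most 3/4, strong induction
    bounds E m itself: D + (3/4) 4 D = 4 D. *)
Lemma inversion M : (0 < M)%N ->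
  `|M%:R ^+ n.+1 * (v / zeta n.+1%:R) - P M| <= inversion_const * M%:R ^+ n.
Proof.
have n0 : (0 < n)%N := ltnW n2.
set Z := zeta _; have Z1 : 1 <= Z by exact: zeta_ge1.
have Z0 : 0 < Z by exact: lt_le_trans Z1.
pose c := v / Z.
have c0 : 0 <= c by rewrite divr_ge0// ltW.
have cV : c <= V.
  by rewrite ler_pdivrMr//; apply: le_trans vV _; rewrite ler_peMr// (le_trans v0).
have V0 : 0 <= V := le_trans v0 vV.
pose D := C + V * (2 * n.+1%:R + 1).
have D0 : 0 <= D by rewrite addr_ge0// mulr_ge0// addr_ge0// mulr_ge0.
pose E m := m%:R ^+ n.+1 * c - P m.
have sumE m : (0 < m)%N -> `|\sum_(d <- iota 1 m) E (m %/ d)%N| <= D * m%:R ^+ n.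
  move=> m0; have m1 : 1 <= m%:R :> R by rewrite ler1n.
  have mp : 0 < m%:R :> R by rewrite ltr0n.
  rewrite sumrB -TP// -mulr_suml.
  set s := \sum_(d <- _) _.
  (* Integer part: (m/d)^(n+1) exceeds its rounded version by at most
     (n+1) (m/d)^n. *)
  have s1 : m%:R ^+ n.+1 * zeta_part n m - s <= n.+1%:R * 2 * m%:R ^+ n.
    rewrite mulr_sumr -sumrB.
    apply: (@le_trans _ _ (\sum_(d <- iota 1 m) n.+1%:R * m%:R ^+ n * (d%:R ^+ n)^-1)).
      rewrite big_seq [leRHS]big_seq; apply: ler_sum => d; rewrite mem_iota => /andP[d0 _].
      have d0' : 0 < d%:R :> R by rewrite ltr0n.
      have mdE : m%:R = (m %/ d)%:R * d%:R + (m %% d)%:R :> R.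
        by rewrite -natrM -natrD -divn_eq.
      have lo : (m %/ d)%:R <= m%:R / d%:R :> R.
        by rewrite ler_pdivlMr// [leRHS]mdE lerDl.
      have hi : m%:R / d%:R - (m %/ d)%:R <= 1 :> R.
        rewrite lerBlDr ler_pdivrMr// [leLHS]mdE mulrDl mul1r addrC lerD2r.
        by rewrite ler_nat ltnW// ltn_mod.
      have := expr_diff_le n (ler0n R (m %/ d)) lo.
      rewrite -expr_div_n => /le_trans; apply.
      rewrite expr_div_n -[leRHS]mulrA ler_wpM2r ?mulr_ge0 ?invr_ge0 ?exprn_ge0//.
      by rewrite ler_piMr.
    rewrite -mulr_sumr -[leRHS]mulrA [2 * _]mulrC [leRHS]mulrA ler_wpM2l ?mulr_ge0 ?exprn_ge0//.
    have := zeta_part_le (n := n.-1) m; rewrite -subn1 subn_gt0 => /(_ n2).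
    rewrite /zeta_part subn1 (prednK n0) => /le_trans; apply; lra.
  have s2 : s <= m%:R ^+ n.+1 * zeta_part n m.
    rewrite mulr_sumr /s big_seq [leRHS]big_seq; apply: ler_sum => d; rewrite mem_iota => /andP[d0 _].
    have d0' : 0 < d%:R :> R by rewrite ltr0n.
    rewrite -expr_div_n lerXn2r ?nnegrE ?divr_ge0// ler_pdivlMr//.
    by rewrite -natrM ler_nat leq_trunc_div.
  have z1 := zeta_ge m n0; have z2 := zeta_le n0 m0; rewrite -/Z in z1 z2.
  have z2' : m%:R ^+ n.+1 * Z <= m%:R ^+ n.+1 * zeta_part n m + m%:R ^+ n.
    apply: (@le_trans _ _ (m%:R ^+ n.+1 * zeta_part n m + m%:R)).
      have e : m%:R = m%:R ^+ n.+1 * (m%:R ^+ n)^-1 :> R.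
        by rewrite exprS mulfK// expf_neq0 ?lt0r_neq0.
      by rewrite [X in _ + X]e -mulrDr ler_pM2l ?exprn_gt0.
    by rewrite lerD2l -[leLHS]expr1 ler_weXn2l.
  have z1' : m%:R ^+ n.+1 * zeta_part n m <= m%:R ^+ n.+1 * Z.
    by rewrite ler_wpM2l ?exprn_ge0.
  have vE : v = Z * c by rewrite /c mulrC mulfVK// lt0r_neq0.
  have h1 : `|m%:R ^+ n.+1 * v - s * c| <= V * (2 * n.+1%:R + 1) * m%:R ^+ n.
    rewrite vE mulrA -mulrBl normrM (ger0_norm c0) mulrC -mulrA ler_pM//.
    rewrite ger0_norm; last by rewrite subr_ge0 (le_trans s2).
    by rewrite mulrDl mul1r; move: s1; rewrite [2 * _]mulrC; lra.
  have := Tv m0; move: h1; rewrite /D [(C + _) * _]mulrDl !ler_norml; lra.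
suff : forall N m, (0 < m <= N)%N -> `|E m| <= 4 * D * m%:R ^+ n.
  by move=> h M0; apply: (h M); rewrite M0 leqnn.
elim=> [|N IH] m /andP[m0 mN]; first by move: (leq_trans m0 mN).
have m1 : 1 <= m%:R :> R by rewrite ler1n.
have := sumE m m0.
have iE : iota 1 m = 1%N :: iota 2 m.-1 by case: (m) m0.
rewrite iE big_cons divn1.
set r := \sum_(d <- _) _ => h.
(* r collects the terms with d >= 2, where the induction hypothesis applies. *)
have hr : `|r| <= 4 * D * m%:R ^+ n * (3 / 4).
  apply: le_trans (ler_norm_sum _ _ _) _.
  apply: (@le_trans _ _ (\sum_(d <- iota 2%N m.-1) 4 * D * m%:R ^+ n * (d%:R ^+ n)^-1)).
    rewrite big_seq [leRHS]big_seq; apply: ler_sum => d; rewrite mem_iota => /andP[d2 dm].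
    have d0 : (0 < d)%N by exact: ltnW.
    have md : (d <= m)%N by move: dm; rewrite add2n ltnS; case: (m) m0.
    apply: le_trans (IH _ _) _.
      by rewrite divn_gt0// md -ltnS (leq_trans _ mN)// ltn_Pdiv.
    rewrite -[leRHS]mulrA ler_wpM2l ?mulr_ge0// -expr_div_n lerXn2r ?nnegrE ?divr_ge0//.
    by rewrite ler_pdivlMr ?ltr0n// -natrM ler_nat leq_trunc_div.
  rewrite -mulr_sumr ler_wpM2l ?mulr_ge0 ?exprn_ge0//.
  have := zeta_part_le (n := n.-1) m; rewrite -subn1 subn_gt0 => /(_ n2).
  rewrite /zeta_part subn1 (prednK n0) iE.
  rewrite big_cons expr1n invr1; lra.
move: h hr; rewrite !ler_norml; lra.
Qed.

End zeta_bounds.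

(** * Primitive polynomials *)

Section content.
Context (R : realType).
Implicit Types (p q : {poly int}).

Definition content p : nat := `|zcontents p|%N.

Definition prim_total n (S : pred R) M : nat :=
  \sum_(p <- box n M | content p == 1%N) nroots S (pR R p).

Lemma contentZ c p : content (c *: p) = (`|c| * content p)%N.
Proof. by rewrite /content zcontentsZ abszM. Qed.

Lemma content_eq0 p : (content p == 0%N) = (p == 0).
Proof. by rewrite /content absz_eq0 zcontents_eq0. Qed.

Lemma pR_eq0 p : (pR R p == 0) = (p == 0).
Proof.
apply/eqP/eqP => [h|->]; last exact: map_poly0.
apply/polyP => i; rewrite coef0; have /eqP := congr1 (fun q : {poly R} => q`_i) h.
by rewrite coef_map coef0 /= intr_eq0 => /eqP.
Qed.

Lemma pRZ c p : pR R (c *: p) = c%:~R *: pR R p.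
Proof. by rewrite /pR map_polyZ. Qed.

Lemma height_coef p i : (`|(p`_i)%R| <= height p)%N.
Proof.
have [pi|pi] := leqP (size p) i; first by rewrite nth_default.
exact: (leq_bigmax (Ordinal pi)).
Qed.

Lemma height_leP p M : reflect (forall i, (`|(p`_i)%R| <= M)%N) (height p <= M)%N.
Proof.
apply: (iffP idP) => [h i|h]; first exact: leq_trans (height_coef p i) h.
by rewrite height_le; apply/forallP => i; exact: h.
Qed.

Lemma mem_boxZ n M d q : (0 < d)%N -> (d%:Z *: q \in box n M) = (q \in box n (M %/ d)).
Proof.
move=> d0; rewrite !mem_box size_scale; last by case: d d0.
congr andb; apply/height_leP/height_leP => h i; have := h i;
  by rewrite coefZ abszM absz_nat leq_divRL// mulnC.
Qed.

Lemma content_le n M p : p != 0 -> p \in box n M -> (0 < content p <= M)%N.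
Proof.
move=> p0; rewrite mem_box => /andP[_ /height_leP hM].
rewrite lt0n content_eq0 p0 /=.
have lc0 : lead_coef p != 0 by rewrite lead_coef_eq0.
apply: leq_trans (hM (size p).-1); rewrite -/(lead_coef p).
apply: dvdn_leq; first by rewrite absz_gt0.
have := dvdz_contents (zcontents p) p; rewrite dvdzz => /esym/polyOverP/(_ (size p).-1).
by rewrite -/(lead_coef p).
Qed.

Lemma content_decomp p d : content p = d -> (0 < d)%N ->
  exists2 q, content q = 1%N & p = d%:Z *: q.
Proof.
move=> cp d0; exists (Num.sg (zcontents p) *: zprimitive p).
  rewrite contentZ /content zcontents_primitive.
  have p0 : p != 0 by rewrite -content_eq0 cp -lt0n.
  have : zcontents p != 0 by rewrite zcontents_eq0.
  by rewrite p0; case: sgrP.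
rewrite scalerA {1}[p]zpolyEprim; congr (_ *: _).
by rewrite -cp /content abszE mulrC; exact: numEsg.
Qed.

(** A nonzero polynomial is in a unique way d times a primitive one, d being its
    content, and division by d maps the polynomials of height at most M and
    content d onto the primitive ones of height at most M/d. *)
Lemma root_total_content n (S : pred R) M : (0 < M)%N ->
  root_total n S M = (\sum_(d <- iota 1 M) prim_total n S (M %/ d))%N.
Proof.
move=> M0; rewrite /root_total.
have F0 p : p == 0 -> nroots S (pR R p) = 0%N.
  by rewrite -pR_eq0 => /eqP ->; rewrite nroots0.
transitivity (\sum_(p <- box n M) \sum_(d <- iota 1 M | content p == d) nroots S (pR R p))%N.
  rewrite big_seq [RHS]big_seq; apply: eq_bigr => p pM.
  have [/[dup] /eqP -> /F0 ->|p0] := boolP (p == 0); first by rewrite big1.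
  rewrite -big_filter (_ : [seq d <- iota 1 M | content p == d] = [:: content p]) ?big_seq1//.
  apply: perm_small_eq => //; apply: uniq_perm => //; first by rewrite filter_uniq ?iota_uniq.
  move=> d; rewrite mem_filter inE mem_iota eq_sym; case: eqVneq => //= ->.
  by rewrite add1n ltnS; exact: content_le pM.
rewrite (exchange_big_dep xpredT)//= big_seq [RHS]big_seq; apply: eq_bigr => d.
rewrite mem_iota => /andP[d0 _].
rewrite /prim_total -big_filter -[RHS]big_filter.
transitivity (\sum_(p <- [seq d%:Z *: q | q <- box n (M %/ d) & content q == 1%N]) nroots S (pR R p))%N.
  apply: perm_big; apply: uniq_perm.
  - by rewrite filter_uniq ?uniq_box.
  - rewrite map_inj_uniq ?filter_uniq ?uniq_box// => p q /polyP e.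
    apply/polyP => i; have := e i; rewrite !coefZ => /mulfI; apply.
    by case: d d0 {e}.
  move=> p; rewrite mem_filter; apply/andP/mapP => [[/eqP cp pM]|[q]].
    have [q q1 pE] := content_decomp cp d0; exists q => //.
    by rewrite mem_filter q1 eqxx -(mem_boxZ _ _ _ d0) -pE.
  rewrite mem_filter => /andP[/eqP q1 qM] ->; split; last by rewrite mem_boxZ.
  by rewrite contentZ q1 muln1 absz_nat.
rewrite big_map; apply: eq_bigr => q _; rewrite pRZ nroots_scale//.
by rewrite intr_eq0; case: d d0.
Qed.

Theorem prim_total_asymp n : (1 < n)%N -> exists C : R, forall (S : pred R), convex S ->
  exists2 v : R, (\int[@lebesgue_measure R]_(x in [set x | S x]) density n x = v%:E)%E /\
     0 <= v <= volume_bound R n &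
  forall M, (0 < M)%N ->
   `|M%:R ^+ n.+1 * (v / zeta n.+1%:R) - (prim_total n S M)%:R| <= C * M%:R ^+ n.
Proof.
move=> n1; exists (inversion_const n (asymp_const R n) (volume_bound R n)) => S cS.
have [v [vE /andP[v0 vV]] h] := root_total_asymp n cS; exists v; first by rewrite v0.
move=> M M0.
apply: (@inversion _ _ (fun M => (root_total n S M)%:R : R) (fun M => (prim_total n S M)%:R)) => //.
- have := h 1%N isT; rewrite !expr1n mulr1; exact: le_trans.
- by move=> m m0; rewrite root_total_content// natr_sum.
Qed.
End content.

(** * Gelfond's inequality *)

Section gelfond.
Implicit Types (g h q : {poly int}).

(** A bound for the coefficients in interpolation at k integer nodes of [0, n];
    see interp_bound for the recursion. *)
Fixpoint interp_const n k : nat :=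
  if k is k'.+1 then (1 + 2 * n.+1 * interp_const n k')%N else 0%N.

(** A polynomial is bounded by its values at as many points as its size.  Write
    g = g(x0) + (X - x0) q.  As distinct integers are at distance at least 1,
    q is at most 2 b at the other nodes; multiplication by X - x0 increases the
    height by a factor of at most n+1. *)
Lemma interp_bound n k (xs : seq nat) g (b : nat) : (size g <= k)%N -> uniq xs ->
  size xs = k -> (forall x, x \in xs -> (x <= n)%N /\ (`|(g.[x%:Z])%R| <= b)%N) ->
  (height g <= interp_const n k * b)%N.
Proof.
elim: k xs g b => [|k IH] xs g b sg uxs sxs hb.
  by move: sg; rewrite leqn0 size_poly_eq0 => /eqP ->; rewrite /height size_poly0 big_ord0.
case: xs uxs sxs hb => // x0 xs /= /andP[x0xs uxs] [sxs] hb.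
have [x0n gx0] := hb x0 (mem_head _ _).
have /factor_theorem[q qE] : root (g - (g.[x0%:Z])%:P) x0%:Z.
  by rewrite rootE !hornerE subrr.
have gE : g = q * ('X - (x0%:Z)%:P) + (g.[x0%:Z])%:P by rewrite -qE subrK.
have sq : (size q <= k)%N.
  have [->|q0] := eqVneq q 0; first by rewrite size_poly0.
  have : (size (q * ('X - (x0%:Z)%:P))%R <= k.+1)%N.
    rewrite -qE (leq_trans (size_polyD _ _))// geq_max sg size_polyN.
    by rewrite (leq_trans (size_polyC_leq1 _)).
  by rewrite size_Mmonic ?monicXsubC// size_XsubC addnS/= addn1.
have hq : (height q <= interp_const n k * (2 * b))%N.
  apply: (IH xs) => // x xxs; have [xn gx] := hb x ltac:(by rewrite inE xxs orbT).
  split => //; have := congr1 (fun p : {poly int} => p.[x%:Z]) qE; rewrite !hornerE /=.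
  set u := g.[x%:Z] in gx *; set w := g.[x0%:Z] in gx0 *; set z := q.[_] => e.
  have xx0 : x%:Z - x0%:Z != 0.
    by rewrite subr_eq0; apply: contraNneq x0xs => -[<-].
  have : (`|z| <= `|(z * (x%:Z - x0%:Z))%R|)%N by rewrite abszM leq_pmulr// absz_gt0.
  by rewrite -e; lia.
apply/height_leP => i; rewrite gE coefD mulrBr coefB coefMC coefC.
have h1 := leq_trans (height_coef q i) hq.
have h2 : (`|((q * 'X)`_i)%R| <= interp_const n k * (2 * b))%N.
  by rewrite coefMX; case: i {h1} => //= i; exact: leq_trans (height_coef q i) hq.
have h3 : (`|(q`_i * x0%:Z)%R| <= n * (interp_const n k * (2 * b)))%N.
  by rewrite abszM absz_nat mulnC leq_mul.
have h4 : (`|(if i == 0%N then g.[x0%:Z] else 0)%R| <= b)%N by case: ifP.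
move: h2 h3 h4; set A := (q * 'X)`_i; set B := q`_i * _; set D := (if _ then _ else _).
rewrite mulnDl mul1n -mulnA mulSn mulnDr.
set I := (interp_const n k)%N; lia.
Qed.

Lemma interp_const_mono n k m : (k <= m)%N -> (interp_const n k <= interp_const n m)%N.
Proof.
elim: m k => [|m IH] [|k] //=; rewrite ltnS => /IH h.
by rewrite leq_add2l leq_mul2l h orbT.
Qed.

(** A nonzero g cannot be small, compared with its height, at size g points of
    0, ..., n. *)
Lemma small_values n g : (size g <= n.+1)%N -> g != 0 ->
  (count (fun x : nat => (interp_const n n.+1 * `|(g.[x%:Z])%R| < height g)%N) (iota 0 n.+1)
   < size g)%N.
Proof.
move=> sg g0; rewrite ltnNge; apply/negP => h.
pose bad := [seq x <- iota 0 n.+1 | (interp_const n n.+1 * `|(g.[x%:Z])%R| < height g)%N].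
have sbad : (size g <= size bad)%N by rewrite size_filter.
have C0 : (0 < interp_const n n.+1)%N by [].
have hg0 : (0 < height g)%N.
  have lc0 : lead_coef g != 0 by rewrite lead_coef_eq0.
  by apply: leq_trans (height_coef g (size g).-1); rewrite absz_gt0.
have hbad x : x \in take (size g) bad ->
    (x <= n)%N /\ (`|(g.[x%:Z])%R| <= (height g).-1 %/ interp_const n n.+1)%N.
  move=> /mem_take; rewrite mem_filter mem_iota add0n ltnS => /andP[hx /andP[_ xn]].
  by split => //; rewrite leq_divRL// mulnC; move: hx; case: (height g) hg0.
have := @interp_bound n (size g) (take (size g) bad) g ((height g).-1 %/ interp_const n n.+1).
rewrite leqnn take_uniq ?filter_uniq ?iota_uniq// size_takel// => /(_ isT isT erefl hbad).
apply/negP; rewrite -ltnNge -[ltnRHS](prednK hg0) ltnS.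
apply: leq_trans (leq_trunc_div _ (interp_const n n.+1)).
by rewrite mulnC leq_mul2l interp_const_mono ?orbT.
Qed.

Lemma horner_height n (p : {poly int}) (x : nat) : (size p <= n.+1)%N -> (x <= n)%N ->
  (`|(p.[x%:Z])%R| <= n.+1 ^ n.+1 * height p)%N.
Proof.
move=> sp xn; rewrite (horner_coef_wide _ sp).
apply: (@leq_trans (\sum_(i < n.+1) n.+1 ^ n * height p)%N).
  apply: (leq_trans (_ : (_ <= \sum_(i < n.+1) `|(p`_i * x%:Z ^+ i)%R|)%N)).
    elim/big_ind2: _ => // a b c d ha hc.
    by apply: leq_trans (leqD_dist _ 0 _) _ || (have := leq_add ha hc; lia).
  apply: leq_sum => i _; rewrite abszM mulnC leq_mul ?height_coef//.
  rewrite abszX absz_nat (@leq_trans (n.+1 ^ i))//.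
    by case: (posnP i) => [->//|i0]; rewrite leq_exp2r// (leq_trans xn).
  by rewrite leq_pexp2l// -ltnS.
by rewrite sum_nat_const card_ord expnS mulnA.
Qed.

Definition gelfond_const n : nat := (interp_const n n.+1 ^ 2 * n.+1 ^ n.+1)%N.

(** The points of 0, ..., n at which g or h is small number at most
    deg g + deg h <= n, so at one of these n+1 points neither is; there the value
    of g h is at least a constant times the product of the heights, and it is at
    most a constant times the height of g h. *)
Theorem gelfond n g h : g != 0 -> h != 0 -> (size (g * h)%R <= n.+1)%N ->
  (height g * height h <= gelfond_const n * height (g * h)%R)%N.
Proof.
move=> g0 h0 sgh; have gh0 : g * h != 0 by rewrite mulf_neq0.
have sE : ((size g).-1 + (size h).-1 < n.+1)%N.
  move: sgh; rewrite size_mul//.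
  by move: g0 h0; rewrite -!size_poly_gt0; case: (size g) => // a; case: (size h) => // b; rewrite addSn addnS /=.
have gS := size_poly_gt0 g; have hS := size_poly_gt0 h; rewrite g0 in gS; rewrite h0 in hS.
have bg := @small_values n g; have bh := @small_values n h.
set C := interp_const n n.+1 in bg bh.
have {bg} bg := bg ltac:(lia) g0; have {bh} bh := bh ltac:(lia) h0.
pose Bg (x : nat) := (C * `|(g.[x%:Z])%R| < height g)%N.
pose Bh (x : nat) := (C * `|(h.[x%:Z])%R| < height h)%N.
have : has (predC (predU Bg Bh)) (iota 0 n.+1).
  have := count_predC (predU Bg Bh) (iota 0 n.+1); rewrite size_iota has_count.
  have : (count (predU Bg Bh) (iota 0 n.+1) <= count Bg (iota 0 n.+1) + count Bh (iota 0 n.+1))%N.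
    by rewrite -count_predUI leq_addr.
  by move: bg bh; rewrite -/Bg -/Bh; lia.
move=> /hasP[x]; rewrite mem_iota add0n ltnS => /andP[_ xn] /norP[].
rewrite /Bg /Bh -!leqNgt => gx hx.
apply: leq_trans (leq_mul gx hx) _.
rewrite mulnACA -abszM -hornerM /gelfond_const -/C -mulnn -[leqRHS]mulnA.
by apply: leq_mul => //; exact: horner_height.
Qed.
End gelfond.

(** * Counting reducible polynomials *)

Section reducible.
Implicit Types (p g h : {poly int}).

Definition factorable p : Prop :=
  exists g h, [/\ p = g * h, (1 < size g)%N & (1 < size h)%N].

Definition reducibles n M : seq {poly int} :=
  [seq p : {poly int} <- box n M | (size p == n.+1) && `[< factorable p >]].

Definition shell k a : seq {poly int} := [seq g : {poly int} <- box k a | height g == a].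

Lemma size_box n M : size (box n M) = (M.*2.+1 ^ n.+1)%N.
Proof.
rewrite size_map; elim: (n.+1) => // m IH.
by rewrite zlistsS size_allpairs size_iota IH expnS.
Qed.

Lemma size_shell k a : (0 < a)%N -> (size (shell k a) + (a.*2.-1) ^ k.+1 = a.*2.+1 ^ k.+1)%N.
Proof.
case: a => // a _; rewrite -size_box doubleS /= -size_box.
have /perm_size <- : perm_eq [seq g : {poly int} <- box k a.+1 | height g != a.+1] (box k a).
  apply: uniq_perm; rewrite ?filter_uniq ?uniq_box// => g.
  by rewrite mem_filter !mem_box andbCA; congr andb; rewrite -[RHS]ltnS ltn_neqAle.
by rewrite !size_filter count_predC.
Qed.

(** Products g h where deg g <= k, deg h <= n - k for some k <= n/2, and
    height g = a, height h <= N/a for some a.  Fixing the height of the smaller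
    factor is what makes the sum over a small. *)
Definition factor_pairs n N : seq {poly int} :=
  flatten [seq flatten [seq [seq (g : {poly int}) * h | g <- shell k a, h <- box (n - k) (N %/ a)]
    | a <- iota 1 N] | k <- [seq k <- iota 1 n | (k.*2 <= n)%N]].

Lemma size_factor_pairs n N : size (factor_pairs n N) =
  (\sum_(k <- iota 1 n | (k.*2 <= n)%N) \sum_(a <- iota 1 N)
     size (shell k a) * size (box (n - k) (N %/ a)))%N.
Proof.
rewrite /factor_pairs size_flatten sumnE big_map big_map big_filter.
apply: eq_bigr => k _; rewrite size_flatten sumnE !big_map.
by apply: eq_bigr => a _; rewrite size_allpairs.
Qed.

Lemma height_gt0 g : g != 0 -> (0 < height g)%N.
Proof.
move=> g0; have lc0 : lead_coef g != 0 by rewrite lead_coef_eq0.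
by apply: leq_trans (height_coef g (size g).-1); rewrite absz_gt0.
Qed.

Lemma reducibles_sub n M : {subset reducibles n M <= factor_pairs n (gelfond_const n * M)}.
Proof.
move=> p; rewrite mem_filter mem_box => /andP[/andP[/eqP sp /asboolP[g [h [pE sg sh]]]] /andP[_ hp]].
wlog le : g h pE sg sh / (size g <= size h)%N.
  move=> W; have [|/ltnW] := leqP (size g) (size h); first exact: (W g h).
  by apply: W => //; rewrite mulrC.
have g0 : g != 0 by rewrite -size_poly_gt0 ltnW.
have h0 : h != 0 by rewrite -size_poly_gt0 ltnW.
have se : (size g + size h = n.+2)%N.
  by move: sp; rewrite pE size_mul//; move: sg sh; set a := size g; set b := size h; lia.
have gel : (height g * height h <= gelfond_const n * M)%N.
  apply: leq_trans (gelfond g0 h0 (_ : _ <= n.+1)%N) _; first by rewrite -pE sp.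
  by rewrite leq_mul2l -pE hp orbT.
have hg := height_gt0 g0; have hh := height_gt0 h0.
apply/flattenP; exists (flatten [seq [seq (u : {poly int}) * w | u <- shell (size g).-1 a,
   w <- box (n - (size g).-1) (gelfond_const n * M %/ a)] | a <- iota 1 (gelfond_const n * M)]).
  have hk : (size g).-1 \in [seq k <- iota 1 n | (k.*2 <= n)%N].
    by rewrite mem_filter mem_iota; lia.
  by apply/mapP; exists (size g).-1.
apply/flattenP; exists [seq (u : {poly int}) * w | u <- shell (size g).-1 (height g),
   w <- box (n - (size g).-1) (gelfond_const n * M %/ (height g))].
  have ha : height g \in iota 1 (gelfond_const n * M).
    by rewrite mem_iota add1n ltnS hg (leq_trans _ gel)// leq_pmulr.
  by apply/mapP; exists (height g).
rewrite pE; apply: (allpairs_f (fun g h : {poly int} => g * h)).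
  by rewrite mem_filter eqxx mem_box leqnn andbT; lia.
rewrite mem_box leq_divRL// [(height h * _)%N]mulnC gel andbT; lia.
Qed.

Lemma size_reducibles n M : (size (reducibles n M) <=
  \sum_(k <- iota 1 n | (k.*2 <= n)%N) \sum_(a <- iota 1 (gelfond_const n * M))
     size (shell k a) * size (box (n - k) (gelfond_const n * M %/ a)))%N.
Proof.
rewrite -size_factor_pairs; apply: uniq_leq_size; first by rewrite filter_uniq ?uniq_box.
exact: reducibles_sub.
Qed.

Context (R : realType).

(** The shell of height a has O(a^k) elements by the mean value theorem applied
    to its defining difference of (k+1)-st powers. *)
Lemma pair_term_le n k N a : (k <= n)%N -> (0 < a <= N)%N ->
  (size (shell k a) * size (box (n - k) (N %/ a)))%:R <=
  k.+1%:R * 2 * 3 ^+ n.+1 * (a%:R ^+ k * (N%:R / a%:R) ^+ (n - k).+1) :> R.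
Proof.
move=> kn /andP[a0 aN].
have a1 : 1 <= a%:R :> R by rewrite ler1n.
have h1 : (size (shell k a))%:R <= k.+1%:R * 2 * (3 * a%:R) ^+ k :> R.
  have /(congr1 (fun m : nat => m%:R : R)) := size_shell k a0.
  rewrite natrD !natrX => /(canRL (addrK _)) ->.
  have e1 : a.*2.+1%:R = 2 * a%:R + 1 :> R by rewrite -natr1 -mul2n natrM.
  have e2 : a.*2.-1%:R = 2 * a%:R - 1 :> R.
    by case: (a) a0 => // b _; rewrite doubleS /= -mul2n -!natr1 natrM; ring.
  have := @expr_diff_le R a.*2.+1%:R a.*2.-1%:R k (ler0n _ _).
  rewrite e1 e2 => /(_ ltac:(lra)) /le_trans; apply.
  rewrite (_ : 2 * a%:R + 1 - (2 * a%:R - 1) = 2); last by ring.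
  by rewrite ler_wpM2l ?mulr_ge0// lerXn2r ?nnegrE; lra.
have h2 : (size (box (n - k) (N %/ a)))%:R <= (3 * (N%:R / a%:R)) ^+ (n - k).+1 :> R.
  rewrite size_box natrX lerXn2r ?nnegrE ?mulr_ge0 ?invr_ge0//.
  have : (N %/ a)%:R <= N%:R / a%:R :> R.
    by rewrite ler_pdivlMr ?ltr0n// -natrM ler_nat leq_trunc_div.
  have : 1 <= N%:R / a%:R :> R by rewrite ler_pdivlMr ?ltr0n// mul1r ler_nat.
  by rewrite -natr1 -mul2n natrM; lra.
rewrite natrM; apply: le_trans (ler_pM _ _ h1 h2) _ => //.
rewrite !exprMn le_eqVlt; apply/orP; left; apply/eqP.
rewrite (_ : n.+1 = k + (n - k).+1)%N; last by lia.
by rewrite exprD; ring.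
Qed.

Lemma harmonic_le N : (0 < N)%N -> \sum_(a <- iota 1 N) a%:R^-1 <= 1 + ln N%:R :> R.
Proof.
case: N => // N _; elim: N => [|N IH].
  by rewrite big_seq1 ln1 addr0 invr1.
rewrite -[X in iota 1 X]addn1 iotaD big_cat big_seq1 add1n.
have p1 : 0 < N.+1%:R :> R by rewrite ltr0n.
have p2 : 0 < N.+2%:R :> R by rewrite ltr0n.
have h : ln (N.+1%:R / N.+2%:R) <= - (N.+2%:R^-1) :> R.
  have -> : N.+1%:R / N.+2%:R = 1 + (- N.+2%:R^-1) :> R.
    rewrite -[N.+2%:R]natr1; move: p1; set x := N.+1%:R => p1; field; apply: lt0r_neq0; by rewrite addr_gt0.
  by apply: le_ln1Dx; rewrite ltrN2 invf_lt1// ltr1n.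
rewrite ln_div ?posrE// in h.
by apply: le_trans (lerD IH (lexx _)) _; move: h; set x := N.+2%:R^-1; set y := ln _; set z := ln _; lra.
Qed.

(** The general term is N^(n-k+1) a^(2k-n-1).  For k >= 2 each of the N terms is
    at most N^(n-1); for k = 1 the sum of a^(1-n) converges, except if n = 2
    where it is harmonic and produces the logarithm. *)
Lemma pair_sum_le n k N : (1 < n)%N -> (0 < k)%N -> (k.*2 <= n)%N -> (0 < N)%N ->
  \sum_(a <- iota 1 N) (a%:R ^+ k * (N%:R / a%:R) ^+ (n - k).+1)
    <= 2 * N%:R ^+ n * (1 + ln N%:R) ^+ ell n :> R.
Proof.
move=> n1 k0 kn N0.
have Nge1 : 1 <= N%:R :> R by rewrite ler1n.
have N0' : 0 <= N%:R ^+ n :> R by rewrite exprn_ge0.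
have [k1|k1] := leqP k 1%N.
  have {k1 k0 kn} -> : k = 1%N by lia.
  have -> : \sum_(a <- iota 1 N) (a%:R ^+ 1 * (N%:R / a%:R) ^+ (n - 1).+1) =
      N%:R ^+ n * \sum_(a <- iota 1 N) (a%:R ^+ n.-1)^-1 :> R.
    rewrite mulr_sumr big_seq [RHS]big_seq; apply: eq_bigr => a; rewrite mem_iota => /andP[a0 _].
    rewrite subn1 prednK 1?ltnW// expr1 expr_div_n -[in a%:R ^+ n](prednK (ltnW n1)) exprS invfM.
    by rewrite mulrCA mulrA mulrA mulfK ?mulrA// pnatr_eq0 -lt0n.
  rewrite [2 * _]mulrC -mulrA ler_wpM2l//.
  move: n1; rewrite leq_eqVlt => /predU1P[<-|n2].
    rewrite /ell /= expr1; under eq_bigr do rewrite expr1.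
    apply: le_trans (harmonic_le N0) _; rewrite ler_peMl// ?ler1n//.
    by rewrite addr_ge0// ln_ge0.
  rewrite /ell gtn_eqF// expr0 mulr1.
  have := @zeta_part_le R n.-2 N; rewrite -subn2 subn_gt0 => /(_ n2).
  rewrite /zeta_part (_ : (n - 2).+1 = n.-1)%N; last by lia.
  move=> /le_trans; apply; lra.
have n3 : (n == 2)%N = false by lia.
rewrite /ell n3 expr0 mulr1.
apply: (@le_trans _ _ (\sum_(a <- iota 1 N) N%:R ^+ (n - k).+1)).
  rewrite big_seq [leRHS]big_seq; apply: ler_sum => a; rewrite mem_iota => /andP[a0 _].
  rewrite expr_div_n mulrCA ler_piMr ?exprn_ge0// ler_pdivrMr ?exprn_gt0 ?ltr0n// mul1r.
  by rewrite ler_weXn2l ?ler1n//; lia.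
rewrite big_const_seq count_predT size_iota iter_addr_0 -[_ *+ N]mulr_natr -exprSr.
apply: (@le_trans _ _ (N%:R ^+ n)); first by rewrite ler_weXn2l//; lia.
by rewrite ler_peMl// ler1n.
Qed.

Theorem reducibles_asymp n : (1 < n)%N -> exists2 C : R, 0 <= C & forall M, (0 < M)%N ->
  (size (reducibles n M))%:R <= C * (M%:R ^+ n * (1 + ln M%:R) ^+ ell n).
Proof.
move=> n1; set c := gelfond_const n.
have c0 : (0 < c)%N by rewrite /c /gelfond_const muln_gt0 !expn_gt0.
have c1 : 1 <= c%:R :> R by rewrite ler1n.
have lnc : 0 <= ln c%:R :> R by rewrite ln_ge0.
pose K : R := n.+1%:R * 2 * 3 ^+ n.+1.
have K0 : 0 <= K by rewrite !mulr_ge0// exprn_ge0.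
exists (n%:R * (K * (2 * c%:R ^+ n * (1 + ln c%:R) ^+ ell n))).
  by rewrite !mulr_ge0 ?exprn_ge0// addr_ge0.
move=> M M0.
have M1 : 1 <= M%:R :> R by rewrite ler1n.
have lnM0 : 0 <= ln M%:R :> R by rewrite ln_ge0.
pose N := (c * M)%N; have N0 : (0 < N)%N by rewrite muln_gt0 c0.
have NN : 1 <= N%:R :> R by rewrite ler1n.
apply: (@le_trans _ _ (\sum_(k <- iota 1 n | (k.*2 <= n)%N)
    K * (2 * N%:R ^+ n * (1 + ln N%:R) ^+ ell n))).
  apply: le_trans (_ : _ <= (\sum_(k <- iota 1 n | (k.*2 <= n)%N) \sum_(a <- iota 1 N)
     size (shell k a) * size (box (n - k) (N %/ a)))%:R) _.
    by rewrite ler_nat size_reducibles.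
  rewrite natr_sum big_seq_cond [leRHS]big_seq_cond; apply: ler_sum => k.
  rewrite mem_iota => /andP[/andP[k0 _] kn].
  rewrite natr_sum; apply: le_trans (_ : _ <= \sum_(a <- iota 1 N)
     K * (a%:R ^+ k * (N%:R / a%:R) ^+ (n - k).+1)) _.
    rewrite big_seq [leRHS]big_seq; apply: ler_sum => a; rewrite mem_iota add1n ltnS => aN.
    apply: le_trans (pair_term_le _ _) _ => //; first by lia.
    rewrite ler_wpM2r ?mulr_ge0 ?exprn_ge0 ?divr_ge0//.
    by rewrite ler_wpM2r ?exprn_ge0// ler_wpM2r// ler_nat; lia.
  by rewrite -mulr_sumr ler_wpM2l// pair_sum_le.
rewrite -big_filter big_const_seq count_predT iter_addr_0 -[leLHS]mulr_natl -[leRHS]mulrA ler_pM//.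
- by rewrite !mulr_ge0 ?exprn_ge0// addr_ge0// ln_ge0.
- by rewrite ler_nat size_filter -[leqRHS](size_iota 1) count_size.
rewrite -!mulrA ler_wpM2l// ler_wpM2l//.
have -> : N%:R = c%:R * M%:R :> R by rewrite natrM.
rewrite exprMn lnM ?posrE ?ltr0n//.
rewrite -!mulrA; do 3 rewrite ler_wpM2l ?exprn_ge0//.
rewrite [leRHS]mulrCA ler_wpM2l ?exprn_ge0// -exprMn.
have h : 0 <= ln c%:R * ln M%:R :> R by rewrite mulr_ge0.
by rewrite lerXn2r ?nnegrE ?mulr_ge0 ?addr_ge0//; lra.
Qed.
End reducible.

(** * Algebraic numbers and their minimal polynomials *)

Section min_poly.
Context (R : realType).
Implicit Types (p q : {poly int}) (x : R).

Lemma counting_seq (T : choiceType) (s : seq T) : uniq s ->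
  counting [set x | x \in s] = ((size s)%:R : R)%:E.
Proof.
move=> us; have fs : finite_set [set x | x \in s] by exact: finite_seq.
rewrite /counting asboolT//; congr (_%:R)%:E.
apply: perm_size; apply: uniq_perm => //.
by move=> x; rewrite in_fset_set//; apply/idP/idP; rewrite in_setE.
Qed.

(** The pseudo-remainder of q by p also vanishes at x and is shorter than p,
    hence zero; Gauss's lemma then gives divisibility over the integers. *)
Lemma min_poly_dvd x p q : is_min_poly x p -> root (pR R q) x ->
  exists r, q = zprimitive p * r.
Proof.
move=> [rp cp minp] rq.
have p0 : p != 0 by apply/eqP => p0; move: cp; rewrite p0 zcontents0.
suff : (q %% p == 0)%R by move=> /dvdpP_int[r ->]; exists r.
apply/negPn/negP => m0; have := minp _ m0; rewrite leqNgt Pdiv.Idomain.ltn_modp p0.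
move=> /(_ _)/negP; apply=> //.
have /(congr1 (fun u => (pR R u).[x])) := Pdiv.Idomain.divp_eq q p.
rewrite /pR !rmorphD !rmorphM /= map_polyZ !hornerE.
by move: rp rq; rewrite /root => /eqP-> /eqP->; rewrite !mulr0 add0r => <-.
Qed.

Lemma content_primitive p : content p = 1%N -> zprimitive p = p \/ zprimitive p = - p.
Proof.
rewrite /content => c1; have := zpolyEprim p.
have : (zcontents p == 1) || (zcontents p == -1) by lia.
case/orP => /eqP ->; first by rewrite scale1r; left.
by rewrite scaleN1r => e; right; rewrite {2}e opprK.
Qed.

Lemma min_poly_uniq x p q : is_min_poly x p -> is_min_poly x q ->
  0 < lead_coef p -> 0 < lead_coef q -> p = q.
Proof.
move=> mp mq lp lq; have [rq cq minq] := mq; have [rp cp minp] := mp.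
have [r qE] := min_poly_dvd mp rq.
have p0 : p != 0 by rewrite -lead_coef_eq0 gt_eqF.
have q0 : q != 0 by rewrite -lead_coef_eq0 gt_eqF.
have r0 : r != 0 by apply: contraNneq q0 => r0; rewrite qE r0 mulr0.
have sz : size q = size p.
  by apply/eqP; rewrite eqn_leq minp// minq.
have : size r = 1%N.
  move: sz; rewrite qE size_mul ?zprimitive_eq0// size_zprimitive.
  have := size_poly_gt0 p; have := size_poly_gt0 r; rewrite p0 r0; move: (size p) (size r) => a b; lia.
move=> /eqP/size_poly1P[c c0 rE].
have cE : `|c|%N = 1%N.
  move: cq; rewrite qE rE mulrC mul_polyC zcontentsZ zcontents_primitive abszM p0.
  by rewrite muln1.
have : q = p \/ q = - p.
  have : (c == 1) || (c == -1) by lia.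
  rewrite qE rE mulrC mul_polyC.
  by case: (content_primitive cp) => ->; case/orP => /eqP->; rewrite ?scale1r ?scaleN1r ?opprK; auto.
by case=> // e; move: lq; rewrite e lead_coefN oppr_gt0 ltNge ltW.
Qed.

(** A shorter polynomial vanishing at x may be taken of least size and
    primitive; it then divides p properly. *)
Lemma root_min_or_factor x p n : content p = 1%N -> size p = n.+1 -> root (pR R p) x ->
  ~ factorable p -> is_min_poly x p.
Proof.
move=> cp sp rp nf; split => //.
have p0 : p != 0 by rewrite -size_poly_gt0 sp.
suff H : forall m q, (size q <= m)%N -> q != 0 -> root (pR R q) x -> (size p <= size q)%N.
  by move=> q; exact: (H (size q)).
elim=> [|m IH] q sq q0 rq.
  by move: sq; rewrite leqn0 size_poly_eq0 (negbTE q0).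
have [//|qp] := leqP (size p) (size q); exfalso; apply: nf.
have mq : is_min_poly x (zprimitive q).
  split.
  - move: rq; rewrite {1}[q]zpolyEprim pRZ rootZ//.
    by rewrite intr_eq0 zcontents_eq0.
  - by rewrite zcontents_primitive q0.
  - move=> u u0 ru; rewrite size_zprimitive leqNgt; apply/negP => us.
    by have := IH u (leq_trans us sq) u0 ru; rewrite leqNgt (ltn_trans us qp).
have [r pE] := min_poly_dvd mq rp.
have r0 : r != 0 by apply: contraNneq p0 => r0; rewrite pE r0 mulr0.
have q1 : (1 < size q)%N.
  rewrite ltnNge; apply: contraL rq => /size1_polyC qE.
  move: q0; rewrite qE polyC_eq0 => c0.
  by rewrite /pR map_polyC rootC intr_eq0.
exists (zprimitive (zprimitive q)), r; split => //; rewrite ?size_zprimitive//.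
have := congr1 (fun u : {poly int} => size u) pE.
rewrite size_mul ?zprimitive_eq0// !size_zprimitive; move: qp q1.
move: (size p) (size q) (size r) => a b d; lia.
Qed.

Variables (n M : nat) (S : pred R).
Hypothesis n0 : (0 < n)%N.

Definition minroots p : seq R := [seq x <- rootsR (pR R p) | S x && `[< is_min_poly x p >]].

Let posbox := [seq p : {poly int} <- box n M | (size p == n.+1) && (0 < lead_coef p)].

(** The algebraic numbers, without repetition: of the two minimal polynomials of
    a number, the one with positive leading coefficient is used. *)
Definition alg_list : seq R := [seq x | p <- posbox, x <- minroots p].

Lemma mem_minroots x p : (x \in minroots p) = S x && `[< is_min_poly x p >].
Proof.
rewrite mem_filter; apply/andP/idP => [[]//|/[dup] h /andP[Sx /asboolP[rx cp _]]]; split => //.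
by rewrite mem_rootsR// pR_eq0; apply/eqP => p0; move: cp; rewrite p0 zcontents0.
Qed.

Lemma is_min_polyN x p : is_min_poly x p -> is_min_poly x (- p).
Proof.
move=> [rp cp mp]; split.
- by rewrite rmorphN rootN.
- by rewrite -scaleN1r zcontentsZ abszM mul1n.
- by move=> q q0 rq; rewrite size_polyN; exact: mp.
Qed.

Lemma uniq_alg_list : uniq alg_list.
Proof.
rewrite /alg_list; apply: allpairs_uniq_dep.
- by rewrite filter_uniq ?uniq_box.
- by move=> p _; rewrite filter_uniq ?uniq_rootsR.
move=> u w /allpairsPdep[p [x [pin xin ->]]] /allpairsPdep[q [y [qin yin ->]]] /= xy.
move: xin yin; rewrite !mem_minroots xy => /andP[_ /asboolP mp] /andP[_ /asboolP mq].
move: pin qin; rewrite !mem_filter => /andP[/andP[_ lp] _] /andP[/andP[_ lq] _].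
by rewrite (min_poly_uniq mp mq lp lq).
Qed.

Lemma mem_alg_list (Q : R) x : M = Num.trunc Q -> 0 <= Q ->
  (x \in alg_list) <-> (algebraic_numbers n Q `&` [set x | S x]) x.
Proof.
move=> ME Q0.
have hQ (p : {poly int}) : ((height p)%:R <= Q) = (height p <= M)%N.
  by rewrite ME truncn_ge_nat.
split.
  move=> /allpairsPdep[p [y [pin yin ->]]].
  move: pin; rewrite mem_filter mem_box => /andP[/andP[/eqP sp _] /andP[_ hp]].
  move: yin; rewrite mem_minroots => /andP[Sy /asboolP mp]; split => //.
  by exists p; rewrite sp hQ.
move=> [[p [mp sp]]]; rewrite hQ => hp Sx.
have [rp cp _] := mp.
have p0 : p != 0 by apply/eqP => p0; move: cp; rewrite p0 zcontents0.
have sp' : size p = n.+1 by rewrite -sp prednK ?size_poly_gt0.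
have := p0; rewrite -lead_coef_eq0; case: ltgtP => // lp _.
  apply/allpairsPdep; exists (- p), x; split => //.
    rewrite mem_filter size_polyN sp' eqxx lead_coefN oppr_gt0 lp mem_box size_polyN sp' leqnn.
    by apply/height_leP => i; rewrite coefN abszN; move/height_leP: hp.
  by rewrite mem_minroots Sx; apply/asboolP; exact: is_min_polyN.
apply/allpairsPdep; exists p, x; split => //.
  by rewrite mem_filter sp' eqxx lp mem_box sp' leqnn.
by rewrite mem_minroots Sx; apply/asboolP.
Qed.

Lemma PhiE (Q : R) : M = Num.trunc Q -> 0 <= Q ->
  Phi n Q [set x | S x] = ((size alg_list)%:R)%:E.
Proof.
move=> ME Q0; rewrite /Phi -counting_seq ?uniq_alg_list//; congr counting.
by apply/seteqP; split => x; move/(mem_alg_list x ME Q0).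
Qed.

Lemma size_minrootsN p : size (minroots (- p)) = size (minroots p).
Proof.
apply: perm_size; apply: uniq_perm; rewrite ?filter_uniq ?uniq_rootsR// => x.
rewrite !mem_minroots; congr andb; apply/asboolP/asboolP => /is_min_polyN//.
by rewrite opprK.
Qed.

Lemma double_alg_list :
  (\sum_(p <- box n M | size p == n.+1) size (minroots p) = (size alg_list).*2)%N.
Proof.
rewrite (bigID (fun p : {poly int} => 0 < lead_coef p)) /= -addnn.
have sz : size alg_list = (\sum_(p <- posbox) size (minroots p))%N.
  by rewrite /alg_list size_allpairs_dep sumnE big_map.
congr addn; first by rewrite sz big_filter.
rewrite sz -big_filter.
transitivity (\sum_(p <- [seq - q | q : {poly int} <- posbox]) size (minroots p))%N; last first.
  by rewrite big_map; apply: eq_bigr => p _; rewrite size_minrootsN.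
apply: perm_big; apply: uniq_perm.
- by rewrite filter_uniq ?uniq_box.
- by rewrite map_inj_uniq ?filter_uniq ?uniq_box//; exact: oppr_inj.
have boxN q : (- q \in box n M) = (q \in box n M).
  rewrite !mem_box size_polyN; congr andb.
  by apply/height_leP/height_leP => h i; have := h i; rewrite coefN abszN.
move=> p; rewrite mem_filter; apply/idP/mapP => [/andP[/andP[sp lp] pin]|[q]].
  exists (- p); last by rewrite opprK.
  rewrite mem_filter size_polyN sp boxN pin lead_coefN oppr_gt0 !andbT /=.
  rewrite lt_neqAle leNgt lp andbT lead_coef_eq0 -size_poly_eq0.
  by rewrite (eqP sp).
rewrite mem_filter => /andP[/andP[sp lp] pin] ->.
by rewrite size_polyN sp boxN pin lead_coefN oppr_gt0 -leNgt ltW.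
Qed.

Lemma minroots_content p : content p != 1%N -> minroots p = [::].
Proof.
move=> cp; apply/eqP; rewrite -size_eq0 -[_ == _]negbK -lt0n -has_predT.
apply/hasPn => x; rewrite mem_minroots => /andP[_ /asboolP[_ c1 _]].
by move: cp; rewrite /content c1.
Qed.

Lemma minroots_le p : (size (minroots p) <= nroots S (pR R p))%N.
Proof.
rewrite size_filter; apply: sub_count => x /andP[]//.
Qed.

Lemma prim_total_lower : ((size alg_list).*2 <= prim_total n S M)%N.
Proof.
rewrite -double_alg_list /prim_total big_mkcond [leqRHS]big_mkcond; apply: leq_sum => p _.
have [cp|/minroots_content ->] := eqVneq (content p) 1%N; last by case: ifP.
by case: ifP => // _; exact: minroots_le.
Qed.

(** A root of a primitive polynomial which is not accounted for by its minimal
    polynomial comes from a polynomial of degree less than n or from a factorable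
    one; each has at most n roots. *)
Lemma prim_total_upper :
  (prim_total n S M <= (size alg_list).*2 + n * (size (box n.-1 M) + size (reducibles n M)))%N.
Proof.
have sb : (\sum_(p <- box n M | (size p <= n)%N) 1 <= size (box n.-1 M))%N.
  rewrite sum1_count -size_filter; apply: uniq_leq_size; first by rewrite filter_uniq ?uniq_box.
  by move=> p; rewrite mem_filter !mem_box (prednK n0) => /andP[-> /andP[_ ->]].
have sr : size (reducibles n M) =
    (\sum_(p <- box n M | (size p == n.+1) && `[< factorable p >]) 1)%N.
  by rewrite sum1_count -size_filter.
apply: (@leq_trans ((size alg_list).*2 + n * (\sum_(p <- box n M | (size p <= n)%N) 1 +
   size (reducibles n M)))); last by rewrite leq_add2l leq_mul2l leq_add2r sb orbT.
rewrite sr -double_alg_list /prim_total mulnDr !big_distrr /=.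
rewrite [leqLHS]big_mkcond [X in (X + _)%N]big_mkcond /= [X in (_ + (X + _))%N]big_mkcond.
rewrite [X in (_ + (_ + X))%N]big_mkcond -!big_split /= big_seq [leqRHS]big_seq.
apply: leq_sum => p pin; case: ifP => // /eqP cp.
have spn := size_pR R pin.
have nn : (nroots S (pR R p) <= n)%N by exact: nroots_le.
have sp : (size p <= n.+1)%N by move: pin; rewrite mem_box => /andP[].
move: sp; rewrite leq_eqVlt ltnS => /orP[/eqP sp|sp]; last first.
  by rewrite sp (ltn_eqF (_ : size p < n.+1)%N)//= add0n addn0 muln1.
rewrite sp eqxx ltnn /= add0n; case: asboolP => [_|nf]; first by rewrite muln1 (leq_trans nn) ?leq_addl.
rewrite addn0 /minroots size_filter; apply/eq_leq/eq_in_count => x.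
move=> /root_rootsR rx; case: (S x) => //=; apply/esym/asboolP.
exact: root_min_or_factor cp sp rx nf.
Qed.

End min_poly.

(** * Finiteness and continuity of the density *)

Section density_regularity.
Context (R : realType).
Local Notation mu := (@lebesgue_measure R).
Local Notation T := (measurableTypeR R).
Implicit Types (x c : R) (n : nat).

Lemma measurable_value_at n (x : R) : measurable_fun setT (fun p : n.-tuple T => value x p).
Proof.
exact: (measurableT_comp (@measurable_value R n) (measurable_pair1 (x : T))).
Qed.

Lemma measurable_slope_at n (x : R) : measurable_fun setT (fun p : n.-tuple T => slope x p).
Proof.
exact: (measurableT_comp (@measurable_slope R n) (measurable_pair1 (x : T))).
Qed.

Definition unit_level n (x : R) : set (n.-tuple T) := [set p | `|value x p| <= 1].
Arguments unit_level : clear implicits.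

Lemma measurable_unit_level n x : measurable (unit_level n x).
Proof.
rewrite (_ : unit_level n x = (fun p : n.-tuple T => value x p) @^-1` `[-1, 1]%classic).
  rewrite -[X in measurable X]setTI; exact: measurable_value_at.
by apply/seteqP; split => p; rewrite /unit_level /= in_itv/= ler_norml.
Qed.

Definition density_integrand n (x : R) (p : n.-tuple T) : \bar R :=
  ((fun p : n.-tuple T => (`|slope x p|)%:E) \_ (unit_level n x)) p.

Lemma measurable_density_integrand n x (D : set (n.-tuple T)) :
  measurable_fun D (density_integrand x).
Proof.
apply: measurable_funTS; apply/(measurable_restrictT _ _).1; first exact: measurable_unit_level.
apply: measurable_funTS; apply/measurable_EFinP/measurableT_comp => //.
exact: measurable_slope_at.
Qed.

Lemma density_integrandE n x :
  density n x = (\int[lebesgue_tuple R n]_(p in cube R n) density_integrand x p)%E.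
Proof.
by rewrite /density DeltaE integral_mkcondr.
Qed.

Definition slope_bound n (c : R) : R := \sum_(k < n) k.+1%:R * c ^+ k.

Lemma slope_le n x c (p : n.-tuple T) : `|x| <= c -> cube R n p -> `|slope x p| <= slope_bound n c.
Proof.
move=> xc cp; apply: le_trans (ler_norm_sum _ _ _) _; apply: ler_sum => k _.
rewrite !normrM normr_nat -mulrA ler_wpM2l// normrX -[leRHS]mul1r.
by apply: ler_pM => //; rewrite lerXn2r ?nnegrE// (le_trans _ xc).
Qed.

Lemma slope_bound_ge0 n c : 0 <= c -> 0 <= slope_bound n c.
Proof. by move=> c0; apply: sumr_ge0 => k _; rewrite mulr_ge0// exprn_ge0. Qed.

Lemma lebesgue_cube n : lebesgue_tuple R n (cube R n) = ((2 : R) ^+ n)%:E.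
Proof.
rewrite cubeE (@lebesgue_tuple_box R n (fun=> `[(-1 : R), 1]%classic)); last first.
  by move=> i; exact: measurable_itv.
under eq_bigr do rewrite lebesgue_measure_itv/= lte_fin gtrN// -EFinD opprK -[(1 + 1)%R]/(2 : R).
by rewrite prodEFin prodr_const card_ord.
Qed.

Lemma density_fin n x : density n x \is a fin_num.
Proof.
rewrite ge0_fin_numE; last exact: density_ge0.
rewrite density_integrandE.
apply: (@le_lt_trans _ _ (\int[lebesgue_tuple R n]_(p in cube R n) (slope_bound n `|x|)%:E)%E).
  apply: ge0_le_integral => //.
  - exact: measurable_cube.
  - by move=> p _; rewrite /density_integrand patchE; case: ifP => // _; rewrite lee_fin.
  - exact: measurable_density_integrand.
  - move=> p cp; rewrite /density_integrand patchE; case: ifP => _; rewrite lee_fin.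
      exact: slope_le.
    exact: slope_bound_ge0.
by rewrite integral_cst ?[X in (_ * X)%E]lebesgue_cube -?EFinM ?ltry//; exact: measurable_cube.
Qed.

Lemma value_cons n x a (p : n.-tuple T) : value x [tuple of a :: p] = a * x + x * value x p.
Proof.
rewrite /value big_ord_recl /= (tnth_nth 0) /= expr1; congr (_ + _).
rewrite mulr_sumr; apply: eq_bigr => k _.
by rewrite tnthS [in LHS]exprS mulrCA.
Qed.

Lemma measurable_level_eq n x : measurable [set p : n.-tuple T | `|value x p| = 1].
Proof.
rewrite (_ : [set p | _] = (fun p : n.-tuple T => `|value x p|) @^-1` [set 1]) //.
rewrite -[X in measurable X]setTI.
have mf : measurable_fun setT (fun p : n.-tuple T => `|value x p|).
  by apply: measurableT_comp => //; exact: measurable_value_at.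
by apply: mf => //; exact: measurable_set1.
Qed.

(** For x != 0 and the other coordinates fixed, the equation |value x p| = 1
    allows only two values of the first coordinate. *)
Lemma null_level_eq n x : x != 0 ->
  lebesgue_tuple R n.+1 [set p : n.+1.-tuple T | `|value x p| = 1] = 0%E.
Proof.
move=> x0; set N := [set p | _].
have mN : measurable N by exact: measurable_level_eq.
have -> : lebesgue_tuple R n.+1 N = (\int[lebesgue_tuple R n.+1]_p (\1_N p)%:E)%E.
  by rewrite integral_indic// setIT.
have mI : measurable_fun setT (fun p : n.+1.-tuple T => (\1_N p)%:E : \bar R).
  exact/measurable_EFinP.
rewrite integral_tupleS//.
rewrite (@fubini_tonelli _ _ _ _ _ mu (lebesgue_tuple R n)
  (fun u : T * n.-tuple T => (\1_N (@cons_pair R n u))%:E))//; last first.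
- by apply: (measurableT_comp mI); exact: measurable_cons_pair.
apply: integral0_eq => p _ /=.
pose v := value x p; pose B : set T := [set (1 - x * v) / x; (- 1 - x * v) / x].
rewrite (_ : (fun a => _) = (fun a => (\1_B a)%:E)); last first.
  apply/funext => a; rewrite !indicE; congr (_%:R%:E); congr nat_of_bool.
  have -> : (cons_pair (a, p) \in N) = (`|a * x + x * v| == 1).
    by rewrite -value_cons; apply/idP/idP => [|/eqP h]; rewrite in_setE => // h; exact/eqP.
  rewrite eqr_norml ler01 andbT; apply/idP/idP; rewrite /B in_setE.
    by case/orP => /eqP <-; [left|right]; rewrite addrK mulfK.
  by case=> ->; rewrite divfK// subrK eqxx ?orbT.
have cB : countable B by exact/finite_set_countable/finite_set2.
rewrite integral_indic//; last exact: countable_measurable.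
by rewrite setIT; exact: countable_lebesgue_measure0.
Qed.

(** Dominated convergence on the cube.  The integrand is discontinuous in x only
    when |value x p| = 1, which is negligible, and never happens if x = 0. *)
Lemma density_cvg n x0 (u : nat -> R) : (0 < n)%N -> u k @[k --> \oo] --> x0 ->
  density n (u k) @[k --> \oo] --> density n x0.
Proof.
case: n => // n _ ux.
have [c uc] : exists c : R, forall k, `|u k| <= c.
  have /cvg_seq_bounded[c [_ hc]] : cvgn u by apply/cvg_ex; exists x0.
  by exists (c + 1) => k; apply: (hc (c + 1)) => //; rewrite ltrDl.
have c0 : 0 <= c := le_trans (normr_ge0 _) (uc 0%N).
rewrite density_integrandE; under eq_fun do rewrite density_integrandE.
have H1 : \forall p \ae lebesgue_tuple R n.+1, cube R n.+1 p ->
    density_integrand (u k) p @[k --> \oo] --> density_integrand x0 p.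
  have cvv (p : n.+1.-tuple T) : value (u k) p @[k --> \oo] --> value x0 p.
    under eq_fun do rewrite valueE; rewrite valueE.
    exact: (continuous_cvg _ (@continuous_horner _ (tpoly p) x0) ux).
  have cvs (p : n.+1.-tuple T) : (`|slope (u k) p|)%:E @[k --> \oo] --> (`|slope x0 p|)%:E.
    apply: cvg_EFin; first exact: nearW.
    apply: cvg_norm; under eq_fun do rewrite /= slopeE; rewrite slopeE.
    exact: (continuous_cvg _ (@continuous_horner _ (tpoly p)^`() x0) ux).
  have good (p : n.+1.-tuple T) : `|value x0 p| != 1 ->
      density_integrand (u k) p @[k --> \oo] --> density_integrand x0 p.
    move=> ne; have nv : `|value (u k) p| @[k --> \oo] --> `|value x0 p| by exact: cvg_norm.
    rewrite {2}/density_integrand patchE; case: ltgtP ne => // lt _.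
      rewrite ifT; last by rewrite inE; exact: ltW.
      apply: cvg_trans (cvs p); apply: near_eq_cvg.
      apply: (filterS _ (cvgr_lt _ nv _ lt)) => k /= hk.
      by rewrite /density_integrand patchE ifT// inE; exact: ltW.
    rewrite ifF; last by apply/negP; rewrite inE /unit_level /= leNgt lt.
    apply: cvg_near_cst; apply: (filterS _ (cvgr_gt _ nv _ lt)) => k /= hk.
    by rewrite /density_integrand patchE ifF//; apply/negP; rewrite inE /unit_level /= leNgt hk.
  have [x00|xn0] := eqVneq x0 0.
    apply: nearW => p _; apply: good; rewrite x00 /value big1 ?normr0 1?eq_sym ?oner_eq0//.
    by move=> k _; rewrite expr0n mulr0.
  exists [set p : n.+1.-tuple T | `|value x0 p| = 1]; split.
  + exact: measurable_level_eq.
  + exact: null_level_eq.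
  + move=> p /= /not_implyP[_ np]; apply: contrapT => /eqP ne; exact/np/good.
have H2 : (lebesgue_tuple R n.+1).-integrable (cube R n.+1) (cst (slope_bound n.+1 c)%:E).
  apply/integrableP; split; first exact: measurable_cst.
  by rewrite integral_cst ?[X in (_ * X)%E]lebesgue_cube -?EFinM ?ltry//; exact: measurable_cube.
have H3 : \forall p \ae lebesgue_tuple R n.+1, forall k, cube R n.+1 p ->
    (`|density_integrand (u k) p| <= cst (slope_bound n.+1 c)%:E p)%E.
  apply: nearW => p k cp; rewrite /density_integrand patchE; case: ifP => _.
    by rewrite /= lee_fin normr_id; exact: slope_le.
  by rewrite abse0 lee_fin slope_bound_ge0.
have [_ _] := @dominated_convergence _ _ _ (lebesgue_tuple R n.+1) (cube R n.+1) (@measurable_cube R n.+1)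
  (fun k => density_integrand (u k)) (density_integrand x0) (cst (slope_bound n.+1 c)%:E)
  (fun k => @measurable_density_integrand n.+1 (u k) _) (@measurable_density_integrand n.+1 x0 _) H1 H2 H3.
exact.
Qed.

Definition phi n (x : R) : R := fine (density n x).

Lemma phiE n x : (phi n x)%:E = density n x.
Proof. by rewrite /phi fineK// density_fin. Qed.

Lemma phi_ge0 n x : 0 <= phi n x.
Proof. by rewrite /phi fine_ge0// density_ge0. Qed.

Theorem continuous_phi n : (0 < n)%N -> continuous (phi n).
Proof.
move=> n0 x; apply/(@cvg_nbhsP R R^o) => u ux.
apply: fine_cvg; rewrite phiE; exact: density_cvg.
Qed.

End density_regularity.

(** * Positivity of the density *)

Section positivity.
Context (R : realType).
Local Notation mu := (@lebesgue_measure R).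
Local Notation T := (measurableTypeR R).
Implicit Types (x : R).

(** On a small box of coefficients with the first one dominant, the value at x
    is at most 1 and the slope stays away from 0. *)
Theorem phi_gt0 n x : (0 < n)%N -> 0 < phi n x.
Proof.
case: n => // n _.
rewrite -lte_fin phiE.
pose s : R := 1 + \sum_(k < n.+1) (`|x| ^+ k.+1 + k.+1%:R * `|x| ^+ k).
have t0 (k : 'I_n.+1) : 0 <= `|x| ^+ k.+1 + k.+1%:R * `|x| ^+ k.
  by rewrite addr_ge0 ?mulr_ge0 ?exprn_ge0.
have s1 : 1 <= s by rewrite lerDl sumr_ge0.
have s0 : 0 < s by exact: lt_le_trans s1.
pose sa := \sum_(k < n.+1) `|x| ^+ k.+1.
pose sb := \sum_(k < n.+1) k.+1%:R * `|x| ^+ k.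
have sE : s = 1 + (sa + sb) by rewrite /s big_split.
have sa0 : 0 <= sa by apply: sumr_ge0 => k _; rewrite exprn_ge0.
have sb0 : 0 <= sb by apply: sumr_ge0 => k _; rewrite mulr_ge0 ?exprn_ge0.
have sV : sa <= s by lra.
have sS : sb <= s by lra.
(* With p_1 in [e/2, e] and the other p_k in [0, d], the value is at most
   e s = 1 and the slope is at least e/2 - d s = e/4. *)
pose e := s^-1; pose d := e / (4 * s).
have e0 : 0 < e by rewrite invr_gt0.
have e1 : e <= 1 by rewrite invf_le1.
have d0 : 0 < d by rewrite divr_gt0// mulr_gt0.
have de : d <= e by rewrite ler_pdivrMr ?mulr_gt0// ler_peMr ?ltW//; lra.
pose A (i : 'I_n.+1) : set T := if i == ord0 then `[(e / 2)%R, e]%classic else `[0%R, d]%classic.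
pose a (i : 'I_n.+1) : R := if i == ord0 then e / 2 else d.
have mA i : measurable (A i) by rewrite /A; case: ifP => _; exact: measurable_itv.
have lA i : mu (A i) = (a i)%:E.
  rewrite /A /a; case: ifP => _; rewrite lebesgue_measure_itv/= lte_fin.
    rewrite ifT -?EFinB; last lra.
    by congr EFin; lra.
  by rewrite d0 oppr0 adde0.
pose B := [set p : n.+1.-tuple T | forall i, A i (tnth p i)].
have mB : measurable B by exact: measurable_tuple_box.
have lB : lebesgue_tuple R n.+1 B = (\prod_i a i)%:E.
  by rewrite lebesgue_tuple_box// -prodEFin; apply: eq_bigr => i _.
have pB : 0 < \prod_i a i.
  by apply: prodr_gt0 => i _; rewrite /a; case: ifP => _ //; rewrite divr_gt0.
have Bp p : B p -> forall i, 0 <= (tnth p i : R) <= e.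
  move=> h i; have := h i; rewrite /A; case: ifP => _; rewrite /= in_itv/=; lra.
have Bcube p : B p -> cube R n.+1 p.
  by move=> /Bp h i; have := h i; rewrite ler_norml; lra.
have Bval p : B p -> `|value x p| <= 1.
  move=> /Bp h; apply: le_trans (ler_norm_sum _ _ _) _.
  apply: (@le_trans _ _ (\sum_(k < n.+1) e * `|x| ^+ k.+1)).
    apply: ler_sum => k _; rewrite normrM normrX ler_wpM2r ?exprn_ge0//.
    by rewrite ger0_norm; case/andP: (h k).
  rewrite -mulr_sumr; apply: le_trans (_ : _ <= e * s) _; first by rewrite ler_wpM2l// ltW.
  by rewrite mulVf ?gt_eqF.
have Bslope p : B p -> e / 4 <= `|slope x p|.
  move=> Bp0; rewrite /slope big_ord_recl expr0 mulr1 mul1r.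
  have hA := Bp0 ord0; rewrite /A eqxx /= in_itv/= in hA.
  have : `|\sum_(i < n) (lift ord0 i).+1%:R * (tnth p (lift ord0 i) : R) * x ^+ lift ord0 i| <= d * s.
    apply: le_trans (ler_norm_sum _ _ _) _.
    apply: (@le_trans _ _ (\sum_(i < n) d * ((lift ord0 i).+1%:R * `|x| ^+ lift ord0 i))).
      apply: ler_sum => i _; rewrite !normrM normrX normr_nat [d * _]mulrA [d * _]mulrC.
      rewrite ler_wpM2r ?exprn_ge0// ler_wpM2l//.
      have := Bp0 (lift ord0 i); rewrite /A (_ : lift ord0 i == ord0 = false) //= in_itv/=.
      by case/andP => h1 h2; rewrite ger0_norm.
    rewrite -mulr_sumr ler_wpM2l ?(ltW d0)//; apply: le_trans sS.
    by rewrite [leRHS]big_ord_recl lerDr mulr_ge0 ?exprn_ge0.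
  have -> : d * s = e / 4 by rewrite /d; field; rewrite gt_eqF.
  by rewrite ler_norml => ?; rewrite ler_normr; apply/orP; left; lra.
apply: (@lt_le_trans _ _ ((e / 4)%:E * (\prod_i a i)%:E)%E).
  by rewrite -EFinM lte_fin mulr_gt0// divr_gt0.
rewrite -lB -integral_cst// /density.
apply: (@le_trans _ _ (\int[lebesgue_tuple R n.+1]_(p in B) (`|slope x p|)%:E)%E).
  apply: ge0_le_integral => //.
  - by move=> p _; rewrite lee_fin divr_ge0// ltW.
  - apply: measurable_funTS; apply/measurable_EFinP/measurableT_comp => //.
    exact: measurable_slope_at.
apply: ge0_subset_integral => //.
- rewrite DeltaE; apply: measurableI; [exact: measurable_cube|exact: measurable_unit_level].
- apply: measurable_funTS; apply/measurable_EFinP/measurableT_comp => //.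
  exact: measurable_slope_at.
- by rewrite DeltaE => p Bp0; split; [exact: Bcube|exact: Bval].
Qed.

End positivity.

(** * Symmetries of the density *)

Section symmetry.
Context (R : realType).
Local Notation mu := (@lebesgue_measure R).
Implicit Types (p : {poly int}) (x : R) (S : pred R).

Lemma root_total_invol n M S S' (f : {poly int} -> {poly int}) :
    {in box n M, forall p, f p \in box n M} -> {in box n M, forall p, f (f p) = p} ->
    {in box n M, forall p, nroots S' (pR R (f p)) = nroots S (pR R p)} ->
  root_total n S' M = root_total n S M.
Proof.
move=> fb ff fn; rewrite /root_total.
transitivity (\sum_(p <- map f (box n M)) nroots S' (pR R p))%N.
  apply: perm_big; apply: uniq_perm; first exact: uniq_box.
    rewrite map_inj_in_uniq ?uniq_box// => p q pin qin e.
    by rewrite -(ff p)// e ff.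
  move=> p; apply/idP/mapP => [pin|[q qin ->]]; last exact: fb.
  by exists (f p); rewrite ?ff ?fb.
by rewrite big_map big_seq [RHS]big_seq; apply: eq_bigr => p pin; exact: fn.
Qed.

Definition flip n p : {poly int} := \poly_(i < n.+1) ((-1) ^+ i * p`_i).
(** The coefficients are reversed as those of a polynomial of formal degree n,
    so that reverse n is an involution of the box. *)
Definition reverse n p : {poly int} := \poly_(i < n.+1) p`_(n - i).

Lemma box_coef n M p i : p \in box n M -> (n < i)%N -> p`_i = 0.
Proof.
by rewrite mem_box => /andP[sp _] ni; rewrite nth_default// (leq_trans sp).
Qed.

Lemma box_height n M p i : p \in box n M -> (`|(p`_i)%R| <= M)%N.
Proof. by rewrite mem_box => /andP[_ /height_leP]; apply. Qed.

Lemma flip_box n M : {in box n M, forall p, flip n p \in box n M}.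
Proof.
move=> p pin; rewrite mem_box size_poly; apply/height_leP => i; rewrite coef_poly.
case: ifP => // _; rewrite abszM abszX abszN absz1 exp1n mul1n; exact: box_height pin.
Qed.

Lemma reverse_box n M : {in box n M, forall p, reverse n p \in box n M}.
Proof.
move=> p pin; rewrite mem_box size_poly; apply/height_leP => i; rewrite coef_poly.
by case: ifP => // _; exact: box_height pin.
Qed.

Lemma flipK n M : {in box n M, forall p, flip n (flip n p) = p}.
Proof.
move=> p pin; apply/polyP => i; rewrite !coef_poly; case: ltnP => [_|ni].
  by rewrite mulrA -exprMn mulrNN mulr1 expr1n mul1r.
by rewrite (box_coef pin).
Qed.

Lemma reverseK n M : {in box n M, forall p, reverse n (reverse n p) = p}.
Proof.
move=> p pin; apply/polyP => i; rewrite !coef_poly; case: ltnP => [ni|ni].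
  by rewrite ltnS leq_subr subKn.
by rewrite (box_coef pin).
Qed.

Lemma horner_box n M p x : p \in box n M -> (pR R p).[x] = \sum_(i < n.+1) (p`_i)%:~R * x ^+ i.
Proof.
move=> pin; rewrite (horner_coef_wide _ (size_pR R pin)); apply: eq_bigr => i _.
by rewrite coef_map.
Qed.

Lemma horner_flip n M p x : p \in box n M -> (pR R (flip n p)).[x] = (pR R p).[- x].
Proof.
move=> pin; rewrite (horner_box _ pin) (horner_box _ (flip_box pin)); apply: eq_bigr => i _.
by rewrite coef_poly ltn_ord intrM rmorphXn rmorphN1 [in RHS]exprNn; ring.
Qed.

Lemma horner_reverse n M p x : p \in box n M -> x != 0 ->
  (pR R (reverse n p)).[x^-1] * x ^+ n = (pR R p).[x].
Proof.
move=> pin x0; rewrite (horner_box _ pin) (horner_box _ (reverse_box pin)) mulr_suml.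
rewrite [RHS](reindex_inj rev_ord_inj) /=; apply: eq_bigr => i _.
rewrite coef_poly ltn_ord subSS -mulrA; congr (_ * _).
have hi : (i <= n)%N by rewrite -ltnS.
have -> : x ^+ n = x ^+ (n - i) * x ^+ i by rewrite -exprD subnK.
by rewrite exprVn mulrC mulfK// expf_neq0.
Qed.

Lemma flip0 n : flip n 0 = 0.
Proof. by apply/polyP => i; rewrite coef_poly !coef0 mulr0 if_same. Qed.

Lemma reverse0 n : reverse n 0 = 0.
Proof. by apply/polyP => i; rewrite coef_poly !coef0 if_same. Qed.

Lemma pR0 : pR R 0 = 0.
Proof. exact: map_poly0. Qed.

Lemma root_total_flip n M S : root_total n [pred x | S (- x)] M = root_total n S M.
Proof.
apply: (@root_total_invol _ _ _ _ (flip n)); [exact: flip_box|exact: flipK|].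
move=> p pin; have [->|p0] := eqVneq p 0.
  by rewrite flip0 pR0 !nroots0.
have f0 : flip n p != 0.
  by apply: contraNneq p0 => e; rewrite -(flipK pin) e flip0.
apply: (@nroots_bij _ _ _ _ _ -%R); rewrite ?pR_eq0//.
- by move=> x y _ _; exact: oppr_inj.
- by move=> x /= Sx; rewrite /root (horner_flip _ pin) => rx; rewrite Sx rx.
- move=> y Sy; rewrite /root => /eqP ry; exists (- y); last by rewrite opprK.
  by rewrite /= opprK Sy (horner_flip _ pin) opprK ry eqxx.
Qed.

Lemma root_total_reverse n M S : ~~ S 0 -> root_total n [pred x | S x^-1] M = root_total n S M.
Proof.
move=> S0.
apply: (@root_total_invol _ _ _ _ (reverse n)); [exact: reverse_box|exact: reverseK|].
move=> p pin; have [->|p0] := eqVneq p 0.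
  by rewrite reverse0 pR0 !nroots0.
have f0 : reverse n p != 0.
  by apply: contraNneq p0 => e; rewrite -(reverseK pin) e reverse0.
have Snz x : S x -> x != 0 by apply: contraTneq => ->.
have h x : x != 0 -> root (pR R (reverse n p)) x^-1 = root (pR R p) x.
  move=> x0; rewrite /root -(horner_reverse pin x0) mulf_eq0 expf_eq0 (negbTE x0) andbF orbF//.
apply: (@nroots_bij _ _ _ _ _ GRing.inv); rewrite ?pR_eq0//.
- by move=> x y _ _; exact: invr_inj.
- by move=> x /= Sx rx; rewrite Sx -h ?(Snz _ Sx)// invrK.
- move=> y Sy ry; exists y^-1; last by rewrite invrK.
  by have y0 := Snz _ Sy; rewrite /= invrK Sy h.
Qed.

(** Two intervals with the same root counts for all M have the same leading
    term. *)
Lemma volume_eq n S S' : convex S -> convex S' ->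
  (forall M, root_total n S' M = root_total n S M) ->
  (\int[mu]_(x in [set x | S x]) density n x = \int[mu]_(x in [set x | S' x]) density n x)%E.
Proof.
move=> cS cS' e; have [v [-> _] hv] := root_total_asymp n cS.
have [w [-> _] hw] := root_total_asymp n cS'; congr EFin.
apply/eqP; rewrite -subr_eq0 -normr_le0 leNgt; apply/negP => d0.
pose C := asymp_const R n.
have C0 : 0 <= C by have := hv 1%N isT; rewrite !expr1n mulr1; exact: le_trans.
pose M := (Num.trunc (2 * C / `|v - w|)).+1.
have M0 : 0 < M%:R :> R by rewrite ltr0n.
have : `|v - w| * M%:R <= 2 * C.
  rewrite -(ler_pM2r (_ : 0 < M%:R ^+ n)) ?exprn_gt0//.
  rewrite -mulrA -exprS -[M%:R ^+ _.+1]ger0_norm ?exprn_ge0// -normrM mulrBl.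
  have := hv M isT; have := hw M isT; rewrite e -/C !ler_norml; lra.
apply/negP; rewrite -ltNge [`|v - w| * _]mulrC -ltr_pdivrMr//; exact: truncnS_gt.
Qed.

Definition segment (a b : R) : pred R := fun z => a <= z <= b.

Lemma convex_segment a b : convex (segment a b).
Proof.
move=> x y z /andP[ax _] /andP[_ zb] /andP[xy yz].
by rewrite /segment (le_trans ax xy) (le_trans yz zb).
Qed.

Lemma integral_cst_segment a b (c : R) : a <= b ->
  (\int[mu]_(z in [set z | segment a b z]) (cst c%:E z) = (c * (b - a))%:E)%E.
Proof.
move=> ab; have SE : [set z | segment a b z] = `[a, b]%classic.
  by apply/seteqP; split => z; rewrite /= in_itv.
rewrite SE integral_cst//= lebesgue_measure_itv/= lte_fin; case: ltP => ba; first by rewrite -EFinB -EFinM.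
by rewrite (_ : b = a) ?subrr ?mule0 ?mulr0//; apply/le_anti; rewrite ab ba.
Qed.

Lemma integral_phi_near n (a b c e v : R) : (0 < n)%N -> a <= b -> 
    (forall z, a <= z <= b -> `|phi n z - c| <= e) ->
    (\int[mu]_(z in [set z | segment a b z]) density n z = v%:E)%E ->
  `|v - c * (b - a)| <= e * (b - a).
Proof.
move=> n0 ab h vE.
have mS := measurable_convex (@convex_segment a b).
have mD := measurable_density n (@convex_segment a b).
have ab0 : 0 <= b - a by rewrite subr_ge0.
have e0 : 0 <= e by apply: le_trans (h a _) => //; rewrite lexx.
have ce0 : 0 <= c + e.
  have := h a; rewrite lexx => /(_ ab); rewrite ler_norml; have := phi_ge0 n a; lra.
rewrite ler_norml; apply/andP; split; last first.
  rewrite lerBlDr -mulrDl addrC -lee_fin -vE -integral_cst_segment//.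
  apply: ge0_le_integral => //.
  - by move=> z _; exact: density_ge0.
  - by move=> z /= zab; rewrite -phiE lee_fin; have := h z zab; rewrite ler_norml; lra.
have m0 : 0 <= Num.max 0 (c - e) by rewrite le_max lexx.
rewrite lerBrDr -mulNr -mulrDl addrC.
apply: (@le_trans _ _ (Num.max 0 (c - e) * (b - a))).
  by rewrite ler_wpM2r// le_max lexx orbT.
rewrite -lee_fin -vE -integral_cst_segment//.
apply: ge0_le_integral => //.
move=> z /= zab; rewrite -phiE lee_fin ge_max phi_ge0 /=.
by have := h z zab; rewrite ler_norml; lra.
Qed.

Lemma phi_near n x (e : R) : (0 < n)%N -> 0 < e ->
  exists2 d : R, 0 < d & forall z, `|z - x| < d -> `|phi n z - phi n x| <= e.
Proof.
move=> n0 e0; have /cvgrPdist_le/(_ e e0)/nbhs_ballP[d /= d0 hd] := @continuous_phi R n n0 x.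
by exists d => // z zx; rewrite distrC; apply: hd; rewrite /ball/= distrC.
Qed.

(** Divide the equality of integrals by the length h/(a + b h) of the second
    segment and let h tend to 0: by continuity the two sides tend to a phi(x)
    and phi(y).  The general form of the length covers both x -> -x, with
    a = 1 and b = 0, and x -> 1/x, with a = x^2 and b = x. *)
Lemma phi_transport n x y (a b h0 : R) : (0 < n)%N -> 0 < a -> 0 <= b -> 0 < h0 ->
    (forall h, 0 < h -> h < h0 ->
      (\int[mu]_(z in [set z | segment x (x + h) z]) density n z =
       \int[mu]_(z in [set z | segment (y - h / (a + b * h)) y z]) density n z)%E) ->
  a * phi n x = phi n y.
Proof.
move=> n0 a0 b0 h00 hint; apply/eqP; rewrite -subr_eq0 -normr_le0 leNgt; apply/negP.
set d := `|_| => d0.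
pose e := d / (4 * (a + 2)).
have e0 : 0 < e by rewrite divr_gt0// mulr_gt0//; lra.
have [r1 r10 hr1] := phi_near x n0 e0; have [r2 r20 hr2] := phi_near y n0 e0.
have b1 : 0 < b + 1 by lra.
have ph := phi_ge0 n x.
have bp : 0 < b * phi n x + 1 by rewrite ltr_wpDl// mulr_ge0.
near (0 : R)^'+ => h.
have hp : 0 < h by near: h; exact: nbhs_right_gt.
have hh0 : h < h0 by near: h; exact: nbhs_right_lt.
have hr1' : h < r1 by near: h; exact: nbhs_right_lt.
have hr2' : h < r2 * a by near: h; apply: nbhs_right_lt; rewrite mulr_gt0.
have hb : h < 1 / (b + 1) by near: h; apply: nbhs_right_lt; rewrite divr_gt0.
have hd : h < d / 4 / (b * phi n x + 1).
  by near: h; apply: nbhs_right_lt; rewrite divr_gt0// divr_gt0.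
have bh1 : b * h <= 1 by move: hb; rewrite ltr_pdivlMr// => hb; nra.
have bhd : b * h * phi n x <= d / 4 by move: hd; rewrite ltr_pdivlMr// => hd; nra.
have bh0 : 0 <= b * h by rewrite mulr_ge0// ltW.
have ab0 : 0 < a + b * h by rewrite ltr_wpDr.
pose ll := h / (a + b * h).
have l0 : 0 < ll by rewrite divr_gt0.
have lE : ll * (a + b * h) = h by rewrite divfK// gt_eqF.
have lr2 : ll < r2 by rewrite ltr_pdivrMr// (lt_le_trans hr2')// ler_pM2l// lerDl.
have [v [vE _] _] := root_total_asymp n (@convex_segment x (x + h)).
have vE' := vE; rewrite (hint h hp hh0) in vE'.
have h1 := @integral_phi_near n x (x + h) (phi n x) e v n0 ltac:(lra) _ vE.
have h2 := @integral_phi_near n (y - ll) y (phi n y) e v n0 ltac:(lra) _ vE'.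
have {}h1 := h1 ltac:(move=> z hz; apply: hr1; rewrite ltr_norml; lra).
have {}h2 := h2 ltac:(move=> z hz; apply: hr2; rewrite ltr_norml; lra).
rewrite (_ : x + h - x = h) in h1; last by ring.
rewrite (_ : y - (y - ll) = ll) in h2; last by ring.
have key : `|phi n x * (a + b * h) - phi n y| * ll <= e * (a + b * h + 1) * ll.
  rewrite -{1}(gtr0_norm l0) -normrM.
  have -> : (phi n x * (a + b * h) - phi n y) * ll = phi n x * h - phi n y * ll.
    by rewrite -{2}lE; ring.
  have -> : e * (a + b * h + 1) * ll = e * h + e * ll by rewrite -{2}lE; ring.
  by move: h1 h2; rewrite !ler_norml; lra.
rewrite ler_pM2r// in key.
have e2 : e * (a + b * h + 1) <= d / 4.
  have -> : d / 4 = e * (a + 2) by rewrite /e; field; rewrite gt_eqF//; lra.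
  by rewrite ler_pM2l//; lra.
have : d <= `|phi n x * (a + b * h) - phi n y| + b * h * phi n x.
  have -> : d = `|(phi n x * (a + b * h) - phi n y) - b * h * phi n x| by rewrite /d; congr `|_|; ring.
  apply: le_trans (ler_normB _ _) _; rewrite lerD2l ger0_norm// mulr_ge0//.
lra.
Unshelve. all: by end_near. Qed.

Theorem phi_even n x : (0 < n)%N -> phi n (- x) = phi n x.
Proof.
move=> n0; apply/esym; rewrite -[LHS]mul1r.
apply: (@phi_transport n x (- x) 1 0 1) => // h hp _; rewrite mul0r addr0 divr1.
apply: volume_eq; try exact: convex_segment.
move=> M; rewrite -(root_total_flip n M (segment x (x + h))).
rewrite /root_total; apply: eq_bigr => p _; apply: nroots_eqS => z.
by rewrite /segment /= [x <= - z]lerNr [- z <= _]lerNl opprD andbC.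
Qed.

(** The inversion maps [x, x + h] to the segment from 1/(x + h) to 1/x, of
    length h/(x^2 + x h). *)
Lemma phi_inv_pos n x : (0 < n)%N -> 0 < x -> x ^+ 2 * phi n x = phi n x^-1.
Proof.
move=> n0 x0.
apply: (@phi_transport n x x^-1 (x ^+ 2) x 1) => //; [exact: exprn_gt0|exact: ltW|].
move=> h hp _.
have xh : 0 < x + h by rewrite addr_gt0.
have -> : x^-1 - h / (x ^+ 2 + x * h) = (x + h)^-1.
  by field; rewrite !gt_eqF// ?addr_gt0// ?exprn_gt0// mulr_gt0.
apply: volume_eq; try exact: convex_segment.
move=> M; rewrite -(@root_total_reverse n M (segment x (x + h))).
  rewrite /root_total; apply: eq_bigr => p _; apply: nroots_eqS => z.
  have inv_le : 0 < z -> (((x + h)^-1 <= z) = (z^-1 <= x + h)) * ((z <= x^-1) = (x <= z^-1)).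
    by move=> z0; rewrite -{1 3}[z]invrK !lef_pV2 ?posrE ?invr_gt0.
  rewrite /segment /=; apply/andP/andP => -[h1 h2].
    have z0 : 0 < z by apply: lt_le_trans h1; rewrite invr_gt0.
    by rewrite -!inv_le.
  have z0 : 0 < z by rewrite -invr_gt0; exact: lt_le_trans h1.
  by rewrite !inv_le.
by rewrite /segment leNgt x0.
Qed.

Theorem phi_inv n x : (0 < n)%N -> x != 0 -> x ^+ 2 * phi n x = phi n x^-1.
Proof.
move=> n0; rewrite neq_lt => /orP[xn|]; last exact: phi_inv_pos.
have := @phi_inv_pos n (- x) n0; rewrite oppr_gt0 => /(_ xn).
by rewrite sqrrN invrN !phi_even.
Qed.

End symmetry.

(** * The remainder term *)

Section final.
Context (R : realType).
Local Notation mu := (@lebesgue_measure R).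

Lemma convex_itv (I : interval R) : convex (fun x => x \in I).
Proof. by move=> x y z Sx Sz xyz; apply: (@interval_is_interval _ I x z). Qed.

Lemma integral_phiE n (D : set R) :
  (\int[mu]_(x in D) (phi n x)%:E = \int[mu]_(x in D) density n x)%E.
Proof. by apply: eq_integral => x _; rewrite phiE. Qed.

(** For Q >= e the logarithm is at least 1, which makes Q^n an admissible error.
    The four constants come from the asymptotics of primitive polynomials, the
    polynomials of degree less than n, the reducible ones, and the replacement of
    the integer part M of Q by Q in the main term. *)
Lemma remainder_le n : (1 < n)%N -> exists C : R, forall (Q : R) (I : interval R),
  expR 1 <= Q -> (`|remainder n (phi n) Q I| <= (C * (Q ^+ n * ln Q ^+ ell n))%:E)%E.
Proof.
move=> n1; have n0 := ltnW n1.
have [C1 hC1] := prim_total_asymp R n1.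
have [C2 C20 hC2] := reducibles_asymp R n1.
pose C3 : R := n%:R * 3 ^+ n; pose V := volume_bound R n.
exists (C1 + C3 + 2 * n%:R * C2 + V * n.+1%:R) => Q I hQ.
have Q1 : 1 <= Q by apply: le_trans hQ; rewrite -expR0 ler_expR.
have Q0 : 0 < Q by exact: lt_le_trans Q1.
have lnQ : 1 <= ln Q by rewrite -[leLHS]expRK ler_ln ?posrE ?expR_gt0.
pose M := Num.trunc Q; pose S : pred R := fun x => x \in I.
have M0 : (0 < M)%N by rewrite truncn_gt0.
have MQ : M%:R <= Q by rewrite truncn_le ltW.
have QM : Q < M%:R + 1 by rewrite natr1; exact: truncnS_gt.
have M1 : 1 <= M%:R :> R by rewrite ler1n.
have [v [vE /andP[v0 vV]] hv] := hC1 S (@convex_itv I).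
have {}hv := hv M M0; have {}hC2 := hC2 M M0.
have PE := @PhiE R n M S Q erefl (ltW Q0).
have lo := @prim_total_lower R n M S; have up := @prim_total_upper R n M S n0.
move: PE lo up; set N := size (alg_list _ _ _) => PE lo up.
have SE : [set` I] = [set x | S x] by [].
rewrite /remainder SE PE integral_phiE vE -EFinM -EFinB abse_EFin lee_fin.
set Z := zeta _ in hv *.
have Z1 : 1 <= Z by exact: zeta_ge1.
have Z0 : 0 < Z by exact: lt_le_trans Z1.
set E := Q ^+ n * ln Q ^+ ell n.
have l1 : 1 <= ln Q ^+ ell n by rewrite exprn_ege1.
have QE : Q ^+ n <= E by rewrite ler_peMr// exprn_ge0// ltW.
have MnQ : M%:R ^+ n <= Q ^+ n by rewrite lerXn2r ?nnegrE ?(ltW Q0).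
have Mn0 : 0 <= M%:R ^+ n :> R by rewrite exprn_ge0.
have C10 : 0 <= C1.
  have := le_trans (normr_ge0 _) hv; rewrite pmulr_lge0// exprn_gt0// ltr0n//.
pose w := v / Z.
have w0 : 0 <= w by rewrite divr_ge0// ltW.
have V0 : 0 <= V := le_trans v0 vV.
have wV : w <= V by rewrite ler_pdivrMr//; apply: le_trans vV _; rewrite ler_peMr.
have h1 : `|M%:R ^+ n.+1 * w - (prim_total n S M)%:R| <= C1 * E.
  by apply: le_trans hv _; rewrite ler_wpM2l// (le_trans MnQ).
have h2 : `|Q ^+ n.+1 * w - M%:R ^+ n.+1 * w| <= V * n.+1%:R * E.
  rewrite -mulrBl normrM (ger0_norm w0) mulrC -mulrA; apply: ler_pM => //.
  rewrite ger0_norm ?subr_ge0 ?lerXn2r ?nnegrE ?(ltW Q0)//.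
  have := expr_diff_le n (ler0n R M) MQ => /le_trans; apply.
  rewrite -mulrA ler_wpM2l//; apply: le_trans QE.
  by rewrite ler_piMl ?exprn_ge0 ?(ltW Q0)//; lra.
have h3 : n%:R * (size (box n.-1 M))%:R <= C3 * E.
  rewrite size_box (prednK n0) natrX /C3 -mulrA ler_wpM2l//.
  apply: (@le_trans _ _ (3 ^+ n * Q ^+ n)); last by rewrite ler_wpM2l ?exprn_ge0.
  rewrite -exprMn lerXn2r ?nnegrE ?mulr_ge0 ?(ltW Q0)//.
  by rewrite -natr1 -mul2n natrM; lra.
have h4 : n%:R * (size (reducibles n M))%:R <= 2 * n%:R * C2 * E.
  rewrite [2 * _]mulrC -!mulrA ler_wpM2l//; apply: le_trans hC2 _.
  rewrite [leRHS]mulrCA ler_wpM2l// /E mulrCA; apply: ler_pM => //.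
    by rewrite exprn_ge0// addr_ge0// ln_ge0.
  have lnMQ : ln M%:R <= ln Q by rewrite ler_ln ?posrE// ltr0n.
  by rewrite /ell; case: ifP => _; rewrite ?expr1 ?expr0; lra.
have h5 : `|(prim_total n S M)%:R - 2 * N%:R| <= (C3 + 2 * n%:R * C2) * E.
  rewrite ger0_norm; last by rewrite subr_ge0 -natrM ler_nat mul2n.
  rewrite lerBlDl -(ler_nat R) natrD -mul2n !natrM natrD mulrDr in up *.
  by move: up h3 h4; rewrite mulrDl; lra.
have e1 : N%:R - Q ^+ n.+1 / (2 * Z) * v = (2 * N%:R - Q ^+ n.+1 * w) / 2.
  by rewrite /w; field; rewrite gt_eqF.
rewrite e1 normrM [X in _ * X]ger0_norm ?invr_ge0//.
have E0 : 0 <= E by apply: le_trans QE; rewrite exprn_ge0// ltW.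
have : `|2 * N%:R - Q ^+ n.+1 * w| <= (C1 + C3 + 2 * n%:R * C2 + V * n.+1%:R) * E.
  by move: h1 h2 h5; rewrite !ler_norml; lra.
move=> h6; have h7 := le_trans (normr_ge0 _) h6.
by rewrite ler_pdivrMr// (le_trans h6)// ler_peMr//; lra.
Qed.

Lemma geometric_le2 n (x : R) : 0 <= x -> x <= 1 / 2 -> \sum_(k < n) x ^+ k <= 2.
Proof.
move=> x0 x2; elim: n => [|n IH]; first by rewrite big_ord0.
rewrite big_ord_recl expr0.
have -> : \sum_(i < n) x ^+ lift ord0 i = x * \sum_(i < n) x ^+ i.
  by rewrite mulr_sumr; apply: eq_bigr => i _; rewrite -exprS.
have s0 : 0 <= \sum_(i < n) x ^+ i by apply: sumr_ge0 => i _; rewrite exprn_ge0.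
have : x * \sum_(i < n) x ^+ i <= 1 / 2 * 2 by apply: ler_pM.
lra.
Qed.

(** The minimal polynomial of x != 0 has a nonzero constant term, of absolute
    value at least 1, while for x < 1/(2Q) the other terms at x add up to at most
    2 Q x < 1. *)
Lemma no_small_algebraic n (Q : R) (x : R) : 1 <= Q -> 0 < x -> x * (2 * Q) < 1 ->
  ~ algebraic_numbers n Q x.
Proof.
move=> Q1 x0 xQ [p [[rp cp minp] _ hp]].
have p0 : p != 0 by apply/eqP => p0; move: cp; rewrite p0 zcontents0.
have x2 : x <= 1 / 2 by nra.
have c0 : p`_0 != 0.
  apply/eqP => c0.
  have /factor_theorem[q qE] : root p 0 by rewrite rootE horner_coef0 c0.
  rewrite subr0 in qE.
  have q0 : q != 0 by apply: contraNneq p0 => q0; rewrite qE q0 mul0r.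
  have rq : root (pR R q) x.
    by move: rp; rewrite qE /root rmorphM /= map_polyX hornerM hornerX mulf_eq0 (gt_eqF x0) orbF.
  by have := minp q q0 rq; rewrite qE size_mulX// ltnn.
have : `|(p`_0)%:~R| < 1 :> R.
  move: rp; rewrite /root horner_coef.
  set s := size _; have s0 : (0 < s)%N by rewrite size_poly_gt0 -/(pR R p) pR_eq0.
  rewrite -(prednK s0) big_ord_recl expr0 mulr1 coef_map /= addr_eq0 => /eqP ->.
  rewrite normrN; apply: le_lt_trans (ler_norm_sum _ _ _) _.
  apply: (@le_lt_trans _ _ (\sum_(i < s.-1) Q * x * x ^+ i)).
    apply: ler_sum => i _; rewrite coef_map normrM normrX (gtr0_norm x0).
    have -> : x ^+ lift ord0 i = x * x ^+ i by rewrite -exprS.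
    rewrite mulrA.
    rewrite ler_wpM2r ?exprn_ge0 ?(ltW x0)// ler_wpM2r ?(ltW x0)//.
    apply: le_trans hp; rewrite /= -intr_norm -[`|_|%R]abszE -pmulrn ler_nat.
    exact: height_coef.
  rewrite -mulr_sumr; apply: le_lt_trans (_ : _ <= Q * x * 2) _; last by lra.
  rewrite ler_wpM2l ?mulr_ge0 ?geometric_le2// ltW//; lra.
rewrite -intr_norm -[X in _ < X](_ : 1%:~R = 1)// ltr_int.
by apply/negP; rewrite -leNgt -gtz0_ge1 normr_gt0.
Qed.

(** The factor i + 2 >= 2 keeps the interval free of algebraic numbers, and
    gives distinct families for distinct i. *)
Definition near0 (i : nat) (Q : R) : interval R := `]0, 1 / (i.+2%:R * Q)[.

(** The remainder is minus the main term, whose integral is close to phi(0)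
    times the length of the interval. *)
Lemma near0_true_order n i : (1 < n)%N ->
  true_order (fun Q => remainder n (phi n) Q (near0 i Q)) (fun Q => Q ^+ n).
Proof.
move=> n1; have n0 := ltnW n1.
pose c := phi n (0 : R); have c0 : 0 < c := phi_gt0 0 n0.
pose Z := zeta (n.+1%:R : R).
have Z0 : 0 < Z by apply: lt_le_trans (zeta_ge1 R n0).
have c20 : 0 < c / 2 by rewrite divr_gt0.
have [d d0 hd] := phi_near 0 n0 c20.
have i0 : 0 < i.+2%:R :> R by [].
have i2 : 2 <= i.+2%:R :> R by rewrite (ler_nat R 2).
(* The interval has length h = 1/((i+2) Q) < d, where phi lies between c/2 and
   3c/2, and the integral is multiplied by Q^(n+1) / (2 Z). *)
exists (c / (4 * Z * i.+2%:R)), (3 * c / (4 * Z * i.+2%:R)), (1 + 1 / d); split.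
- by rewrite divr_gt0// !mulr_gt0.
- by rewrite divr_gt0 ?mulr_gt0// !mulr_gt0.
move=> Q hQ.
have d1 : 0 < 1 / d by rewrite divr_gt0.
have Q1 : 1 <= Q by lra.
have Q0 : 0 < Q by lra.
pose h := 1 / (i.+2%:R * Q).
have h0 : 0 < h by rewrite divr_gt0// mulr_gt0.
have hQE : h * (i.+2%:R * Q) = 1 by rewrite divfK// gt_eqF// mulr_gt0.
have hd' : h < d.
  rewrite ltr_pdivrMr ?mulr_gt0//.
  have : 1 < d * Q by rewrite mulrC -ltr_pdivrMr//; lra.
  nra.
have P0 : Phi n Q [set` near0 i Q] = 0%E.
  rewrite /Phi (_ : _ `&` _ = [set x | x \in ([::] : seq R)]) ?counting_seq//.
  apply/seteqP; split => x //= [ax]; rewrite in_itv/= => /andP[x0 xh]; exfalso.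
  apply: no_small_algebraic ax => //.
  move: xh; rewrite ltr_pdivlMr ?mulr_gt0// => xh; nra.
have [v [vE _] _] := root_total_asymp n (@convex_segment _ 0 h).
have := @integral_phi_near _ n 0 h c (c / 2) v n0 (ltW h0) _ vE; rewrite subr0 => hv.
have {}hv : `|v - c * h| <= c / 2 * h.
  by apply: hv => z hz; apply: hd; rewrite subr0 ger0_norm; lra.
have IE : (\int[mu]_(x in [set` near0 i Q]) (phi n x)%:E = v%:E)%E.
  rewrite integral_phiE -vE (_ : [set z | segment 0 h z] = `[0, h]%classic); last first.
    by apply/seteqP; split => z; rewrite /= in_itv.
  rewrite (@integral_itv_bndoo _ 0 h _ true false)//.
  have := measurable_density n (@convex_itv `]0, h[); exact.
rewrite /remainder P0 IE add0e -EFinM abseN abse_EFin !lee_fin -/Z.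
have v0 : 0 <= v by move: hv; rewrite ler_norml; nra.
rewrite ger0_norm; last by rewrite mulr_ge0// divr_ge0 ?exprn_ge0 ?mulr_ge0 ?ltW.
have e (t : R) : t / (4 * Z * i.+2%:R) * Q ^+ n = Q ^+ n.+1 / (2 * Z) * (t / 2 * h).
  by rewrite /h exprS; field; rewrite !gt_eqF.
rewrite !e; have A0 : 0 <= Q ^+ n.+1 / (2 * Z) by rewrite divr_ge0 ?exprn_ge0 ?mulr_ge0 ?ltW.
by split; apply: ler_wpM2l => //; move: hv; rewrite ler_norml; lra.
Qed.

Lemma near0_families n : (1 < n)%N -> infinitely_many_families (fun I : R -> interval R =>
  true_order (fun Q => remainder n (phi n) Q (I Q)) (fun Q => Q ^+ n)).
Proof.
move=> n1; exists near0; split=> [i|i j ij Q0]; first exact: near0_true_order.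
exists (Num.max 1 Q0); split; first by rewrite le_max lexx orbT.
set Q := Num.max 1 Q0; have Q1 : 1 <= Q by rewrite le_max lexx.
have Qp : 0 < Q by lra.
suff lt a b : (a < b)%N -> [set` near0 a Q] <> [set` near0 b Q].
  by apply/eqP; case: (ltngtP i j) ij => // [/lt|/lt h _ /esym].
move=> ab E; pose x := 1 / (b.+2%:R * Q).
have : [set` near0 a Q] x.
  rewrite /= in_itv/= divr_gt0 ?mulr_gt0//= /x !div1r ltf_pV2 ?posrE ?mulr_gt0//.
  by rewrite ltr_pM2r// ltr_nat.
by rewrite E /= in_itv/= ltxx andbF.
Qed.

End final.

Theorem theorem1p1 (R : realType) (n : nat) (hn : (2 <= n)%N) :
  exists phi : R -> R,
    [/\ continuous phi,
        (forall x, 0 < phi x),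
        (exists C Q0 : R, forall (Q : R) (I : interval R), 1 < Q -> Q0 <= Q ->
          (`|remainder n phi Q I| <= (C * (Q ^+ n * ln Q ^+ ell n))%:E)%E) &
        infinitely_many_families (fun I : R -> interval R =>
          true_order (fun Q => remainder n phi Q (I Q)) (fun Q => Q ^+ n))] /\
    [/\ (forall x, phi (- x) = phi x),
        (forall x, x != 0 -> x ^+ 2 * phi x = phi x^-1) &
        (forall x, (phi x)%:E =
          (\int[lebesgue_tuple R n]_(p in Delta n x)
            (`| \sum_(k < n) k.+1%:R * (tnth p k : R) * x ^+ k |%R)%:E)%E)].
Proof.
have n0 : (0 < n)%N := ltnW hn.
exists (phi n); split; split.
- exact: continuous_phi.
- by move=> x; exact: phi_gt0.
- by have [C hC] := remainder_le R hn; exists C, (expR 1) => Q I _; exact: hC.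
- exact: near0_families.
- by move=> x; exact: phi_even.
- by move=> x; exact: phi_inv.
- by move=> x; exact: phiE.
Qed.
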